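(* Let $N\ge 1$, let $\Omega\subset\mathbb{R}^N$ be a bounded domain with smooth boundary, let $a,b>0$ be constants, and let $f\in L^{\frac{2^*}{2^*-1}}(\Omega)$ be positive a.e. in $\Omega$. For $\mu\in\mathbb{R}$ consider the problem $$-\Big(a-b\int_\Omega|\nabla u|^2dx\Big)\Delta u=\mu f(x)\ \text{ in }\Omega,\qquad u=0\ \text{ on }\partial\Omega.$$ Then there exists a constant $\mu_{**}>0$ such that this problem has exactly three (weak) solutions for $0<|\mu|<\mu_{**}$, exactly two (weak) solutions for $\mu=\pm\mu_{**}$, and exactly one (weak) solution for $|\mu|>\mu_{**}$. Moreover, for $\mu=0$ the problem has infinitely many (weak) solutions.
   Context: $2^*=\frac{2N}{N-2}$ if $N\ge 3$ and $2^*=+\infty$ if $N=1,2$ (in which case $\frac{2^*}{2^*-1}$ is read as $1$). Solutions are weak solutions: $u\in H_0^1(\Omega)$ is a solution of the problem if $\big(a-b\int_\Omega|\nabla u|^2dx\big)\int_\Omega\nabla u\cdot\nabla v\,dx=\mu\int_\Omega f v\,dx$ for all $v\in H_0^1(\Omega)$.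
   Formalization: For N=2 it is additionally assumed that fv is integrable on Ω for every v in H_0^1(Ω); for f merely in L^1(Ω) the right-hand side of the weak formulation can be infinite, and then no weak solution exists for any μ≠0. *)

(* Defs.v *)
From HB Require Import structures.
From mathcomp Require Import all_boot all_order all_algebra.
From mathcomp Require Import all_classical all_reals all_analysis.

Set Implicit Arguments.
Unset Strict Implicit.
Unset Printing Implicit Defensive.

Import Order.TTheory GRing.Theory Num.Theory.
Import numFieldNormedType.Exports.

Local Open Scope classical_set_scope.
Local Open Scope ring_scope.

(* R^N is 'rV[R]_N. Its sigma-algebra is the one generated by the coordinate
   maps, i.e. the Borel sigma-algebra. *)
Definition rV_display : measure_display -> measure_display.
Proof. exact. Qed.

Section rV_measurable.
Context {R : realType} {N : nat}.

Let coord (i : 'I_N) (x : 'rV[R]_N) : measurableTypeR R := x 0 i.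

Let rV_set0 : g_sigma_preimage coord set0.
Proof. exact: sigma_algebra0. Qed.

Let rV_setC A : g_sigma_preimage coord A -> g_sigma_preimage coord (~` A).
Proof. exact: sigma_algebraC. Qed.

Let rV_bigcup (F : (set 'rV[R]_N)^nat) :
  (forall i, g_sigma_preimage coord (F i)) ->
  g_sigma_preimage coord (\bigcup_i F i).
Proof. exact: sigma_algebra_bigcup. Qed.

HB.instance Definition _ :=
  @isMeasurable.Build (rV_display default_measure_display)
    'rV[R]_N (g_sigma_preimage coord) rV_set0 rV_setC rV_bigcup.

Lemma measurable_coord (i : 'I_N) : measurable_fun setT (coord i).
Proof.
move=> _ Y mY; rewrite setTI; apply: sub_sigma_algebra => /=.
rewrite -bigcup_seq/=; exists i => /=; first by rewrite mem_index_enum.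
by exists Y => //; rewrite setTI.
Qed.

Lemma measurable_fun_coordP d (T : measurableType d) (f : T -> 'rV[R]_N) :
  (forall i, measurable_fun setT (coord i \o f)) -> measurable_fun setT f.
Proof.
move=> mf _ Y mY; rewrite setTI.
suff : g_sigma_preimage coord `<=` [set A | measurable (f @^-1` A)] by apply.
apply: smallest_sub; first split => //=.
- by rewrite preimage_set0.
- by move=> A mA; rewrite setTD preimage_setC; exact: measurableC.
- by move=> F mF; rewrite preimage_bigcup; exact: bigcupT_measurable.
- rewrite -bigcup_seq; apply: bigcup_sub => i _ _ [B mB <-] /=.
  by rewrite setTI; have := mf i measurableT B mB; rewrite setTI.
Qed.

End rV_measurable.

(* The identification R^N * R = R^(N+1). *)
Definition rV_snoc (R : realType) (N : nat)
    (p : 'rV[R]_N * measurableTypeR R) : 'rV[R]_N.+1 :=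
  \row_(i < N.+1) if unlift ord_max i is Some j then p.1 0 j else p.2.

Lemma measurable_rV_snoc (R : realType) (N : nat) :
  measurable_fun setT (@rV_snoc R N).
Proof.
apply: measurable_fun_coordP => i; case: (unliftP ord_max i) => [j|] ->.
- apply: (eq_measurable_fun (fun p : 'rV[R]_N * measurableTypeR R =>
    (p.1 0 j : measurableTypeR R))).
    by move=> p _ /=; rewrite mxE liftK.
  exact: (measurableT_comp (measurable_coord j) measurable_fst).
- apply: (eq_measurable_fun snd); last exact: measurable_snd.
  by move=> p _ /=; rewrite mxE unlift_none.
Qed.

(* N-dimensional Lebesgue measure, as the iterated product of the
   one-dimensional one. *)
Fixpoint lebesgue_rV (R : realType) (N : nat) : set 'rV[R]_N -> \bar R :=
  if N is n.+1
  then pushforward (product_measure1 (@lebesgue_rV R n) (@lebesgue_measure R))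
         (@rV_snoc R n)
  else dirac (0 : 'rV[R]_0).

Lemma lebesgue_rV_measure (R : realType) (N : nat) :
  exists m : {measure set 'rV[R]_N -> \bar R}, @lebesgue_rV R N = m.
Proof.
elim: N => [|N [m /= ->]]; first by eexists; reflexivity.
have mf := @measurable_rV_snoc R N.
pose p : {measure set ('rV[R]_N * measurableTypeR R) -> \bar R} :=
  product_measure1 m (@lebesgue_measure R).
by exists
  (measure_function_pushforward__canonical__measure_function_Measure p mf).
Qed.

Section lebesgue_rV_instance.
Context (R : realType) (N : nat).
Local Open Scope ereal_scope.

Let leb0 : @lebesgue_rV R N set0 = 0.
Proof. by have [m ->] := lebesgue_rV_measure R N; rewrite measure0. Qed.

Let leb_ge0 A : 0 <= @lebesgue_rV R N A.
Proof. by have [m ->] := lebesgue_rV_measure R N. Qed.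

Let leb_sigma_additive : semi_sigma_additive (@lebesgue_rV R N).
Proof.
by have [m ->] := lebesgue_rV_measure R N; exact: measure_semi_sigma_additive.
Qed.

HB.instance Definition _ :=
  isMeasure.Build _ _ _ (@lebesgue_rV R N) leb0 leb_ge0 leb_sigma_additive.

End lebesgue_rV_instance.

Section calculus.
Context {R : realType} {N : nat}.
Implicit Types (f : 'rV[R]_N -> R) (A Omega : set 'rV[R]_N).

Definition partial (i : 'I_N) f : 'rV[R]_N -> R := 'D_(delta_mx 0 i) f.

(* C^oo on the whole of R^N: all iterated partial derivatives exist and are
   continuous. *)
Definition smooth f := forall s : seq 'I_N,
  continuous (foldr partial f s) /\
  forall i x, derivable (foldr partial f s) x (delta_mx 0 i).

(* The elements of C_c^oo(Omega), extended by zero to R^N. *)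
Definition test_function Omega f :=
  [/\ smooth f, compact (closure [set x | f x != 0])
    & closure [set x | f x != 0] `<=` Omega].

Definition boundary A := closure A `\` interior A.

(* Near each of its boundary points, up to relabelling and reorienting the
   coordinate axes, Omega is the open region above the graph of a smooth
   function of the N - 1 other coordinates. *)
Definition smooth_boundary Omega := forall x, boundary Omega x ->
  exists (i : 'I_N) (s : bool) (gamma : 'rV[R]_N -> R),
    [/\ smooth gamma,
        forall y z : 'rV[R]_N,
          (forall j, j != i -> y 0 j = z 0 j) -> gamma y = gamma z
      & \forall y \near x, Omega y <-> gamma y < (-1) ^+ s * y 0 i].

Definition bounded_domain Omega :=
  [/\ open Omega, connected Omega, Omega !=set0 & bounded_set Omega].

End calculus.

Section sobolev.
Context {R : realType} {N : nat}.
Variable Omega : set 'rV[R]_N.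
Implicit Types u v g : 'rV[R]_N -> R.

Local Notation leb := (@lebesgue_rV R N).

(* Functions on Omega are represented by functions on R^N, whose values outside
   Omega are irrelevant; u \_ Omega is u extended by zero. *)
Definition mem_Lp (p : \bar R) u := u \_ Omega \in Lfun leb p.

Definition is_weak_partial (i : 'I_N) u g :=
  forall phi, test_function Omega phi ->
    \int[leb]_(x in Omega) (u x * partial i phi x) =
    - \int[leb]_(x in Omega) (g x * phi x).

Definition H1 u := mem_Lp 2%:E u /\
  forall i, exists2 g, mem_Lp 2%:E g & is_weak_partial i u g.

(* A representative of the i-th weak derivative, which is unique up to a null
   set. *)
Definition weak_partial (i : 'I_N) u : 'rV[R]_N -> R :=
  get [set g | mem_Lp 2%:E g /\ is_weak_partial i u g].

Definition gradient_dot u v x :=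
  \sum_(i < N) weak_partial i u x * weak_partial i v x.

Definition H1_norm u := Num.sqrt
  (\int[leb]_(x in Omega) (u x ^+ 2) +
   \int[leb]_(x in Omega) gradient_dot u u x).

(* The closure of C_c^oo(Omega) in H^1(Omega). *)
Definition H10 u := H1 u /\
  forall e : R, 0 < e ->
    exists2 phi, test_function Omega phi & H1_norm (u \- phi) < e.

Definition weak_solution (a b : R) (f : 'rV[R]_N -> R) (mu : R) u :=
  H10 u /\ forall v, H10 v ->
    (a - b * \int[leb]_(x in Omega) gradient_dot u u x) *
      \int[leb]_(x in Omega) gradient_dot u v x =
    mu * \int[leb]_(x in Omega) (f x * v x).

(* Elements of H_0^1(Omega) are functions up to equality a.e. in Omega, so that
   solutions have to be counted modulo that equality. *)
Definition ae_class u : set ('rV[R]_N -> R) :=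
  [set v | {ae leb, forall x, Omega x -> u x = v x}].

Definition solution_classes (a b : R) (f : 'rV[R]_N -> R) (mu : R) :
    set (set ('rV[R]_N -> R)) :=
  [set ae_class u | u in weak_solution a b f mu].

End sobolev.

Definition sobolev_exponent (R : realType) (N : nat) : \bar R :=
  if (N <= 2)%N then +oo%E else (2 * N%:R / (N%:R - 2))%:E.

(* 2^* / (2^* - 1) *)
Definition dual_sobolev_exponent (R : realType) (N : nat) : \bar R :=
  if sobolev_exponent R N is p%:E then (p / (p - 1))%:E else 1%E.

(* Main.v *)
(* The form v |-> int f v is bounded for the Dirichlet inner product: by
   Sobolev's inequality for N = 1 and N >= 3 (Gagliardo-Nirenberg), and for
   N = 2, where only its finiteness is assumed, by uniform boundedness applied
   to the truncations of f.  By the Poincare inequality H10 is complete for the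
   Dirichlet inner product, so the form has a Riesz representative w, which is
   nonzero because f > 0.  For mu <> 0 the weak solutions are exactly the t w
   with (a - b |w|^2 t^2) t = mu, a cubic equation whose real roots are counted
   by comparing |mu| with the local maximum of the left-hand side.  For mu = 0
   every u with |u|^2 = a / b is a solution. *)
Require Import Defs.
From HB Require Import structures.
From mathcomp Require Import all_boot all_order all_algebra.
From mathcomp Require Import all_classical all_reals all_analysis.
From mathcomp Require Import measurable_realfun ring lra.

Set Implicit Arguments.
Unset Strict Implicit.
Unset Printing Implicit Defensive.

Import Order.TTheory GRing.Theory Num.Theory.
Import numFieldNormedType.Exports.

Local Open Scope classical_set_scope.
Local Open Scope card_scope.
Local Open Scope ring_scope.

(** Functions are not quotiented by a.e. equality, and [weak_partial] is an arbitrary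
    representative, linear only up to a null set. The Hilbert space arguments are therefore carried
    out for semi-inner products on a subset of a module; a.e. equality is absorbed by the integrals
    and returns only when classes are counted. The facts on weak derivatives rest on one identity: a
    partial derivative of a compactly supported function has integral zero. It is proved on
    coordinate lines and transferred by Tonelli. It shows that weak and classical derivatives of
    test functions agree, and, applied to x_i phi^2, yields the Poincare inequality. Uniqueness of
    weak derivatives needs a supply of smooth bumps, which are built from exp(-1/t). The
    Sobolev-type bounds on int f v are available at first for test functions only. Since f need not
    be in L2 and f v is not yet known to be integrable, the extension to [H10] passes through
    truncations of f, for which the pairing is continuous in L2. *)

Lemma card_eq_I2P (T : Type) (A : set T) (x y : T) : x <> y ->
  A = [set x; y] -> A #= `I_2.
Proof.
move=> xy ->; apply/eq_cardSP; exists x; first by left.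
rewrite (_ : _ `\ x = [set y]) ?card_set1//; apply/seteqP.
split=> [z [[->|->]//] /(_ erefl)[]|z ->].
by split; [right|move=> /esym].
Qed.

Lemma card_eq_I3P (T : Type) (A : set T) (x y z : T) :
  x <> y -> x <> z -> y <> z -> A = [set x; y; z] -> A #= `I_3.
Proof.
move=> xy xz yz ->; apply/eq_cardSP; exists x; first by left; left.
apply: (card_eq_I2P yz); apply/seteqP; split=> [t [[[->|->]|->] tx]|t [->|->]].
- by case: tx.
- by left.
- by right.
- by split; [left; right|move=> /esym].
- by split; [right|move=> /esym].
Qed.

(** * Real roots of the cubic equation (a - c t^2) t = mu *)

Section cubic.
Variables (R : rcfType) (a c : R).
Hypotheses (a_gt0 : 0 < a) (c_gt0 : 0 < c).

Definition cubic_roots (mu : R) : set R :=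
  [set t | (a - c * t ^+ 2) * t = mu].

(** The positive critical point of t |-> (a - c t^2) t. *)
Let t0 : R := Num.sqrt (a / (3 * c)).

Let ct0 : 3 * c * t0 ^+ 2 = a.
Proof. by rewrite sqr_sqrtr ?divr_ge0 ?mulr_ge0 ?ltW//; field; rewrite lt0r_neq0. Qed.

Let t0_gt0 : 0 < t0.
Proof. by rewrite sqrtr_gt0 divr_gt0 ?mulr_gt0. Qed.

(** The local maximum, attained at [t0]: a = 3 c t0^2 turns (a - c t0^2) t0 into 2 c t0^3. *)
Let m : R := 2 * c * t0 ^+ 3.

Lemma cubic_rootsN mu : cubic_roots (- mu) = [set t | cubic_roots mu (- t)].
Proof.
by apply/seteqP; split=> t; rewrite /cubic_roots/= sqrrN mulrN => h;
  [rewrite h opprK|rewrite -h opprK].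
Qed.

(** The sign change is expressed by a negative product so as to cover both directions of crossing.
    The strict bounds on t make roots found in adjacent intervals distinct. *)
Lemma cubic_roots_ivt mu x y : x <= y ->
  ((a - c * x ^+ 2) * x - mu) * ((a - c * y ^+ 2) * y - mu) < 0 ->
  exists2 t, x < t < y & cubic_roots mu t.
Proof.
move=> xy.
pose p : {poly R} := (a%:P - c%:P * 'X ^+ 2) * 'X - mu%:P.
have pE t : p.[t] = (a - c * t ^+ 2) * t - mu by rewrite !hornerE.
rewrite -!pE => pxy.
suff [t txy] : exists2 t, x <= t <= y & root p t.
  rewrite /root pE subr_eq0 => /eqP t_root; exists t => //.
  have pt : p.[t] = 0 by rewrite pE t_root subrr.
  case/andP: txy => xt ty; rewrite !lt_neqAle xt ty !andbT.
  apply/andP; split.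
    by apply: contraTneq pxy => ->; rewrite pt mul0r ltxx.
  by apply: contraTneq pxy => <-; rewrite pt mulr0 ltxx.
have [px|px] := leP p.[x] 0.
- have py : 0 <= p.[y].
    by rewrite leNgt; apply/negP => py; move: pxy; rewrite ltNge mulr_le0// ltW.
  by apply: poly_ivt => //; rewrite px py.
- have py : p.[y] <= 0.
    by rewrite leNgt; apply/negP => py; move: pxy; rewrite ltNge mulr_ge0// ltW.
  have [|t txy] := @poly_ivt _ (- p) x y xy.
  - by rewrite !hornerN oppr_le0 oppr_ge0 py ltW.
  - by rewrite rootN; exists t.
Qed.

Let cubic_root_ex mu : exists t, cubic_roots mu t.
Proof.
(* M >= 1 and c M = c + a + |mu| give (c M^2 - a) M >= c + |mu|, so the cubic minus mu is positive
   at -M and negative at M. *)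
pose M : R := 1 + a / c + `|mu| / c.
have M1 : 1 <= M by rewrite /M -addrA lerDl addr_ge0 ?divr_ge0 ?normr_ge0 ?ltW.
have cM : c * M = c + a + `|mu| by rewrite /M; field; rewrite lt0r_neq0.
have M2 : M <= M ^+ 2 by rewrite expr2 ler_peMl//; lra.
clearbody M; have kM : c * M ^+ 2 >= c + a + `|mu| by rewrite -cM ler_pM2l.
have mu1 := ler_norm mu; have mu2 : - `|mu| <= mu by rewrite lerNl -normrN ler_norm.
have mu3 : 0 <= `|mu| := normr_ge0 mu.
have k : (c * M ^+ 2 - a) * M >= c + `|mu|.
  rewrite (@le_trans _ _ (c * M ^+ 2 - a))//; first lra.
  have h : 0 <= c * M ^+ 2 - a by have := c_gt0; lra.
  by rewrite ler_peMr.
have [||t _ h] := @cubic_roots_ivt mu (- M) M; first lra; last by exists t.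
by have c0 := c_gt0; rewrite sqrrN pmulr_rlt0; lra.
Qed.

(** Vieta: there is no quadratic term, so three distinct roots sum to 0. [e1] and [e2] are the
    differences of two root equations divided by s - t and by s - u. *)
Lemma cubic_rootsP mu s t u : s != t -> cubic_roots mu s -> cubic_roots mu t ->
  cubic_roots mu u -> u <> s -> u <> t -> u = - s - t.
Proof.
rewrite /cubic_roots/= => /eqP st hs ht hu us ut.
have e1 : a = c * (s ^+ 2 + s * t + t ^+ 2).
  have h : s - t != 0 by rewrite subr_eq0; apply/eqP.
  by apply: (mulfI h); lra.
have e2 : a = c * (s ^+ 2 + s * u + u ^+ 2).
  have h : s - u != 0 by rewrite subr_eq0; apply/eqP => /esym.
  by apply: (mulfI h); lra.
have h1 : t - u != 0 by rewrite subr_eq0; apply/eqP => /esym.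
have h2 : c != 0 by rewrite gt_eqF.
apply: (mulfI h1); apply: (mulfI h2); lra.
Qed.

(** The third root is - s - t, whence mu = c s t (s + t), while t0^2 = (s^2 + s t + t^2) / 3. After
    squaring, the inequality says that the discriminant ((s - t) (2 s + t) (s + 2 t))^2 / 27 is
    non-negative. *)
Lemma cubic_roots_bound mu s t : s != t -> cubic_roots mu s ->
  cubic_roots mu t -> `|mu| <= m.
Proof.
rewrite /cubic_roots/= => /eqP st hs ht.
have e1 : a = c * (s ^+ 2 + s * t + t ^+ 2).
  have h : s - t != 0 by rewrite subr_eq0; apply/eqP.
  by apply: (mulfI h); lra.
have muE : mu = c * (s * t * (s + t)) by rewrite -hs e1; ring.
have t2 : t0 ^+ 2 = (s ^+ 2 + s * t + t ^+ 2) / 3.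
  apply: (mulfI (lt0r_neq0 c_gt0)); move: ct0; rewrite e1 => k; lra.
rewrite muE /m normrM gtr0_norm// (_ : 2 * c * _ = c * (2 * t0 ^+ 3)); last ring.
rewrite ler_pM2l//.
rewrite -ler_sqr ?nnegrE ?mulr_ge0 ?exprn_ge0 ?(ltW t0_gt0)//.
rewrite real_normK ?num_real// [(2 * _) ^+ 2]exprMn exprAC t2.
rewrite -subr_ge0.
have -> : 2 ^+ 2 * ((s ^+ 2 + s * t + t ^+ 2) / 3) ^+ 3 -
  (s * t * (s + t)) ^+ 2 =
  ((s - t) * (2 * s + t) * (s + 2 * t)) ^+ 2 / 27 by field.
by rewrite divr_ge0 ?sqr_ge0.
Qed.

Lemma card_cubic_roots : exists mustar : R, [/\ 0 < mustar,
  forall mu, 0 < `|mu| < mustar -> cubic_roots mu #= `I_3,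
  forall mu, mu = mustar \/ mu = - mustar -> cubic_roots mu #= `I_2
  & forall mu, mustar < `|mu| -> cubic_roots mu #= `I_1].
Proof.
exists m; split; first by rewrite /m !mulr_gt0 ?exprn_gt0.
- move=> mu /andP[_]; rewrite ltr_norml => /andP[mu1 mu2].
  (* The cubic equals m at t0 and -2 t0, and -m at -t0 and 2 t0, so for |mu| < m it crosses mu in
     each of the three intervals between these points. *)
  have pm : (a - c * t0 ^+ 2) * t0 - mu > 0.
    by rewrite -ct0; move: mu2; rewrite /m; lra.
  have pNm : (a - c * (- t0) ^+ 2) * (- t0) - mu < 0.
    by rewrite -ct0; move: mu1; rewrite /m; lra.
  have p2m : (a - c * (2 * t0) ^+ 2) * (2 * t0) - mu < 0.
    by rewrite -ct0; move: mu1; rewrite /m; lra.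
  have pN2m : (a - c * (- 2 * t0) ^+ 2) * (- 2 * t0) - mu > 0.
    by rewrite -ct0; move: mu2; rewrite /m; lra.
  have t0' := t0_gt0.
  have [||x /andP[x1 x2] hx] := @cubic_roots_ivt mu (- 2 * t0) (- t0); first lra.
    by rewrite pmulr_rlt0.
  have [||y /andP[y1 y2] hy] := @cubic_roots_ivt mu (- t0) t0; first lra.
    by rewrite pmulr_llt0.
  have [||z /andP[z1 z2] hz] := @cubic_roots_ivt mu t0 (2 * t0); first lra.
    by rewrite pmulr_rlt0.
  have xy : x != y by apply/eqP; lra.
  apply: (@card_eq_I3P _ _ x y z); [lra|lra|lra|].
  apply/seteqP; split => [u hu|u [[->|->]|->]]//.
  have [->|/eqP ux] := eqVneq u x; first by left; left.
  have [->|/eqP uy] := eqVneq u y; first by left; right.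
  (* A root other than x and y must be - x - y, and so must z. *)
  right; rewrite (cubic_rootsP xy hx hy hu ux uy).
  by rewrite -(cubic_rootsP xy hx hy hz)//; lra.
(* As m is a critical value, t0 is a double root of the cubic minus m; the simple root is -2 t0. *)
- have mE mu : (a - c * mu ^+ 2) * mu - m =
      - c * (mu - t0) ^+ 2 * (mu + 2 * t0) by rewrite -ct0 /m; ring.
  have S2 : cubic_roots m #= `I_2.
    apply: (@card_eq_I2P _ _ t0 (- 2 * t0)); first by have := t0_gt0; lra.
    apply/seteqP; split => [u|u hu]; rewrite /cubic_roots/=.
      move/eqP; rewrite -subr_eq0 mE !mulf_eq0 oppr_eq0 (gt_eqF c_gt0)/=.
      rewrite orbb subr_eq0 addr_eq0 => /orP[]/eqP ->; first by left.
      by right; rewrite mulNr.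
    apply/eqP; rewrite -subr_eq0 mE.
    by case: hu => ->; rewrite ?subrr ?expr0n/= ?mulr0 ?mul0r// mulNr addNr mulr0.
  move=> mu [->//|->]; rewrite cubic_rootsN.
  apply: card_eq_trans S2.
  rewrite (_ : [set t | _] = -%R @` cubic_roots m); last first.
    apply/seteqP; split => [t ht|t [s hs <-]] /=; last by rewrite opprK.
    by exists (- t) => //; rewrite opprK.
  by apply: inj_card_eq => x y _ _; exact: oppr_inj.
- move=> mu mmu; have [t ht] := cubic_root_ex mu.
  rewrite (_ : cubic_roots mu = [set t]) ?card_set1//.
  apply/seteqP; split => [s hs|s ->]//.
  apply/eqP; apply: contraTT mmu => st; rewrite -leNgt.
  exact: cubic_roots_bound st hs ht.
Qed.

End cubic.

(** * Semi-inner products: Cauchy-Schwarz, Riesz representation, uniform boundedness *)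

Section semi_inner_product.
Variables (R : realType) (V : lmodType R) (P : set V) (B : V -> V -> R).

(** The form is only semi-definite because functions that agree a.e. stay distinct, and its laws are
    required only on P because V is to be the module of all functions. *)
Definition semi_inner := [/\ P 0,
  forall c u v, P u -> P v -> P (c *: u + v),
  forall u v, P u -> P v -> B u v = B v u,
  forall c u v w, P u -> P v -> P w -> B (c *: u + v) w = c * B u w + B v w
  & forall u, P u -> 0 <= B u u].

Definition seminorm u := Num.sqrt (B u u).

Definition seminorm_complete := forall u : nat -> V, (forall n, P (u n)) ->
  (forall e, 0 < e -> exists K, forall m n, (K <= m)%N -> (K <= n)%N ->
    seminorm (u m - u n) < e) ->
  exists2 l, P l & forall e, 0 < e -> exists K, forall n, (K <= n)%N ->
    seminorm (u n - l) < e.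

Definition linear_on (L : V -> R) :=
  forall c u v, P u -> P v -> L (c *: u + v) = c * L u + L v.

Hypothesis BP : semi_inner.

Local Notation nrm := seminorm.

Lemma semi_inner0 : P 0. Proof. by case: BP. Qed.

Lemma semi_innerD u v : P u -> P v -> P (u + v).
Proof. by case: BP => _ PD _ _ _ Pu Pv; rewrite -[u]scale1r; exact: PD. Qed.

Lemma semi_innerZ c u : P u -> P (c *: u).
Proof. by case: BP => P0 PD _ _ _ Pu; rewrite -[_ *: _]addr0; exact: PD. Qed.

Lemma semi_innerB u v : P u -> P v -> P (u - v).
Proof.
by move=> Pu Pv; rewrite -scaleN1r; apply: semi_innerD => //; exact: semi_innerZ.
Qed.

Lemma innerC u v : P u -> P v -> B u v = B v u.
Proof. by case: BP => _ _ + _ _; exact. Qed.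

Lemma innerDl u v w : P u -> P v -> P w -> B (u + v) w = B u w + B v w.
Proof.
by case: BP => _ _ _ BD _ Pu Pv Pw; rewrite -[u in LHS]scale1r BD// mul1r.
Qed.

Lemma inner0l w : P w -> B 0 w = 0.
Proof.
have P0 := semi_inner0; move=> Pw; have := innerDl P0 P0 Pw.
by rewrite addr0 => /eqP; rewrite -subr_eq subrr => /eqP.
Qed.

Lemma innerZl c u w : P u -> P w -> B (c *: u) w = c * B u w.
Proof.
case: BP => P0 _ _ BD _ Pu Pw.
by rewrite -[c *: u]addr0 BD// inner0l// addr0.
Qed.

Lemma innerBl u v w : P u -> P v -> P w -> B (u - v) w = B u w - B v w.
Proof.
move=> Pu Pv Pw; rewrite -scaleN1r innerDl// ?innerZl ?mulN1r//.
exact: semi_innerZ.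
Qed.

Lemma innerDr u v w : P u -> P v -> P w -> B w (u + v) = B w u + B w v.
Proof.
move=> Pu Pv Pw; rewrite innerC ?innerDl//; last exact: semi_innerD.
by rewrite ![B _ w]innerC.
Qed.

Lemma innerZr c u w : P u -> P w -> B w (c *: u) = c * B w u.
Proof.
move=> Pu Pw; rewrite innerC ?innerZl//; last exact: semi_innerZ.
by rewrite [B _ w]innerC.
Qed.

Lemma innerBr u v w : P u -> P v -> P w -> B w (u - v) = B w u - B w v.
Proof.
move=> Pu Pv Pw; rewrite innerC ?innerBl//; last exact: semi_innerB.
by rewrite ![B _ w]innerC.
Qed.

Lemma inner_diag_eq u u' : P u -> P u' -> (forall v, P v -> B u v = B u' v) ->
  B u u = B u' u'.
Proof. by move=> Pu Pu' h; rewrite h// (innerC Pu' Pu) h. Qed.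

Lemma inner_ge0 u : P u -> 0 <= B u u. Proof. by case: BP => _ _ _ _; exact. Qed.

Lemma seminorm_ge0 u : 0 <= nrm u. Proof. exact: sqrtr_ge0. Qed.

Lemma sqr_seminorm u : P u -> nrm u ^+ 2 = B u u.
Proof. by move=> Pu; rewrite sqr_sqrtr// inner_ge0. Qed.

Lemma innerDD u v : P u -> P v -> B (u + v) (u + v) = B u u + 2 * B u v + B v v.
Proof.
move=> Pu Pv; have Puv := semi_innerD Pu Pv.
by rewrite innerDl// !innerDr// (innerC Pv Pu); ring.
Qed.

Lemma innerBB u v : P u -> P v -> B (u - v) (u - v) = B u u - 2 * B u v + B v v.
Proof.
move=> Pu Pv; have Puv := semi_innerB Pu Pv.
by rewrite innerBl// !innerBr// (innerC Pv Pu); ring.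
Qed.

Lemma inner_discriminant (x y z : R) : 0 <= z ->
  (forall t, 0 <= t ^+ 2 * x + 2 * t * y + z) -> y ^+ 2 <= z * x.
Proof.
move=> z0 h; have [x0|x0|x0] := ltgtP x 0.
(* A negative leading coefficient is refuted at t, or at t + 1 when t < 1: the value t x = -(1 + z +
   2 |y|) outweighs both 2 y and z. *)
- pose t := (1 + z) / - x + 2 * `|y| / - x.
  have tx : t * x = - (1 + z + 2 * `|y|).
    by rewrite /t; field; rewrite lt_eqF.
  have t0 : 0 < t.
    by rewrite /t -mulrDl divr_gt0 ?oppr_gt0// -addrA ltr_pwDl// addr_ge0// mulr_ge0.
  have y1 := ler_norm y; have y2 : 0 <= `|y| := normr_ge0 y.
  have [t1|t1] := leP 1 t; last first.
    have := h (t + 1); nra.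
  by have := h t; nra.
- have := h (- y / x); have -> : (- y / x) ^+ 2 * x + 2 * (- y / x) * y + z =
    (z * x - y ^+ 2) / x by field; rewrite gt_eqF.
  by rewrite pmulr_lge0 ?invr_gt0// subr_ge0.
- have [->|y0] := eqVneq y 0; first by rewrite x0 expr0n/= mulr0.
  have := h (- (z + 1) / (2 * y)); rewrite x0 mulr0 add0r.
  have -> : 2 * (- (z + 1) / (2 * y)) * y + z = - 1 by field.
  by rewrite ler0N1.
Qed.

Lemma inner_CS u v : P u -> P v -> B u v ^+ 2 <= B u u * B v v.
Proof.
move=> Pu Pv; apply: inner_discriminant; first exact: inner_ge0.
move=> t; have Ptv := semi_innerZ t Pv.
have := inner_ge0 (semi_innerD Pu Ptv).
rewrite innerDD// innerZr// innerZl// innerZr//.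
by congr (_ <= _); ring.
Qed.

Lemma inner_CS_norm u v : P u -> P v -> `|B u v| <= nrm u * nrm v.
Proof.
move=> Pu Pv; rewrite -sqrtrM ?inner_ge0// -sqrtr_sqr ler_wsqrtr//.
exact: inner_CS.
Qed.

Lemma seminormD u v : P u -> P v -> nrm (u + v) <= nrm u + nrm v.
Proof.
move=> Pu Pv; rewrite -ler_sqr ?nnegrE ?addr_ge0 ?seminorm_ge0//.
rewrite sqr_seminorm ?innerDD//; last exact: semi_innerD.
rewrite sqrrD !sqr_seminorm// lerD2r lerD2l mulr_natl ler_pMn2r//.
by rewrite (le_trans (ler_norm _))// inner_CS_norm.
Qed.

Lemma seminormZ c u : P u -> nrm (c *: u) = `|c| * nrm u.
Proof.
move=> Pu; rewrite /nrm innerZl ?innerZr//; last exact: semi_innerZ.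
by rewrite mulrA -expr2 sqrtrM ?sqr_ge0// sqrtr_sqr.
Qed.

Lemma seminormN u : P u -> nrm (- u) = nrm u.
Proof. by move=> Pu; rewrite -scaleN1r seminormZ// normrN1 mul1r. Qed.

Lemma seminormB u v : P u -> P v -> nrm (u - v) <= nrm u + nrm v.
Proof.
move=> Pu Pv; rewrite -(seminormN Pv) -scaleN1r seminormD//.
exact: semi_innerZ.
Qed.

Lemma seminorm_distC u v : P u -> P v -> nrm (u - v) = nrm (v - u).
Proof.
by move=> Pu Pv; rewrite -opprB seminormN//; exact: semi_innerB.
Qed.

Lemma linear_onD L u v : linear_on L -> P u -> P v -> L (u + v) = L u + L v.
Proof. by move=> lL Pu Pv; rewrite -[u in LHS]scale1r lL// mul1r. Qed.

Lemma linear_on0 L : linear_on L -> L 0 = 0.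
Proof.
have P0 := semi_inner0; move=> lL; have := linear_onD lL P0 P0.
by rewrite addr0 => /eqP; rewrite -subr_eq subrr => /eqP.
Qed.

Lemma linear_onZ L c u : linear_on L -> P u -> L (c *: u) = c * L u.
Proof.
move=> lL Pu; rewrite -[c *: u]addr0 lL ?(linear_on0 lL) ?addr0//.
exact: semi_inner0.
Qed.

Lemma linear_onB L u v : linear_on L -> P u -> P v -> L (u - v) = L u - L v.
Proof.
move=> lL Pu Pv; rewrite -scaleN1r (linear_onD lL)//; last exact: semi_innerZ.
by rewrite linear_onZ// mulN1r.
Qed.

Hypothesis Pc : seminorm_complete.

(* The representative is the limit of a minimising sequence of
   v |-> B v v - 2 L v. *)
Lemma riesz_representation L C : linear_on L ->
  (forall v, P v -> `|L v| <= C * nrm v) ->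
  exists2 w, P w & forall v, P v -> B w v = L v.
Proof.
move=> lL LC.
pose J v := B v v - 2 * L v.
have JD u v : P u -> P v -> J (u + v) = J u + (2 * (B u v - L v) + B v v).
  by move=> Pu Pv; rewrite /J innerDD// (linear_onD lL)//; ring.
have JC v : P v -> - C ^+ 2 <= J v.
  move=> Pv; rewrite /J -sqr_seminorm//.
  have := LC _ Pv; have := ler_norm (L v) => h1 h2.
  by have := sqr_ge0 (nrm v - C); nra.
pose S := [set J v | v in P].
have Sinf : has_inf S.
  split; first by exists (J 0), 0 => //; exact: semi_inner0.
  by exists (- C ^+ 2) => _ [v Pv <-]; exact: JC.
have infJ v : P v -> inf S <= J v.
  by move=> Pv; apply: ge_inf; [case: Sinf|exists v].
have minS n : exists v, P v /\ J v < inf S + n.+1%:R^-1.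
  have [|_ [v Pv <-] Jv] := @inf_adherent _ S n.+1%:R^-1 _ Sinf.
    by rewrite invr_gt0.
  by exists v.
have [v /all_and2[Pv Jv]] := choice minS.
(* J (v n + t u) >= inf J for all t, while J (v n) exceeds the infimum by less than 1/(n+1). The
   discriminant in t then says that v n almost satisfies the Euler equation B (v n) u = L u. *)
have disc n u : P u -> (B (v n) u - L u) ^+ 2 <= n.+1%:R^-1 * B u u.
  move=> Pu; apply: inner_discriminant; first by rewrite invr_ge0.
  move=> t; have Ptu := semi_innerZ t Pu.
  have := infJ _ (semi_innerD (Pv n) Ptu); rewrite JD//.
  rewrite innerZr// (linear_onZ _ lL)// innerZr// innerZl//.
  by have := Jv n; move: (n.+1%:R^-1) => ?; lra.
(* Parallelogram law: J at the midpoint of v m and v n is at least inf J, which makes the minimising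
   sequence Cauchy. *)
have dv m n : B (v m - v n) (v m - v n) <= 2 * (m.+1%:R^-1 + n.+1%:R^-1).
  have Pmn := semi_innerD (Pv m) (Pv n).
  have Ph := semi_innerZ 2^-1 Pmn.
  have := infJ _ Ph; rewrite /J innerZl// innerZr// (linear_onZ _ lL)//.
  rewrite innerDD// (linear_onD lL)// innerBB//.
  by have := Jv m; have := Jv n; rewrite /J; move: (n.+1%:R^-1) (m.+1%:R^-1) => ? ?; lra.
have [||w Pw vw] := Pc (u := v) => //.
  move=> e e0; have e2 : 0 < e ^+ 2 / 4 by rewrite divr_gt0// exprn_gt0.
  have [K _ hK] := (near_infty_natSinv_lt (PosNum e2)).
  exists K => m n Km Kn.
  rewrite -ltr_sqr ?nnegrE ?seminorm_ge0 ?(ltW e0)//.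
  rewrite sqr_seminorm; last exact: semi_innerB.
  have /= := hK m Km; have /= := hK n Kn; have := dv m n.
  by move: (n.+1%:R^-1) (m.+1%:R^-1) => ? ?; lra.
exists w => // u Pu; apply/eqP; rewrite -subr_eq0 -normr_le0.
apply/ler_addgt0Pl => e e0; rewrite addr0.
pose q := nrm u + 1; have q0 : 0 < q by rewrite ltr_wpDl ?seminorm_ge0.
have eq2 : 0 < (e / (2 * q)) ^+ 2 by rewrite exprn_gt0// divr_gt0// mulr_gt0.
have [K1 _ hK1] := (near_infty_natSinv_lt (PosNum eq2)).
have eq1 : 0 < e / (2 * q) by rewrite divr_gt0// mulr_gt0.
have [K2 hK2] := vw _ eq1.
pose n := maxn K1 K2.
have /= h1 := hK1 n (leq_maxl _ _); have h2 := hK2 n (leq_maxr _ _).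
have k1 : `|B (v n) u - L u| <= e / (2 * q) * nrm u.
  rewrite -ler_sqr ?nnegrE ?(mulr_ge0 (ltW eq1)) ?seminorm_ge0//.
  rewrite real_normK ?num_real// (le_trans (disc n u Pu))//.
  by rewrite exprMn sqr_seminorm// ler_wpM2r ?inner_ge0// ltW.
have k2 : `|B (v n) u - B w u| <= e / (2 * q) * nrm u.
  rewrite -innerBl// (le_trans (inner_CS_norm _ _))//; first exact: semi_innerB.
  by rewrite ler_wpM2r ?seminorm_ge0// ltW.
have k3 : e / (2 * q) * nrm u <= e / 2.
  have -> : e / (2 * q) * nrm u = e / 2 * (nrm u / q).
    by field; rewrite gt_eqF.
  rewrite ler_piMr ?divr_ge0 ?(ltW e0)// ler_pdivrMr// mul1r.
  by rewrite lerDl.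
rewrite -(subrKA (B (v n) u)) (le_trans (ler_normD _ _))//.
by rewrite distrC; lra.
Qed.

(* Gliding hump. *)
Lemma uniform_boundedness (L : nat -> V -> R) (C : nat -> R) :
  (forall k, linear_on (L k)) ->
  (forall k v, P v -> `|L k v| <= C k * nrm v) ->
  (forall v, P v -> exists M, forall k, `|L k v| <= M) ->
  exists M, forall k v, P v -> `|L k v| <= M * nrm v.
Proof.
move=> lL LC Lb; apply: contrapT => noM.
have big (M : R) : exists p : nat * V, [/\ P p.2, nrm p.2 = 1 & M <= `|L p.1 p.2|].
  apply: contrapT => h; apply: noM; exists M => k v Pv.
  have [v0|v0] := eqVneq (nrm v) 0.
    by rewrite (le_trans (LC k v Pv))// v0 !mulr0.
  have v1 : 0 < nrm v by rewrite lt_neqAle eq_sym v0 seminorm_ge0.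
  rewrite leNgt; apply/negP => Mv; apply: h; exists (k, (nrm v)^-1 *: v) => /=.
  split; first exact: semi_innerZ.
    by rewrite seminormZ// gtr0_norm ?invr_gt0// mulVf.
  rewrite (linear_onZ _ (lL k))// normrM gtr0_norm ?invr_gt0//.
  by rewrite mulrC ler_pdivlMr// ltW.
have [K KP] := choice big.
have PK M : P (K M).2 by case: (KP M).
have nK M : nrm (K M).2 = 1 by case: (KP M).
have LK M : M <= `|L (K M).1 (K M).2| by case: (KP M).
pose D k := `|C k| + 1.
have D0 k : 0 < D k by rewrite ltr_wpDl.
(* At state s with radius r = s.2, the index k and the unit vector v satisfy |L k (r v)| >= n +
   1. *)
pose kn (s : V * R) n := (K (n.+1%:R / s.2)).1.
pose vn (s : V * R) n := (K (n.+1%:R / s.2)).2.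
(* One of |L (x + h)| and |L (x - h)| is at least |L h|; with this sign the new hump h is not
   cancelled by the partial sum x. *)
pose sg (s : V * R) n : R :=
  if `|L (kn s n) (s.2 *: vn s n)| <= `|L (kn s n) (s.1 + s.2 *: vn s n)|
  then 1 else -1.
(* A state is a partial sum with the size of the next hump. Halving makes the sums converge; the
   bound 1 / (2 D) makes all later humps together change the current functional by at most 1. *)
pose step n (s : V * R) := (s.1 + sg s n *: (s.2 *: vn s n),
  Num.min (s.2 / 2) (2 * D (kn s n))^-1).
pose s := fix s n := if n is m.+1 then step m (s m) else (0, 1).
have Ps n : P (s n).1.
  elim: n => [|n ih] /=; first exact: semi_inner0.
  by apply: semi_innerD => //; do 2 apply: semi_innerZ; exact: PK.
have r0 n : 0 < (s n).2.
  by elim: n => [|n ih]//=; rewrite lt_min divr_gt0//= invr_gt0 mulr_gt0.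
have r1 n : (s n.+1).2 <= (s n).2 / 2 by rewrite /= ge_min lexx.
have r2 n : (s n).2 <= n.+1%:R^-1.
  elim: n => [|n ih]; first by rewrite /= invr1.
  rewrite (le_trans (r1 n))//.
  rewrite (@le_trans _ _ (n.+1%:R^-1 / 2)) ?ler_pM2r//.
  rewrite -invfM lef_pV2 ?posrE ?mulr_gt0// -natrM ler_nat muln2 -addnn.
  by rewrite !addSn !addnS !ltnS leq_addr.
have sg1 i : `|sg (s i) i| = 1 by rewrite /sg; case: ifP => _; rewrite ?normrN normr1.
have ds n : nrm ((s n.+1).1 - (s n).1) = (s n).2.
  rewrite /= addrAC subrr add0r !seminormZ ?nK ?mulr1//; [|exact: PK..|].
    by rewrite sg1 mul1r gtr0_norm.
  by apply: semi_innerZ; exact: PK.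
(* Telescoping: step n has length r n, and r (n+1) <= r n / 2 gives r n <= 2 r n - 2 r (n+1). *)
have dds n m : nrm ((s (n + m)%N).1 - (s n).1) <=
    2 * (s n).2 - 2 * (s (n + m)%N).2.
  elim: m => [|m ih]; first by rewrite addn0 !subrr /nrm inner0l ?sqrtr0//; exact: semi_inner0.
  rewrite addnS -(subrKA (s (n + m)%N).1).
  rewrite (le_trans (seminormD _ _))//; [exact: semi_innerB..|].
  by rewrite ds; have := r1 (n + m)%N; lra.
have [||x Px sx] := Pc (u := fun n => (s n).1) => //.
  move=> e e0; have e4 : 0 < e / 4 by rewrite divr_gt0.
  have [N _ hN] := (near_infty_natSinv_lt (PosNum e4)).
  exists N => m n Nm Nn.
  have h k : (N <= k)%N -> nrm ((s k).1 - (s N).1) < e / 2.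
    move=> Nk; have := dds N (k - N)%N; rewrite subnKC// => h.
    have /= := hN N (leqnn _); have := r2 N; have := r0 k.
    by move: (N.+1%:R^-1) => ?; lra.
  rewrite -(subrKA (s N).1) (le_lt_trans (seminormD _ _))//; [exact: semi_innerB..|].
  by have := h _ Nm; have := h _ Nn; rewrite (seminorm_distC (Ps N))//; lra.
have xs n : nrm (x - (s n).1) <= 2 * (s n).2.
  apply/ler_addgt0Pl => e e0; have [N hN] := sx _ e0.
  rewrite -(subrKA (s (n + N)%N).1) (le_trans (seminormD _ _))//; [exact: semi_innerB..|].
  apply: lerD; first by rewrite seminorm_distC// ltW// hN// leq_addl.
  by have := dds n N; have := r0 (n + N)%N; lra.
have [M hM] := Lb x Px.
have [n] : exists n : nat, M < n%:R by exists (Num.trunc M).+1; exact: truncnS_gt.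
apply/negP; rewrite -leNgt.
set k := kn (s n) n; set v := vn (s n) n.
have := hM k; set r := (s n).2.
have rr : 0 < r := r0 n.
have Pv : P v by exact: PK.
have Prv : P (r *: v) by exact: semi_innerZ.
have lr : n.+1%:R <= `|L k (r *: v)|.
  rewrite (linear_onZ _ (lL k))// normrM gtr0_norm//.
  by rewrite -ler_pdivrMl// mulrC; exact: LK.
have ls : `|L k (r *: v)| <= `|L k (s n.+1).1|.
  rewrite /= /sg; case: ifPn => [h|]; first by rewrite scale1r; exact: h.
  rewrite -ltNge -/k -/v -/r => /ltW; rewrite scaleN1r (linear_onB (lL k))// (linear_onD (lL k))//.
  set p := L k (s n).1; set q := L k (r *: v) => pq.
  have := ler_normD (p + q) (q - p).
  have -> : p + q + (q - p) = q *+ 2 by rewrite [p + q]addrC addrACA subrr addr0 mulr2n.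
  by rewrite normrMn [`|q - p|]distrC; lra.
have lx : `|L k (x - (s n.+1).1)| <= 1.
  rewrite (le_trans (LC _ _ _))//; first exact: semi_innerB.
  have h1 := xs n.+1; have h2 : (s n.+1).2 <= (2 * D k)^-1 by rewrite /= ge_min lexx orbT.
  have h3 : C k <= D k by rewrite /D (le_trans (ler_norm _))// lerDl.
  rewrite (@le_trans _ _ (D k * nrm (x - (s n.+1).1))) ?ler_wpM2r ?seminorm_ge0//.
  rewrite mulrC -ler_pdivlMr// mul1r (le_trans h1)//.
  by rewrite -ler_pdivlMl// -invfM.
(* Altogether |L k x| >= (n + 1) - 1 = n > M, against the pointwise bound M at x. *)
move: lx; rewrite (linear_onB (lL k))// distrC => lx.
have := lerB_dist (L k (s n.+1).1) (L k x).
rewrite -natr1 in lr; lra.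
Qed.

End semi_inner_product.

(** * Square-integrable functions and completeness of L2 *)

Section L2.
Context d (T : measurableType d) (R : realType) (mu : {measure set T -> \bar R}).
Variables (D : set T) (mD : measurable D).
Implicit Types u v w : T -> R.

Definition L2 : set (T -> R) := [set u : T -> R | measurable_fun D u /\
  mu.-integrable D (EFin \o (fun x => u x ^+ 2))].

Definition L2_inner u v : R := \int[mu]_(x in D) (u x * v x).

Lemma integrable_le (g f : T -> R) : measurable_fun D f ->
  (forall x, D x -> `|f x| <= g x) -> mu.-integrable D (EFin \o g) ->
  mu.-integrable D (EFin \o f).
Proof.
move=> mf fg ig; apply: le_integrable ig => //; first exact/measurable_EFinP.
by move=> x Dx /=; rewrite lee_fin (le_trans (fg x Dx))// ler_norm.
Qed.

Lemma L2_measurable u : L2 u -> measurable_fun D u. Proof. by case. Qed.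

Lemma L2_mul u v : L2 u -> L2 v -> mu.-integrable D (EFin \o (fun x => u x * v x)).
Proof.
move=> [mu_ u2] [mv v2].
apply: (@integrable_le (fun x => u x ^+ 2 + v x ^+ 2)).
- exact: measurable_funM.
- move=> x _; rewrite normrM -(real_normK (num_real (u x))).
  rewrite -(real_normK (num_real (v x))).
  have := sqr_ge0 (`|u x| - `|v x|); have := sqr_ge0 (`|u x| + `|v x|); nra.
- rewrite (_ : _ \o _ = (EFin \o (fun x => u x ^+ 2)) \+
    (EFin \o (fun x => v x ^+ 2)))//.
  exact: integrableD.
Qed.

Lemma L2_0 : L2 0.
Proof.
split; first exact: measurable_cst.
rewrite (_ : _ \o _ = cst 0%E); first exact: integrable0.
by apply/funext => x /=; rewrite expr0n.
Qed.

Lemma L2_lin c u v : L2 u -> L2 v -> L2 (c *: u + v).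
Proof.
move=> Lu Lv; have [mu_ u2] := Lu; have [mv v2] := Lv.
have m : measurable_fun D (c *: u + v).
  by apply: measurable_funD => //; apply: measurable_funM => //; exact: measurable_cst.
split => //.
apply: (@integrable_le (fun x => 2 * c ^+ 2 * u x ^+ 2 + 2 * v x ^+ 2)).
- exact: measurable_funX.
- move=> x _; rewrite ger0_norm ?sqr_ge0//.
  rewrite -[(c *: u + v) x]/(c * u x + v x).
  by have := sqr_ge0 (c * u x - v x); lra.
- by apply: eq_integrable (integrableD mD (integrableZl mD (2 * c ^+ 2) u2)
    (integrableZl mD 2 v2)).
Qed.

Lemma semi_inner_L2 : semi_inner L2 L2_inner.
Proof.
split.
- exact: L2_0.
- exact: L2_lin.
- by move=> u v _ _; rewrite /L2_inner; apply: eq_Rintegral => x _; rewrite mulrC.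
- move=> c u v w Lu Lv Lw; rewrite /L2_inner.
  rewrite -RintegralZl//; last exact: L2_mul.
  rewrite -RintegralD//; last 2 first.
  + have := integrableZl mD c (L2_mul Lu Lw); apply: eq_integrable => //.
  + exact: L2_mul.
  by apply: eq_Rintegral => x _; rewrite mulrA -mulrDl.
- by move=> u _; apply: Rintegral_ge0 => x _; rewrite -expr2 sqr_ge0.
Qed.

Lemma L2D u v : L2 u -> L2 v -> L2 (u + v).
Proof. exact: semi_innerD semi_inner_L2 _ _. Qed.

Lemma L2Z c u : L2 u -> L2 (c *: u).
Proof. exact: semi_innerZ semi_inner_L2 _ _. Qed.

Lemma L2B u v : L2 u -> L2 v -> L2 (u - v).
Proof. exact: semi_innerB semi_inner_L2 _ _. Qed.

Lemma L2_norm u : L2 u -> L2 (fun x => `|u x|).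
Proof.
move=> [mu_ u2]; split; first exact: measurableT_comp.
by under eq_fun do rewrite real_normK ?num_real//.
Qed.

Lemma L2_cst_ge (g u : T -> R) : measurable_fun D u ->
  (forall x, D x -> `|u x| <= g x) -> L2 g -> L2 u.
Proof.
move=> mu_ ug [mg g2]; split => //.
apply: (@integrable_le (fun x => g x ^+ 2)) => //; first exact: measurable_funX.
move=> x Dx; rewrite normrX ler_sqr ?nnegrE ?ug//.
by rewrite (le_trans _ (ug x Dx)).
Qed.

Lemma L2_inner_eq0 u : L2 u -> L2_inner u u = 0 ->
  {ae mu, forall x, D x -> u x = 0}.
Proof.
move=> Lu; rewrite /L2_inner /Rintegral => u0.
have [mu_ u2] := Lu; have iu := L2_mul Lu Lu.
have : (\int[mu]_(x in D) `|(u x * u x)%:E| = 0)%E.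
  under eq_integral do rewrite abse_EFin ger0_norm -?expr2 ?sqr_ge0//.
  under eq_integral do rewrite expr2.
  by rewrite -(fineK (integrable_fin_num mD iu)) u0.
move/(ae_eq_integral_abs mu mD _).1 => /(_ _).
case; first by apply/measurable_EFinP; exact: measurable_funM.
move=> N [mN N0 sN]; exists N; split => // x /= nx; apply: sN => /= h; apply: nx => Dx.
by have /= [] := h Dx => /eqP; rewrite mulf_eq0 orbb => /eqP.
Qed.

Lemma L2_ae_eq_inner u u' v : measurable_fun D u -> measurable_fun D u' ->
  measurable_fun D v ->
  {ae mu, forall x, D x -> u x = u' x} -> L2_inner u v = L2_inner u' v.
Proof.
move=> mu_ mu' mv uu'; rewrite /L2_inner /Rintegral; congr fine.
apply: ae_eq_integral => //; try by apply/measurable_EFinP; exact: measurable_funM.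
by apply: filterS uu' => x h Dx /=; rewrite h.
Qed.

Hypothesis muD : (mu D < +oo)%E.

Lemma L2_cst c : L2 (cst c).
Proof.
split; first exact: measurable_cst.
apply: measurable_bounded_integrable => //.
  by apply: measurable_funX; exact: measurable_cst.
by exists (c ^+ 2); split; rewrite ?num_real// => x cx y _ /=; rewrite ger0_norm ?sqr_ge0// ltW.
Qed.

Lemma L2_bounded u M : measurable_fun D u -> (forall x, D x -> `|u x| <= M) -> L2 u.
Proof. by move=> mu_ uM; apply: (L2_cst_ge mu_ uM); exact: L2_cst. Qed.

Lemma L2_integrable u : L2 u -> mu.-integrable D (EFin \o u).
Proof.
move=> Lu; have := L2_mul Lu (L2_cst 1); apply: eq_integrable => // x _ /=.
by rewrite mulr1.
Qed.

Local Notation nrm := (seminorm L2_inner).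

(** Fatou's lemma for the squares; in the completeness proof it supplies both the membership of the
    limit and the norm estimate. *)
Lemma L2_fatou (u : nat -> T -> R) (l : T -> R) (e : R) : (forall n, L2 (u n)) ->
  measurable_fun D l -> {ae mu, forall x, D x -> u ^~ x @ \oo --> l x} ->
  (forall n, nrm (u n) <= e) -> L2 l /\ nrm l <= e.
Proof.
move=> Lu ml ul ue.
have e0 : 0 <= e by rewrite (le_trans _ (ue 0)) ?seminorm_ge0.
have mu2 n : measurable_fun D (fun x => (u n x ^+ 2)%:E).
  by apply/measurable_EFinP; apply: measurable_funX; case: (Lu n).
have ml2 : measurable_fun D (fun x => (l x ^+ 2)%:E).
  by apply/measurable_EFinP; exact: measurable_funX.
have h : (\int[mu]_(x in D) (l x ^+ 2)%:E <= (e ^+ 2)%:E)%E.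
  apply: (@le_trans _ _ (\int[mu]_(x in D) limn_einf (fun n => (u n x ^+ 2)%:E))%E).
    apply: ae_ge0_le_integral => //.
    - by move=> x _; rewrite lee_fin sqr_ge0.
    - move=> x _; rewrite limn_einf_lim; apply: lime_ge.
        exact: is_cvg_einfs.
      by apply: nearW => n; apply: le_ereal_inf_tmp => _ [m _ <-]; rewrite lee_fin sqr_ge0.
    - apply: measurableT_comp => //; apply: measurable_fun_limn_esup => n.
      exact: measurableT_comp.
    - apply: filterS ul => x ulx Dx.
      suff /cvg_limn_einf_sup[-> _] : (u n x ^+ 2)%:E @[n --> \oo] --> (l x ^+ 2)%:E by [].
      apply: cvg_EFin; first exact: nearW.
      under eq_fun do rewrite /= expr2.
      by rewrite /= expr2; apply: cvgM; exact: ulx.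
  apply: (le_trans (fatou mu mD mu2 _)); first by move=> n x _; rewrite lee_fin sqr_ge0.
  rewrite limn_einf_lim; apply: lime_le; first exact: is_cvg_einfs.
  apply: nearW => n; apply: (@le_trans _ _ (\int[mu]_(x in D) (u n x ^+ 2)%:E)%E).
    by apply: ereal_inf_lbound; exists n => /=.
  rewrite -(fineK (integrable_fin_num mD (Lu n).2)) lee_fin.
  have : nrm (u n) ^+ 2 <= e ^+ 2 by rewrite ler_sqr ?nnegrE ?seminorm_ge0.
  by rewrite (sqr_seminorm semi_inner_L2).
have Ll : L2 l.
  split=> //; apply/integrableP; split => //.
  under eq_integral do rewrite /= ger0_norm ?sqr_ge0//.
  by rewrite (le_lt_trans h)// ltry.
split=> //; rewrite -ler_sqr ?nnegrE ?seminorm_ge0//.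
rewrite (sqr_seminorm semi_inner_L2)// -lee_fin.
by rewrite /L2_inner /Rintegral (fineK (integrable_fin_num mD Ll.2)).
Qed.

Lemma sum_half_lt2 n : \sum_(0 <= k < n) 2^-1 ^+ k <= 2 :> R.
Proof.
suff : \sum_(0 <= k < n) 2^-1 ^+ k <= 2 - 2 * 2^-1 ^+ n :> R.
  by move/le_trans; apply; rewrite gerBl mulr_ge0// exprn_ge0.
elim: n => [|n ih]; first by rewrite big_geq// expr0; lra.
by rewrite big_nat_recr//= exprS; lra.
Qed.

(* A subsequence with increments at most 2^-k converges a.e. *)
Lemma L2_complete : seminorm_complete L2 L2_inner.
Proof.
move=> u Lu uC.
have /choice[K KP] k : exists K, forall m n, (K <= m)%N -> (K <= n)%N ->
    nrm (u m - u n) < 2^-1 ^+ k by apply: uC; rewrite exprn_gt0.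
(* Summing K i + 1 over i <= k makes N k dominate every earlier threshold as well as k itself. *)
pose N k := (\sum_(i < k.+1) (K i).+1)%N.
have KN k j : (k <= j)%N -> (K k <= N j)%N.
  by move=> kj; rewrite /N (bigD1 (Ordinal (kj : k < j.+1)%N))//= (leq_trans (leqnSn _))// leq_addr.
have Nk k : (k <= N k)%N.
  rewrite /N (leq_trans (leqnSn _))// -[leqLHS](card_ord k.+1) -sum1_card.
  exact: leq_sum.
pose e k x := u (N k.+1) x - u (N k) x.
have Le k : L2 (e k) by exact: L2B.
have ne k : nrm (e k) <= 2^-1 ^+ k by apply/ltW/KP; exact: KN.
pose F x : \bar R := (\sum_(0 <= k <oo) `|e k x|%:E)%E.
have me k : measurable_fun D (fun x => `|e k x|%:E).
  by apply/measurable_EFinP; exact: measurableT_comp (Le k).1.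
have mF : measurable_fun D F by apply: ge0_emeasurable_sum.
(* Cauchy-Schwarz against the constant 1, which is in L2 because D has finite measure, bounds the
   integral of |e k| by a multiple of 2^-k. *)
have iF : (\int[mu]_(x in D) F x < +oo)%E.
  rewrite integral_nneseries//.
  apply: (@le_lt_trans _ _ (nrm (cst 1) * 2)%:E); last exact: ltry.
  apply: lime_le; first by apply: is_cvg_nneseries => n _ _; exact: integral_ge0.
  apply: nearW => n; rewrite (eq_bigr (fun k => (L2_inner (fun x => `|e k x|) (cst 1))%:E)).
    rewrite sumEFin lee_fin (@le_trans _ _ (\sum_(0 <= k < n) nrm (cst 1) * 2^-1 ^+ k))//.
      apply: ler_sum => k _; rewrite (le_trans (ler_norm _))//.
      rewrite (le_trans (inner_CS_norm semi_inner_L2 (L2_norm (Le k)) (L2_cst 1)))//.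
      rewrite mulrC ler_wpM2l ?seminorm_ge0//.
      suff -> : nrm (fun x => `|e k x|) = nrm (e k) by [].
      rewrite /seminorm /L2_inner; congr Num.sqrt.
      by apply: eq_Rintegral => x _; rewrite -!expr2 real_normK ?num_real.
    by rewrite -mulr_sumr ler_wpM2l ?seminorm_ge0// sum_half_lt2.
  move=> k _; rewrite /L2_inner /Rintegral.
  have ie := L2_mul (L2_norm (Le k)) (L2_cst 1).
  rewrite (fineK (integrable_fin_num mD ie)).
  by apply: eq_integral => x _; rewrite /= mulr1.
have F0 x : (0 <= F x)%E by apply: nneseries_ge0 => n _ _; rewrite lee_fin.
have aeF : {ae mu, forall x, D x -> (F x < +oo)%E}.
  have intF : mu.-integrable D F.
    by apply/integrableP; split => //; under eq_integral do rewrite gee0_abs//.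
  by apply: filterS (integrable_ae mD intF) => x h /h; rewrite ge0_fin_numE.
pose E := D `&` [set x | (F x < +oo)%E].
have mE : measurable E by exact: emeasurable_fun_infty_o.
have uE x : E x -> cvgn (fun k => u (N k) x).
  move=> [Dx Fx].
  have : cvgn (series (fun k => e k x)).
    apply: normed_cvg; apply: nondecreasing_is_cvgn.
      by apply: nondecreasing_series => *; exact: normr_ge0.
    exists (fine (F x)) => _ [n _ <-].
    rewrite -lee_fin fineK ?ge0_fin_numE// /series/= -sumEFin.
    by apply: nneseries_lim_ge => k _; rewrite lee_fin.
  rewrite (_ : (fun k => e k x) = telescope (fun k => u (N k) x))// telescopeK => h.
  rewrite (_ : (fun _ => _) = [sequence u (N n) x - u (N 0%N) x]_n \+ cst (u (N 0%N) x)).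
    by apply: is_cvgD => //; exact: is_cvg_cst.
  by apply/funext => n /=; rewrite subrK.
(* Multiplying by the indicator of E makes the sequence converge at every point, so that its limit
   is measurable. *)
pose h k x := u (N k) x * \1_E x.
pose l x := limn (h ^~ x).
have hl x : h ^~ x @ \oo --> l x.
  have [Ex|Ex] := pselect (E x).
    by rewrite /l /h; under eq_fun do rewrite indicE (mem_set Ex) mulr1; exact: uE.
  rewrite /l /h; under eq_fun do rewrite indicE memNset// mulr0.
  exact: is_cvg_cst.
have ml : measurable_fun D l.
  apply: (@measurable_fun_cvg _ _ _ _ h) => [m|x _]; last exact: hl.
  by apply: measurable_funM; [exact: (Lu _).1|exact: measurable_indic].
(* With n fixed, Fatou along the subsequence; the shift by K0 makes the bound hold for all its
   terms. *)
have key n e0 K0 : (forall k, (K0 <= k)%N -> nrm (u n - u (N k)) <= e0) ->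
    L2 (u n - l) /\ nrm (u n - l) <= e0.
  move=> ue; apply: (@L2_fatou (fun k => u n - u (N (k + K0)%N))).
  - by move=> k; exact: L2B.
  - by apply: measurable_funB => //; exact: (Lu _).1.
  - apply: filterS aeF => x Fx Dx.
    have Ex : E x by split => //; exact: Fx.
    apply: cvgB; first exact: cvg_cst.
    have := hl x; rewrite /h; under eq_fun do rewrite indicE (mem_set Ex) mulr1.
    by rewrite -(cvg_shiftn K0).
  - by move=> k; apply: ue; rewrite leq_addl.
have cau eps : 0 < eps -> exists K0, forall n, (K0 <= n)%N ->
    L2 (u n - l) /\ nrm (u n - l) < eps.
  move=> e0; have e2 : 0 < eps / 2 by rewrite divr_gt0.
  have [M hM] := uC _ e2; exists M => n Mn.
  have [|L h1] := key n (eps / 2) M.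
    move=> k Mk; apply/ltW/hM => //; exact: leq_trans Mk (Nk k).
  by split=> //; rewrite (le_lt_trans h1)// ltr_pdivrMr// ltr_pMr// ltr1n.
exists l.
  have [K0 /(_ K0 (leqnn _))[L _]] := cau 1 ltr01.
  by rewrite -[l](subKr (u K0)); exact: L2B.
by move=> e0 /cau[K0 h0]; exists K0 => n /h0[].
Qed.

End L2.

(** * Boxes, open sets and Lebesgue measure in R^N *)

Section rV_topology.
Context {R : realType} {N : nat}.
Implicit Types (x y a b : 'rV[R]_N) (A : set 'rV[R]_N).

Definition rVbox a b : set 'rV[R]_N := [set x | forall i, a 0 i < x 0 i < b 0 i].

Definition rVcbox a b : set 'rV[R]_N := [set x | forall i, a 0 i <= x 0 i <= b 0 i].

Lemma subset_rVbox_cbox a b : rVbox a b `<=` rVcbox a b.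
Proof. by move=> x h i; have /andP[/ltW -> /ltW ->] := h i. Qed.

Lemma rV_ballP x (e : R) y :
  ball x e y <-> 0 < e /\ forall i, `|x 0 i - y 0 i| < e.
Proof.
split=> [[e0 h]|[e0 h]]; split => // i; first exact: h.
by move=> j; rewrite [i]ord1; exact: h.
Qed.

Lemma rV_nbhsP x A : nbhs x A <-> exists2 e : R, 0 < e &
  forall y, (forall i, `|x 0 i - y 0 i| < e) -> A y.
Proof.
split=> [/nbhs_ballP[e /= e0 h]|[e e0 h]].
  by exists e => // y xy; apply: h; apply/rV_ballP.
by apply/nbhs_ballP; exists e => //= y /rV_ballP[_ /h].
Qed.

Lemma rV_coord_norm x i : `|x 0 i| <= `|x|.
Proof.
rewrite [leRHS]/Num.norm/= mx_normrE.
exact: (le_bigmax _ (fun k => `|x k.1 k.2|) (0, i)).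
Qed.

(** Corners of the cube with rational centre q.1 and half-side 1/(q.2 + 1): a countable base of the
    topology. *)
Definition ratcube (q : 'rV[rat]_N * nat) : 'rV[R]_N * 'rV[R]_N :=
  (\row_i (ratr (q.1 0 i) - q.2.+1%:R^-1), \row_i (ratr (q.1 0 i) + q.2.+1%:R^-1)).

Lemma open_ratcube A x : open A -> A x -> exists q : 'rV[rat]_N * nat,
  rVbox (ratcube q).1 (ratcube q).2 x /\
  rVcbox (ratcube q).1 (ratcube q).2 `<=` A.
Proof.
rewrite openE => /[apply] /rV_nbhsP[e e0 he].
have e2 : 0 < e / 2 by rewrite divr_gt0.
have [k _ hk] := near_infty_natSinv_lt (PosNum e2).
have {}hk : k.+1%:R^-1 < e / 2 := hk k (leqnn _).
have k0 : 0 < k.+1%:R^-1 :> R by rewrite invr_gt0.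
have [r rE] : exists r : R, k.+1%:R^-1 = r by eexists.
rewrite rE in hk k0.
have /choice[q hq] i : exists q : rat, x 0 i - r < ratr q < x 0 i + r.
  have [|q] := @rat_in_itvoo R (x 0 i - r) (x 0 i + r); first lra.
  by rewrite in_itv/=; exists q.
exists (\row_i q i, k); split=> [i|y yb].
  by rewrite !mxE/= rE; have /andP[] := hq i; lra.
apply: he => i; have := yb i; rewrite !mxE/= rE => /andP[h1 h2].
by have /andP[h3 h4] := hq i; rewrite ltr_norml; lra.
Qed.

Lemma rVbox_measurable a b : measurable (rVbox a b).
Proof.
rewrite (_ : rVbox a b = \bigcap_(i in [set: 'I_N])
    ((fun x => x 0 i : measurableTypeR R) @^-1` `]a 0 i, b 0 i[)); last first.
  apply/seteqP; split=> x h i; first by move=> _; rewrite /= in_itv/=.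
  by have := h i I; rewrite /= in_itv.
apply: fin_bigcap_measurable => // i _; rewrite -[X in measurable X]setTI.
exact: (measurable_coord i).
Qed.

(** Rational cubes make an open set a countable union of boxes. This links the topology to the
    sigma-algebra generated by the coordinates. *)
Lemma open_measurable_rV A : open A -> measurable A.
Proof.
move=> oA.
pose B q := rVbox (ratcube q).1 (ratcube q).2.
pose D := [set q | rVcbox (ratcube q).1 (ratcube q).2 `<=` A].
rewrite (_ : A = \bigcup_q (if q \in D then B q else set0)).
  apply: countable_bigcupT_measurable => [|q]; first exact: countableP.
  by case: ifP => // _; exact: rVbox_measurable.
apply/seteqP; split=> [x Ax|x [q _]].
  have [q [Bq Dq]] := open_ratcube oA Ax; exists q => //.
  by rewrite mem_set.
by case: ifPn => // /set_mem Dq /subset_rVbox_cbox; exact: Dq.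
Qed.

Lemma continuous_measurable_rV (f : 'rV[R]_N -> R) : continuous f ->
  measurable_fun setT f.
Proof.
move=> cf; apply: (measurability _ (RGenOInfty.measurableE R)).
move=> _ [_ [c ->] <-]; rewrite setTI.
apply: open_measurable_rV; apply: open_comp; first by move=> x _; exact: cf.
exact: interval_open.
Qed.

End rV_topology.

Section rV_snoc.
Context {R : realType} {N : nat}.
Implicit Types (x : 'rV[R]_N.+1) (y : 'rV[R]_N).

Definition rV_init x : 'rV[R]_N := \row_j x 0 (lift ord_max j).

Lemma rV_snoc_lift y t j : rV_snoc (y, t) 0 (lift ord_max j) = y 0 j.
Proof. by rewrite mxE liftK. Qed.

Lemma rV_snoc_max y t : rV_snoc (y, t) 0 ord_max = t.
Proof. by rewrite mxE unlift_none. Qed.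

Lemma rV_snoc_preimage_box (a b : 'rV[R]_N.+1) :
  @rV_snoc R N @^-1` rVbox a b =
  rVbox (rV_init a) (rV_init b) `*` `]a 0 ord_max, b 0 ord_max[%classic.
Proof.
apply/seteqP; split=> [[y t] h|[y t] [/= h1]].
  split=> /= [j|]; last by have := h ord_max; rewrite rV_snoc_max in_itv.
  by have := h (lift ord_max j); rewrite rV_snoc_lift !mxE.
rewrite in_itv/= => h2 i; case: (unliftP ord_max i) => [j|] ->.
  by rewrite rV_snoc_lift; have := h1 j; rewrite !mxE.
by rewrite rV_snoc_max.
Qed.

End rV_snoc.

Lemma lebesgue_rVbox (R : realType) (N : nat) (a b : 'rV[R]_N) :
  (forall i, a 0 i < b 0 i) ->
  lebesgue_rV (rVbox a b) = (\prod_(i < N) (b 0 i - a 0 i))%:E.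
Proof.
elim: N a b => [|N ih] a b ab.
  by rewrite big_ord0 /= diracE mem_set// => -[].
rewrite /= /pushforward rV_snoc_preimage_box.
rewrite product_measure1E//; last exact: rVbox_measurable.
rewrite [X in (X * _)%E](ih (rV_init a) (rV_init b)) => [|i]; last by rewrite !mxE.
rewrite [X in (_ * X)%E](lebesgue_measure_itv `]a 0 ord_max, b 0 ord_max[)/=.
rewrite lte_fin ab -EFinB -EFinM big_ord_recr/=.
congr (_%:E); congr *%R; apply: eq_bigr => i _; rewrite !mxE.
have -> : lift ord_max i = widen_ord (leqnSn N) i.
  by apply/val_inj; rewrite /= /bump leqNgt ltn_ord.
by [].
Qed.

Arguments lebesgue_rV : simpl never.

(** Tonelli's theorem asks for this; the cubes of half-side n + 1 exhaust the space. *)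
Lemma lebesgue_rV_sigma_finite (R : realType) (N : nat) :
  sigma_finite setT (@lebesgue_rV R N).
Proof.
exists (fun n => rVbox (const_mx (- n.+1%:R)) (const_mx n.+1%:R)).
  apply/esym; rewrite -subTset => x _.
  pose M := \sum_i `|x 0 i|.
  exists (Num.trunc M) => // i; rewrite !mxE -ltr_norml.
  apply: le_lt_trans (truncnS_gt M).
  by rewrite /M (bigD1 i)//= lerDl sumr_ge0.
move=> n; split; first exact: rVbox_measurable.
rewrite lebesgue_rVbox ?ltry// => i; rewrite !mxE.
by rewrite (@lt_trans _ _ 0) ?oppr_lt0.
Qed.

HB.instance Definition _ (R : realType) (N : nat) :=
  @Measure_isSigmaFinite.Build _ _ _ (@lebesgue_rV R N)
    (@lebesgue_rV_sigma_finite R N).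

Lemma lebesgue_rV_bounded (R : realType) (N : nat) (A : set 'rV[R]_N) :
  measurable A -> bounded_set A -> (lebesgue_rV A < +oo)%E.
Proof.
move=> mA [M [_ hM]]; pose r : R := `|M| + 1.
have r0 : 0 < r by rewrite ltr_wpDl.
have rM : M < r by rewrite (le_lt_trans (ler_norm _))// ltrDl.
pose c : 'rV[R]_N := const_mx (r + 1).
apply: (@le_lt_trans _ _ (lebesgue_rV (rVbox (const_mx (- (r + 1))) c))).
  apply: le_measure; rewrite ?inE//; first exact: rVbox_measurable.
  move=> x Ax i; rewrite !mxE -ltr_norml.
  rewrite (le_lt_trans (rV_coord_norm x i))// (le_lt_trans (hM _ rM x Ax))//.
  by rewrite ltrDl.
rewrite lebesgue_rVbox ?ltry// => i; rewrite !mxE.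
by rewrite (@lt_trans _ _ 0) ?oppr_lt0 ?ltr_pwDr ?ltW.
Qed.

(** * Tonelli's theorem and comparison of integrals along coordinate lines *)

Section tonelli.
Context {R : realType} {N : nat}.
Local Open Scope ereal_scope.
Variable F : 'rV[R]_N.+1 -> \bar R.
Hypotheses (mF : measurable_fun setT F) (F0 : forall x, 0 <= F x).

Let mFs : measurable_fun setT (F \o @rV_snoc R N).
Proof. exact: measurableT_comp mF (@measurable_rV_snoc R N). Qed.

Let integral_snoc : \int[@lebesgue_rV R N.+1]_x F x =
  \int[product_measure1 (@lebesgue_rV R N) lebesgue_measure]_p F (rV_snoc p).
Proof.
pose P : {measure set ('rV[R]_N * measurableTypeR R) -> \bar R} :=
  product_measure1 (@lebesgue_rV R N) lebesgue_measure.
have ms := @measurable_rV_snoc R N.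
pose Q : {measure set 'rV[R]_N.+1 -> \bar R} :=
  measure_function_pushforward__canonical__measure_function_Measure P ms.
rewrite (eq_measure_integral Q)//.
by rewrite (ge0_integral_pushforward ms)//.
Qed.

Lemma tonelli_rV1 : \int[@lebesgue_rV R N.+1]_x F x =
  \int[@lebesgue_rV R N]_y \int[lebesgue_measure]_t F (rV_snoc (y, t)).
Proof.
by rewrite integral_snoc (fubini_tonelli1 (F \o @rV_snoc R N))//= => x; exact: F0.
Qed.

Lemma tonelli_rV2 : \int[@lebesgue_rV R N.+1]_x F x =
  \int[lebesgue_measure]_t \int[@lebesgue_rV R N]_y F (rV_snoc (y, t)).
Proof.
by rewrite integral_snoc (fubini_tonelli2 (F \o @rV_snoc R N))//= => x; exact: F0.
Qed.

Lemma measurable_tonelli_rV1 :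
  measurable_fun setT (fun y => \int[lebesgue_measure]_t F (rV_snoc (y, t))).
Proof.
by apply: (measurable_fun_fubini_tonelli_F (F \o @rV_snoc R N)) => // x; exact: F0.
Qed.

Lemma measurable_tonelli_rV2 : measurable_fun setT
  (fun t : measurableTypeR R => \int[@lebesgue_rV R N]_y F (rV_snoc (y, t))).
Proof.
by apply: (measurable_fun_fubini_tonelli_G (F \o @rV_snoc R N)) => // x; exact: F0.
Qed.

Lemma measurable_snocl t : measurable_fun setT (fun y => F (rV_snoc (y, t))).
Proof. exact: (measurableT_comp mFs (measurable_pair2 t)). Qed.

End tonelli.

Definition set_coord (R : realType) (N : nat) (x : 'rV[R]_N) (i : 'I_N) (t : R) :
  'rV[R]_N := \row_j if j == i then t else x 0 j.

Section set_coord.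
Context {R : realType} {N : nat}.
Local Open Scope ereal_scope.

Lemma set_coord_snoc_max (y : 'rV[R]_N) s t :
  set_coord (rV_snoc (y, s)) ord_max t = rV_snoc (y, t).
Proof.
apply/rowP => i; rewrite mxE; case: (unliftP ord_max i) => [j|] ->.
  by rewrite eq_sym (negbTE (neq_lift _ _)) !rV_snoc_lift.
by rewrite eqxx rV_snoc_max.
Qed.

Lemma set_coord_snoc_lift (y : 'rV[R]_N) s j t :
  set_coord (rV_snoc (y, s)) (lift ord_max j) t = rV_snoc (set_coord y j t, s).
Proof.
apply/rowP => i; rewrite mxE; case: (unliftP ord_max i) => [k|] ->.
  by rewrite (inj_eq lift_inj) !rV_snoc_lift mxE.
by rewrite (negbTE (neq_lift _ _)) !rV_snoc_max.
Qed.

Lemma set_coordE (x : 'rV[R]_N) i t :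
  set_coord x i t = (x + (t - x 0 i) *: delta_mx 0 i)%R.
Proof.
apply/rowP => j; rewrite !mxE eqxx/=; case: eqVneq => [->|_].
  by rewrite mulr1 subrKC.
by rewrite mulr0 addr0.
Qed.

End set_coord.

Lemma continuous_set_coord (R : realType) (N : nat) (x : 'rV[R]_N) i : continuous (set_coord x i).
Proof.
move=> t A /rV_nbhsP[e e0 he]; apply/nbhs_ballP; exists e => //= s ts.
apply: he => j; rewrite !mxE; case: eqVneq => // _.
by rewrite subrr normr0.
Qed.

Section fiberwise.
Context {R : realType}.
Local Open Scope ereal_scope.

(** Induction on N: if i is the last coordinate, integrate along it first; otherwise slice by the
    last coordinate and use the induction hypothesis on each slice. *)
Lemma ge0_le_integral_fiber (N : nat) (i : 'I_N) (h k : 'rV[R]_N -> \bar R) :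
  measurable_fun setT h -> measurable_fun setT k ->
  (forall x, 0 <= h x) -> (forall x, 0 <= k x) ->
  (forall x, \int[lebesgue_measure]_t h (set_coord x i t) <=
             \int[lebesgue_measure]_t k (set_coord x i t)) ->
  \int[@lebesgue_rV R N]_x h x <= \int[@lebesgue_rV R N]_x k x.
Proof.
elim: N i h k => [[]//|N ih] i h k mh mk h0 k0 hk.
case: (unliftP ord_max i) => [j|] iE.
- rewrite !tonelli_rV2//; apply: ge0_le_integral => //.
  + by move=> t _; exact: integral_ge0.
  + exact: measurable_tonelli_rV2.
  + exact: measurable_tonelli_rV2.
  + move=> t _; apply: (ih j) => //; try exact: measurable_snocl.
    move=> y; have := hk (rV_snoc (y, t)); rewrite iE.
    by under eq_integral do rewrite set_coord_snoc_lift;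
       under [leRHS]eq_integral do rewrite set_coord_snoc_lift.
- rewrite !tonelli_rV1//; apply: ge0_le_integral => //.
  + by move=> t _; exact: integral_ge0.
  + exact: measurable_tonelli_rV1.
  + exact: measurable_tonelli_rV1.
  + move=> y _; have := hk (rV_snoc (y, 0%R)); rewrite iE.
    by under eq_integral do rewrite set_coord_snoc_max;
       under [leRHS]eq_integral do rewrite set_coord_snoc_max.
Qed.

End fiberwise.

(** * Smooth bump functions *)

Section flat.
Variable R : realType.
Implicit Types (k : nat) (t : R).

(* t^-k exp(-1/t), extended by zero to t <= 0; these functions are stable under
   derivation up to linear combinations. *)
Definition flat k t : R := if 0 < t then t^-1 ^+ k * expR (- t^-1) else 0.

Lemma flat_ge0 k t : 0 <= flat k t.
Proof.
by rewrite /flat; case: ifPn => // t0; rewrite mulr_ge0 ?expR_ge0// exprn_ge0// invr_ge0 ltW.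
Qed.

Lemma flat0E k : flat k 0 = 0. Proof. by rewrite /flat ltxx. Qed.

(** Raise e^x >= x at x = 1 / ((k+2) t) to the power k + 2. The two spare powers of t give the
    derivative 0 at the origin. *)
Lemma flat_le k t : flat k t <= k.+2%:R ^+ k.+2 * t ^+ 2.
Proof.
rewrite /flat; case: ifPn => [t0|_]; last by rewrite mulr_ge0 ?sqr_ge0// exprn_ge0.
have s0 : 0 < t^-1 by rewrite invr_gt0.
have e : t^-1 ^+ k.+2 <= k.+2%:R ^+ k.+2 * expR t^-1.
  have h : t^-1 / k.+2%:R <= expR (t^-1 / k.+2%:R).
    by rewrite (le_trans _ (expR_ge1Dx _))// lerDr.
  have : (t^-1 / k.+2%:R) ^+ k.+2 <= expR (t^-1 / k.+2%:R) ^+ k.+2.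
    by rewrite lerXn2r ?nnegrE ?expR_ge0 ?divr_ge0 ?(ltW s0).
  rewrite -expRM_natl mulrCA mulfV ?mulr1 ?pnatr_eq0//.
  by rewrite exprMn [k.+2%:R^-1 ^+ _]exprVn ler_pdivrMr ?exprn_gt0 ?ltr0n// mulrC.
rewrite expRN ler_pdivrMr ?expR_gt0//.
have -> : t^-1 ^+ k = t^-1 ^+ k.+2 * t ^+ 2.
  by rewrite -(addn2 k) exprD -mulrA -exprMn mulVf ?gt_eqF// expr1n mulr1.
by rewrite [leRHS]mulrAC ler_pM2r ?exprn_gt0.
Qed.

Lemma is_derive_flat k t :
  is_derive t 1 (flat k) (flat k.+2 t - k%:R * flat k.+1 t).
Proof.
have [t0|t0|->] := ltgtP t 0.
- rewrite /flat !ltNge (ltW t0)/= mulr0 subr0.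
  apply: (@near_eq_is_derive _ _ _ (cst 0)).
  near=> u; rewrite /flat ltNge (_ : u <= 0)//.
  by near: u; apply: filterS (lt_nbhsl t0) => u /ltW.
- have h : is_derive t 1 (fun u => u^-1 ^+ k * expR (- u^-1))
    (t^-1 ^+ k.+2 * expR (- t^-1) - k%:R * (t^-1 ^+ k.+1 * expR (- t^-1))).
    have tn0 : t != 0 by rewrite gt_eqF.
    have dV : is_derive t 1 (fun u : R => u^-1) (- t ^- 2 *: 1) by exact: is_deriveV.
    have dX := @is_deriveX _ _ (fun u : R => u^-1) k t 1 _ dV.
    have dN := @is_deriveN _ _ _ (fun u : R => u^-1) t 1 _ dV.
    have dE := @is_derive1_comp _ expR (- (fun u : R => u^-1)) t _ _ (is_derive_expR _) dN.
    have := is_deriveM dX dE.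
    rewrite (_ : _ * _ = (fun u => u^-1 ^+ k * expR (- u^-1))); last first.
      by apply/funext => u; rewrite !fctE.
    move/is_derive_eq; apply.
    rewrite /GRing.scale/= mulr1 -exprVn /=.
    rewrite !fctE /=; case: k {dX} => [|k] /=; first by rewrite expr0; ring.
    by rewrite !exprS; ring.
  rewrite [flat k.+2 t]/flat [flat k.+1 t]/flat t0; apply: near_eq_is_derive h.
  by near=> u; rewrite /flat (_ : 0 < u)//; near: u; exact: lt_nbhsr.
(* At 0 the difference quotient is flat k z / z, which is at most C |z| in absolute value. *)
- rewrite !flat0E mulr0 subr0; apply/is_derive1_caratheodory.
  exists (fun z => flat k z / z); split.
  + move=> z; rewrite flat0E !subr0; have [->|z0] := eqVneq z 0.
      by rewrite mulr0 flat0E.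
    by rewrite divfK.
  + rewrite /prop_for /continuous_at flat0E mul0r.
    set C : R := k.+2%:R ^+ k.+2.
    have C0 : C * `|z| @[z --> (0 : R)] --> 0.
      rewrite -[X in _ --> X](mulr0 C) -[X in _ * X](@normr0 _ R).
      by apply: cvgM; [exact: cvg_cst|exact: norm_continuous].
    apply: (@squeeze_cvgr _ _ _ _ (fun z => - (C * `|z|)) (fun z => C * `|z|)) => //.
      apply: nearW => z; rewrite -ler_norml normrM normfV ger0_norm ?flat_ge0//.
      have [->|z0] := eqVneq z 0; first by rewrite normr0 invr0 !mulr0.
      rewrite ler_pdivrMr ?normr_gt0// -mulrA -normrM -expr2 ger0_norm ?sqr_ge0//.
      exact: flat_le.
    by rewrite -[X in _ --> X]oppr0; exact: cvgN.
  + by rewrite flat0E mul0r.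
Unshelve. all: by end_near. Qed.

Lemma flat0_gt0 t : (0 < flat 0 t) = (0 < t).
Proof. by rewrite /flat; case: ifPn; rewrite ?ltxx// => _; rewrite expr0 mul1r expR_gt0. Qed.

Lemma flat0_le1 t : flat 0 t <= 1.
Proof.
rewrite /flat; case: ifPn => // t0; rewrite expr0 mul1r -expR0 ler_expR.
by rewrite oppr_le0 invr_ge0 ltW.
Qed.

Lemma cvg_flat0 t : 0 < t -> flat 0 (n.+1%:R * t) @[n --> \oo] --> (1 : R).
Proof.
move=> t0; rewrite /flat; under eq_fun do rewrite pmulr_rgt0// t0 expr0 mul1r invfM.
have h : - (n.+1%:R^-1 * t^-1) @[n --> \oo] --> - (0 * t^-1).
  by apply: cvgN; apply: cvgMr_tmp; exact: cvg_harmonic.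
have := @continuous_cvg _ _ _ _ _ _ expR _ (@continuous_expR R _) h.
by rewrite mul0r oppr0 expR0 => H; exact: H.
Qed.

End flat.

Section continuous_arith.
Context {R : realType} {T : topologicalType}.
Implicit Types f g : T -> R.

Lemma continuous_addf f g : continuous f -> continuous g ->
  continuous (fun x => f x + g x).
Proof. by move=> cf cg x; apply: cvgD; [exact: cf|exact: cg]. Qed.

Lemma continuous_mulf f g : continuous f -> continuous g ->
  continuous (fun x => f x * g x).
Proof. by move=> cf cg x; apply: cvgM; [exact: cf|exact: cg]. Qed.

End continuous_arith.

Section line_derivative.
Context {R : realType} {N : nat}.
Implicit Types (f g : 'rV[R]_N -> R) (x a b : 'rV[R]_N) (i : 'I_N).

(** Opens partial derivatives to one-variable calculus: chain rule, fundamental theorem. *)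
Lemma is_derive_line f x i t df :
  is_derive (set_coord x i t) (delta_mx 0 i) f df <->
  is_derive (t : R) 1 (fun h => f (set_coord x i h)) df.
Proof.
suff e : (fun h => h^-1 *: ((f \o shift (set_coord x i t)) (h *: delta_mx 0 i)
      - f (set_coord x i t))) =
    (fun h : R => h^-1 *: (((fun h => f (set_coord x i h)) \o shift t) (h *: 1)
      - f (set_coord x i t))).
  by split=> -[d v]; constructor; move: d v; rewrite /derivable /derive e.
apply/funext => h /=; congr (_ *: (f _ - _)).
apply/rowP => j; rewrite !mxE eqxx/=; case: eqVneq => [_|_].
  by rewrite /GRing.scale/= !mulr1.
by rewrite mulr0 add0r.
Qed.

Lemma set_coord_id x i : set_coord x i (x 0 i) = x.
Proof. by rewrite set_coordE subrr scale0r addr0. Qed.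

Lemma set_coord_same x i t : set_coord x i t 0 i = t.
Proof. by rewrite mxE eqxx. Qed.

Lemma is_derive_coord (g : R -> R) (i j : 'I_N) c e x dg :
  is_derive (c * x 0 i + e) 1 g dg ->
  is_derive x (delta_mx 0 j) (fun y => g (c * y 0 i + e))
    (if i == j then c * dg else 0).
Proof.
move=> gd; rewrite -(set_coord_id x j); apply/is_derive_line.
under eq_fun do rewrite mxE.
case: eqVneq => [ij|ij]; last exact: is_derive_cst.
have h : is_derive (x 0 j) 1 (fun u => c * u + e) c.
  have H := is_deriveD (is_deriveZ c (is_derive_id (x 0 j) (1 : R))) (is_derive_cst e (x 0 j) 1).
  by apply: is_derive_eq H _; rewrite addr0 /GRing.scale/= mulr1.
rewrite mulrC; apply: (@is_derive1_comp _ g (fun u => c * u + e)) => //.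
by rewrite -ij.
Qed.

Lemma smooth_partial i f : smooth f -> smooth (partial i f).
Proof. by move=> sf s; have := sf (rcons s i); rewrite foldr_rcons. Qed.

Lemma smooth_continuous f : smooth f -> continuous f.
Proof. by move=> /(_ [::])[]. Qed.

Lemma smooth_is_derive f i x : smooth f ->
  is_derive x (delta_mx 0 i) f (partial i f x).
Proof. by move=> /(_ [::])[_ /(_ i x)/derivableP]. Qed.

(** A coinduction principle: stability of K under partial derivation does the work of an induction
    over words of derivatives for each single function. *)
Lemma smooth_ind (K : set ('rV[R]_N -> R)) :
  (forall f, K f -> continuous f /\ forall i, exists2 g, K g &
    forall x, is_derive x (delta_mx 0 i) f (g x)) ->
  forall f, K f -> smooth f.
Proof.
move=> KP f Kf s; suff /KP[cf df] : K (foldr partial f s).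
  by split=> // i x; have [g _ /(_ x)[]] := df i.
elim: s => //= i s /KP[_ /(_ i)[g Kg dg]].
rewrite (_ : partial _ _ = g)//; apply/funext => x.
by have [_] := dg x.
Qed.

Lemma smooth_lin c f g : smooth f -> smooth g -> smooth (c *: f + g).
Proof.
move=> sf sg; pose K := [set h | exists f g, [/\ smooth f, smooth g & h = c *: f + g]].
apply: (@smooth_ind K); last by exists f, g.
move=> _ [{sf sg} {}f [{}g [sf sg ->]]]; split.
  have cf := smooth_continuous sf; have cg := smooth_continuous sg.
  by apply: continuous_addf => //; apply: continuous_mulf => //; exact: cst_continuous.
move=> i; exists (c *: partial i f + partial i g).
  by exists (partial i f), (partial i g); split => //; exact: smooth_partial.
move=> x; apply: is_deriveD; last exact: smooth_is_derive.
by apply: is_deriveZ; exact: smooth_is_derive.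
Qed.

Lemma smooth0 : smooth (0 : 'rV[R]_N -> R).
Proof.
apply: (@smooth_ind [set 0]) => // _ ->; split; first exact: cst_continuous.
by move=> i; exists 0 => // x; exact: is_derive_cst.
Qed.

(** Differentiating raises the index k and multiplies by constants, so with all k, constants, sums
    and products the class is stable under partial derivation and [smooth_ind] applies. *)
Inductive flat_generated : ('rV[R]_N -> R) -> Prop :=
| FlatBase k i c e : flat_generated (fun x => flat k (c * x 0 i + e))
| FlatCst c : flat_generated (fun=> c)
| FlatAdd f g : flat_generated f -> flat_generated g ->
    flat_generated (fun x => f x + g x)
| FlatMul f g : flat_generated f -> flat_generated g ->
    flat_generated (fun x => f x * g x).

Lemma flat_generated_smooth f : flat_generated f -> smooth f.
Proof.
apply: (@smooth_ind [set f | flat_generated f]) => {}f /=.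
elim=> [k i c e|c|{}f g _ [cf df] _ [cg dg]|{}f g gf [cf df] gg [cg dg]].
- split.
    move=> x; apply: (@continuous_comp _ _ _ (fun y : 'rV[R]_N => c * y 0 i + e) (flat k)).
      apply: continuous_addf; last exact: cst_continuous.
      by apply: continuous_mulf; [exact: cst_continuous|exact: coord_continuous].
    apply: differentiable_continuous; apply/derivable1_diffP.
    by have [] := is_derive_flat k (c * x 0 i + e).
  move=> j; exists (fun x => if i == j then c *
      (flat k.+2 (c * x 0 i + e) - k%:R * flat k.+1 (c * x 0 i + e)) else 0).
    case: (i == j); last exact: FlatCst.
    apply: FlatMul; first exact: FlatCst.
    apply: FlatAdd; first exact: FlatBase.
    rewrite (_ : (fun _ => _) = fun x => (- k%:R) * flat k.+1 (c * x 0 i + e)); last first.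
      by apply/funext => x; rewrite mulNr.
    by apply: FlatMul; [exact: FlatCst|exact: FlatBase].
  by move=> x; apply: is_derive_coord; exact: is_derive_flat.
- split; first exact: cst_continuous.
  by move=> i; exists (fun=> 0); [exact: FlatCst|move=> x; exact: is_derive_cst].
- split; first exact: continuous_addf.
  move=> i; have [f' Kf' df'] := df i; have [g' Kg' dg'] := dg i.
  exists (fun x => f' x + g' x); first exact: FlatAdd.
  by move=> x; exact: is_deriveD.
- split; first exact: continuous_mulf.
  move=> i; have [f' Kf' df'] := df i; have [g' Kg' dg'] := dg i.
  exists (fun x => f x * g' x + g x * f' x).
    by apply: FlatAdd; exact: FlatMul.
  by move=> x; exact: is_deriveM.
Qed.

(** The factor n + 1 steepens the walls: as n grows, the bumps tend pointwise to the indicator of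
    the open box. *)
Definition box_bump (a b : 'rV[R]_N) (n : nat) x : R := \prod_(i < N)
  (flat 0 (n.+1%:R * (x 0 i - a 0 i)) * flat 0 (n.+1%:R * (b 0 i - x 0 i))).

Lemma smooth_box_bump a b n : smooth (box_bump a b n).
Proof.
apply: flat_generated_smooth; rewrite /box_bump.
rewrite (_ : (fun _ => _) = fun x => \prod_(i < N)
  (flat 0 (n.+1%:R * x 0 i + - (n.+1%:R * a 0 i)) *
   flat 0 (- n.+1%:R * x 0 i + n.+1%:R * b 0 i))); last first.
  by apply/funext => x; apply: eq_bigr => i _; congr (flat _ _ * flat _ _); ring.
elim: (index_enum _) => [|i s ih].
  by under eq_fun do rewrite big_nil; exact: FlatCst.
under eq_fun do rewrite big_cons.
by apply: FlatMul => //; apply: FlatMul; exact: FlatBase.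
Qed.

Lemma box_bump_ge0 a b n x : 0 <= box_bump a b n x.
Proof. by apply: prodr_ge0 => i _; rewrite mulr_ge0 ?flat_ge0. Qed.

Lemma box_bump_le1 a b n x : box_bump a b n x <= 1.
Proof.
by apply: prodr_ile1 => i _; rewrite mulr_ge0 ?flat_ge0//= mulr_ile1 ?flat_ge0 ?flat0_le1.
Qed.

Lemma box_bump_gt0 a b n x : rVbox a b x -> 0 < box_bump a b n x.
Proof.
move=> abx; apply: prodr_gt0 => i _; have /andP[h1 h2] := abx i.
by rewrite mulr_gt0// flat0_gt0 pmulr_rgt0// subr_gt0.
Qed.

Lemma box_bump_eq0 a b n x : ~ rVbox a b x -> box_bump a b n x = 0.
Proof.
move=> /existsNP[i /negP]; rewrite negb_and -!leNgt => h.
apply/eqP; apply/prodf_eq0; exists i => //.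
by rewrite mulf_eq0; case/orP: h => h; apply/orP; [left|right]; rewrite /flat
  pmulr_rgt0// subr_gt0 ltNge h.
Qed.

Lemma cvg_box_bump a b x : rVbox a b x -> box_bump a b n x @[n --> \oo] --> (1 : R).
Proof.
move=> abx; rewrite /box_bump; elim: (index_enum _) => [|i s ih].
  by under eq_fun do rewrite big_nil; exact: cvg_cst.
under eq_fun do rewrite big_cons.
have /andP[] := abx i; rewrite -(subr_gt0 (a 0 i)) -(subr_gt0 (x 0 i)) => h1 h2.
have := cvgM (cvgM (cvg_flat0 h1) (cvg_flat0 h2)) ih.
by rewrite !mulr1; apply.
Qed.

Lemma closed_rVcbox a b : closed (rVcbox a b).
Proof.
rewrite (_ : rVcbox a b = \bigcap_i ((fun x : 'rV[R]_N => x 0 i) @^-1` `[a 0 i, b 0 i])).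
  apply: closed_bigI => i _; apply: closed_comp; last exact: interval_closed.
  by move=> x _; exact: coord_continuous.
apply/seteqP; split=> x h i; first by move=> _; rewrite /= in_itv/=.
by have := h i I; rewrite /= in_itv.
Qed.

Lemma bounded_rVcbox a b : bounded_set (rVcbox a b).
Proof.
exists (`|a| + `|b|); split; first by rewrite num_real.
move=> M hM x abx; rewrite /= /Num.norm/= mx_normrE.
apply: bigmax_le => [|[k i] _ /=]; first by rewrite (le_trans _ (ltW hM)).
have /andP[h1 h2] := abx i; rewrite [k]ord1.
have := rV_coord_norm a i; have := rV_coord_norm b i.
rewrite !ler_norml => /andP[h5 h6] /andP[h3 h4].
have pa : 0 <= `|a| by [].
have pb : 0 <= `|b| by [].
by apply/andP; split; lra.
Qed.

Lemma test_function_box_bump (Omega : set 'rV[R]_N) a b n :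
  rVcbox a b `<=` Omega -> test_function Omega (box_bump a b n).
Proof.
move=> abO.
have h : closure [set x | box_bump a b n x != 0] `<=` rVcbox a b.
  apply: (subset_trans _ (closed_rVcbox (a := a) (b := b))).
  apply: closure_subset => x /= /eqP nx; apply: subset_rVbox_cbox.
  by apply: contrapT => /box_bump_eq0.
split; [exact: smooth_box_bump| |exact: subset_trans abO].
apply: bounded_closed_compact; last exact: closed_closure.
have [M [Mr hM]] := bounded_rVcbox a b.
by exists M; split => // r Mr' x /h; exact: hM.
Qed.

End line_derivative.

(** * Integrals of derivatives of compactly supported functions *)

Section compact_support_1d.
Context {R : realType}.
Local Notation leb := (@lebesgue_measure R).
Variables (psi h : R -> R) (M : R).
Hypothesis dpsi : forall t : R, is_derive t 1 psi (h t).
Hypothesis ch : continuous h.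
Hypothesis psi0 : forall t : R, M <= `|t| -> psi t = 0.

Let cpsi : continuous psi.
Proof.
move=> t; apply: differentiable_continuous; apply/derivable1_diffP.
by have [] := dpsi t.
Qed.

Lemma integral_derive_itv a b : a < b ->
  (\int[leb]_(t in `[a, b]) (h t)%:E = (psi b - psi a)%:E)%E.
Proof.
move=> ab; rewrite (@continuous_FTC2 _ h psi a b ab) ?EFinB//.
- exact: continuous_subspaceT.
- split.
  + by move=> t _; have [] := dpsi t.
  + exact/cvg_at_right_filter/cpsi.
  + exact/cvg_at_left_filter/cpsi.
- by move=> t _; rewrite derive1E; have [_ ->] := dpsi t.
Qed.

Lemma integrable_itv_continuous a b : leb.-integrable `[a, b] (EFin \o h).
Proof.
apply: continuous_compact_integrable; first exact: segment_compact.
exact: continuous_subspaceT.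
Qed.

Let mh (D : set R) : measurable D -> measurable_fun D h.
Proof. by move=> mD; apply: measurable_funTS; exact: continuous_measurable_fun. Qed.

Lemma le_integral_abs_derive s : (`|psi s|%:E <= \int[leb]_t `|h t|%:E)%E.
Proof.
(* A point to the left of s and outside the support, so that psi s is the integral of h over
   [m, s]. *)
pose m : R := - (`|M| + `|s| + 1).
have ms : m < s.
  rewrite /m ltrNl (le_lt_trans (ler_norm _))// normrN.
  by rewrite -addrA [_ + 1]addrC addrA ltrDr ltr_wpDl.
have m0 : psi m = 0.
  apply: psi0; rewrite /m normrN ger0_norm ?addr_ge0//.
  by rewrite -addrA (le_trans (ler_norm _))// lerDl addr_ge0.
rewrite -(subr0 (psi s)) -m0 -abse_EFin -integral_derive_itv//.
apply: (le_trans (le_abse_integral _ _ _)) => //.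
  by apply/measurable_EFinP; exact: mh.
apply: ge0_subset_integral => //.
by apply/measurable_EFinP; apply: measurableT_comp => //; exact: mh.
Qed.

(** The integral of h is zero, but split into its two non-negative parts, the form in which Tonelli
    can be used on the fibres in R^N. *)
Lemma integral_funepos_funeneg_derive :
  (\int[leb]_t ((EFin \o h)^\+ t) = \int[leb]_t ((EFin \o h)^\- t))%E.
Proof.
pose m : R := `|M| + 1.
have m0 : 0 < m by rewrite ltr_wpDl.
have mm : - m < m by rewrite (lt_trans _ m0)// oppr_lt0.
have Mm : M < m by rewrite (le_lt_trans (ler_norm _))// ltrDl.
have h0 (t : R) : ~ `[- m, m]%classic t -> h t = 0.
  rewrite /= in_itv/= -ler_norml => /negP; rewrite -ltNge => mt.
  have [_ <-] := dpsi t.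
  have k : is_derive t 1 psi 0.
    apply: (@near_eq_is_derive _ _ _ (cst 0)).
    have : \forall u \near t, M < `|u|.
      apply/nbhs_ballP; exists (`|t| - M) => /= [|u]; first by rewrite subr_gt0 (lt_trans Mm).
      by rewrite /ball/= => tu; have := lerB_dist t u; lra.
    by apply: filterS => u Mu; rewrite psi0// ltW.
  by have [_ ->] := k.
have e (k : R -> \bar R) : (forall t, h t = 0 -> k t = 0%E) ->
    (\int[leb]_t k t = \int[leb]_(t in `[(- m)%R, m]) k t)%E.
  move=> k0; rewrite [RHS]integral_mkcond; apply: eq_integral => t _.
  by rewrite patchE; case: ifPn => // /negP; rewrite inE => /h0 /k0.
rewrite (e (EFin \o h)^\+%E); last by move=> t; rewrite funeposE /= => ->; rewrite maxxx.
rewrite (e (EFin \o h)^\-%E); last by move=> t; rewrite funenegE /= => ->; rewrite oppr0 maxxx.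
have := integral_derive_itv mm; rewrite !psi0 ?normrN ?ger0_norm ?ltW//.
rewrite subrr integralE => z.
have ih := integrable_itv_continuous (- m) m.
have : (\int[leb]_(t in `[(- m)%R, m]) (EFin \o h)^\+ t \is a fin_num)%E.
  by apply: integrable_pos_fin_num ih.
have : (\int[leb]_(t in `[(- m)%R, m]) (EFin \o h)^\- t \is a fin_num)%E.
  by apply: integrable_neg_fin_num ih.
move: z; case: (\int[_]_(_ in _) _^\- _)%E => // r; case: (\int[_]_(_ in _) _^\+ _)%E => // r'.
by move=> /eqP; rewrite -EFinB eqe subr_eq0 => /eqP ->.
Qed.

End compact_support_1d.

Section compact_support.
Context {R : realType} {N : nat}.
Local Notation leb := (@lebesgue_rV R N).
Variables (i : 'I_N) (Phi h : 'rV[R]_N -> R) (M : R).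
Hypothesis dPhi : forall x, is_derive x (delta_mx 0 i) Phi (h x).
Hypothesis ch : continuous h.
Hypothesis Phi0 : forall x, M <= `|x| -> Phi x = 0.

Let psi (x : 'rV[R]_N) (t : R) := Phi (set_coord x i t).
Let dpsi (x : 'rV[R]_N) (t : R) : is_derive t 1 (psi x) (h (set_coord x i t)).
Proof. exact/is_derive_line. Qed.
Let cpsi (x : 'rV[R]_N) : continuous (fun t => h (set_coord x i t)).
Proof.
by move=> t; apply: continuous_comp; [exact: continuous_set_coord|exact: ch].
Qed.
Let psi0 (x : 'rV[R]_N) (t : R) : M <= `|t| -> psi x t = 0.
Proof.
move=> Mt; apply: Phi0; rewrite (le_trans Mt)// -{1}(set_coord_same x i t).
exact: rV_coord_norm.
Qed.

Lemma abs_le_integral_partial x :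
  (`|Phi x|%:E <= \int[lebesgue_measure]_t `|h (set_coord x i t)|%:E)%E.
Proof.
rewrite -[in leLHS](set_coord_id x i).
exact: (le_integral_abs_derive (dpsi x) (@cpsi x) (@psi0 x)).
Qed.

(** On each line in direction i the positive and negative parts of h have the same integral;
    comparing them fibrewise in both directions gives the same over R^N. *)
Lemma integral_partial_eq0 : \int[leb]_x h x = 0.
Proof.
have mh : measurable_fun setT (EFin \o h).
  by apply/measurable_EFinP; exact: continuous_measurable_rV.
rewrite /Rintegral integralE.
suff -> : (\int[leb]_x (EFin \o h)^\+ x = \int[leb]_x (EFin \o h)^\- x)%E.
  by case: (\int[_]_(_ in _) _)%E => //= r; rewrite subrr.
have l x : (\int[lebesgue_measure]_t (EFin \o h)^\+ (set_coord x i t) =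
    \int[lebesgue_measure]_t (EFin \o h)^\- (set_coord x i t))%E.
  have := integral_funepos_funeneg_derive (dpsi x) (@cpsi x) (@psi0 x).
  rewrite (_ : (fun t => _) = fun t => (EFin \o h)^\+%E (set_coord x i t)); last first.
    by apply/funext => t; rewrite !funeposE.
  by move=> ->; apply: eq_integral => t _; rewrite !funenegE.
apply/eqP; rewrite eq_le; apply/andP; split; apply: (@ge0_le_integral_fiber _ _ i) => //;
  try exact: measurable_funepos; try exact: measurable_funeneg; move=> x.
- by rewrite l.
- by rewrite l.
Qed.

End compact_support.

(** * Powers of absolute values and Hölder inequalities *)

Section norm_power.
Context {R : realType}.
Implicit Types (s p : R).

Lemma continuous_norm_powR p : 0 < p -> continuous (fun s : R => `|s| `^ p).
Proof.
move=> p0 s; have [->|s0] := eqVneq s 0; last first.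
  apply: (@continuous_comp _ _ _ (fun s : R => `|s|) (fun t => t `^ p)).
    exact: norm_continuous.
  apply: differentiable_continuous; apply/derivable1_diffP.
  have ns0 : 0 < `|s| by rewrite normr_gt0.
  by have [] := is_derive1_powR p ns0.
rewrite /continuous_at normr0 powR0 ?gt_eqF//; apply/cvgrPdist_lt => e e0.
near=> u; rewrite sub0r normrN ger0_norm ?powR_ge0//.
have -> : e = (e `^ p^-1) `^ p by rewrite -powRrM mulVf ?gt_eqF// powRr1 ?ltW.
rewrite gt0_ltr_powR ?nnegrE ?powR_ge0//.
near: u; apply/nbhs_ballP; exists (e `^ p^-1) => [|v] /=; first exact: powR_gt0.
by rewrite /ball/= sub0r normrN.
Unshelve. all: by end_near. Qed.

Lemma norm_powR_sqr s p : `|s| `^ p = (s ^+ 2) `^ (p / 2).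
Proof.
by rewrite -real_normK ?num_real// -powR_mulrn// -powRrM mulrC divfK.
Qed.

(** Away from 0, writing |t|^p = (t^2)^(p/2) avoids differentiating the absolute value; at 0 the
    Carathéodory slope z |z|^(p-2) is continuous because p > 2. *)
Lemma is_derive_norm_powR s p : 2 < p ->
  is_derive s 1 (fun t => `|t| `^ p) (p * (s * `|s| `^ (p - 2))).
Proof.
move=> p2; have p0 : 0 < p - 2 by rewrite subr_gt0.
have [->|s0] := eqVneq s 0.
  apply/is_derive1_caratheodory; exists (fun z => z * `|z| `^ (p - 2)); split.
  - move=> z; rewrite normr0 powR0 ?gt_eqF ?(lt_trans _ p2)// !subr0.
    rewrite mulrAC -expr2 -real_normK ?num_real// -powR_mulrn//.
    have [->|z0] := eqVneq z 0; first by rewrite normr0 !powR0 ?mul0r// gt_eqF// (lt_trans _ p2).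
    by rewrite -powRD ?subrKC// normr_eq0 z0 implybT.
  - apply: continuous_mulf; last exact: continuous_norm_powR.
    by move=> x; exact: cvg_id.
  - by rewrite !mul0r mulr0.
under eq_fun do rewrite norm_powR_sqr.
have s2 : 0 < s ^+ 2 by rewrite exprn_even_gt0.
have dX := @is_deriveX _ _ (id : R -> R) 2 s 1 1 (is_derive_id s 1).
have := @is_derive1_comp _ (fun t => t `^ (p / 2)) ((id : R -> R) ^+ 2) s _ _
  (is_derive1_powR (p / 2) s2) dX.
rewrite (_ : _ \o _ = (fun t : R => (t ^+ 2) `^ (p / 2))); last first.
  by apply/funext => t; rewrite /= !fctE.
move/is_derive_eq; apply; rewrite norm_powR_sqr mulrBl divff//.
by rewrite /GRing.scale/= expr1; move: (_ `^ _) => w; field.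
Qed.

End norm_power.

Section generalized_hoelder.
Context d (T : measurableType d) (R : realType) (mu : {measure set T -> \bar R}).
Implicit Types f g : T -> R.

Lemma measurable_powR_fun f p : measurable_fun setT f ->
  measurable_fun setT (fun x => f x `^ p).
Proof. by move=> mf; exact: measurableT_comp (measurable_powR p) mf. Qed.

(** Hölder's inequality with exponents 1/a and 1/b, applied to f^a and g^b. *)
Lemma hoelder_powR f g a b : 0 < a -> 0 < b -> a + b = 1 ->
  measurable_fun setT f -> measurable_fun setT g ->
  (forall x, 0 <= f x) -> (forall x, 0 <= g x) ->
  (\int[mu]_x (f x `^ a * g x `^ b)%:E <=
   (\int[mu]_x (f x)%:E) `^ a * (\int[mu]_x (g x)%:E) `^ b)%E.
Proof.
move=> a0 b0 ab mf mg f0 g0.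
have := @hoelder _ _ _ mu (fun x => f x `^ a) (fun x => g x `^ b) a^-1 b^-1
  (measurable_powR_fun a mf) (measurable_powR_fun b mg).
rewrite !invr_gt0 !invrK => /(_ a0 b0 ab); rewrite Lnorm1.
rewrite unlock !invrK => h.
have nE (k : T -> R) c : 0 < c -> (forall x, 0 <= k x) ->
    (\int[mu]_x (`|(k x `^ c)%:E| `^ c^-1) = \int[mu]_x (k x)%:E)%E.
  move=> c0 k0; apply: eq_integral => x _.
  rewrite gee0_abs ?lee_fin ?powR_ge0// poweR_EFin -powRrM mulfV ?gt_eqF//.
  by rewrite powRr1.
move: h; rewrite !nE//; congr (_ <= _)%E; apply: eq_integral => x _.
by rewrite /= ger0_norm ?mulr_ge0 ?powR_ge0.
Qed.

Lemma prod_powR (I : Type) (s : seq I) (F : I -> R) p : (forall i, 0 <= F i) ->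
  \prod_(i <- s) (F i `^ p) = (\prod_(i <- s) F i) `^ p.
Proof.
move=> F0; elim: s => [|i s ih]; first by rewrite !big_nil powR1.
by rewrite !big_cons ih powRM// prodr_ge0.
Qed.

Lemma prod_poweR (I : Type) (s : seq I) (F : I -> \bar R) p : (forall i, 0 <= F i)%E ->
  (\prod_(i <- s) (F i `^ p) = (\prod_(i <- s) F i) `^ p)%E.
Proof.
move=> F0; elim: s => [|i s ih]; first by rewrite !big_nil poweR1r.
by rewrite !big_cons ih poweRM// prode_ge0.
Qed.

Lemma measurable_prod_powR (I : Type) (s : seq I) (F : I -> T -> R) p :
  (forall i, measurable_fun setT (F i)) ->
  measurable_fun setT (fun x => \prod_(i <- s) (F i x `^ p)).
Proof.
move=> mF; elim: s => [|i s ih].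
  by under eq_fun do rewrite big_nil; exact: measurable_cst.
under eq_fun do rewrite big_cons.
by apply: measurable_funM => //; exact: measurable_powR_fun.
Qed.

(** Induction on the number of factors: split off one factor with weight 1/(m+1), and give weight b
    = m/(m+1) to the product G of the m-th roots of the others. *)
Lemma hoelder_prod (I : Type) (s : seq I) (F : I -> T -> R) :
  (forall i, measurable_fun setT (F i)) -> (forall i x, 0 <= F i x) ->
  (0 < size s)%N ->
  (\int[mu]_x (\prod_(i <- s) (F i x `^ (size s)%:R^-1))%:E <=
   \prod_(i <- s) (\int[mu]_x (F i x)%:E) `^ (size s)%:R^-1)%E.
Proof.
move=> mF F0; case: s => // i s _; elim: s i => [|j s ih] i.
  rewrite big_seq1 /= invr1 poweRe1; last by apply: integral_ge0 => x _; rewrite lee_fin.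
  by under eq_integral do rewrite big_seq1 powRr1//.
set m := size (j :: s); rewrite -/m in ih.
have -> : size [:: i, j & s] = m.+1 by [].
have m0 : (0 < m%:R :> R) by rewrite ltr0n.
pose b : R := m%:R / m.+1%:R.
have b0 : 0 < b by rewrite divr_gt0.
have mb : m%:R^-1 * b = m.+1%:R^-1 by rewrite /b mulrA mulVf ?gt_eqF// mul1r.
have ab : m.+1%:R^-1 + b = 1.
  by rewrite /b -[X in X + _]mul1r -mulrDl nat1r mulfV.
pose G x := \prod_(k <- j :: s) (F k x `^ m%:R^-1).
have G0 x : 0 <= G x by apply: prodr_ge0 => k _; exact: powR_ge0.
have GE x : \prod_(k <- j :: s) (F k x `^ m.+1%:R^-1) = G x `^ b.
  rewrite -prod_powR; last by move=> k; exact: powR_ge0.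
  by apply: eq_bigr => k _; rewrite -powRrM mb.
under eq_integral do rewrite big_cons GE.
rewrite big_cons.
have mG : measurable_fun setT G by exact: measurable_prod_powR.
apply: (le_trans (@hoelder_powR (F i) G m.+1%:R^-1 b _ _ _ _ _ _ _)) => //.
rewrite lee_wpmul2l ?poweR_ge0//.
have I0 k : (0 <= \int[mu]_x (F k x)%:E)%E.
  by apply: integral_ge0 => x _; rewrite lee_fin.
have -> : (\prod_(k <- j :: s) (\int[mu]_x (F k x)%:E) `^ m.+1%:R^-1 =
    (\prod_(k <- j :: s) (\int[mu]_x (F k x)%:E) `^ m%:R^-1) `^ b)%E.
  rewrite -prod_poweR; last by move=> k; exact: poweR_ge0.
  by apply: eq_bigr => k _; rewrite -poweRrM mb.
apply: gt0_ler_poweR; first exact: ltW.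
- by rewrite in_itv/= leey andbT integral_ge0// => x _; rewrite lee_fin.
- by rewrite in_itv/= leey andbT prode_ge0// => k _; exact: poweR_ge0.
- exact: ih.
Qed.

End generalized_hoelder.

(** * The Gagliardo-Nirenberg inequality *)

Section compactly_supported.
Context {R : realType}.

(** Smoothness is not asked for, so that absolute values and powers |phi|^s of test functions stay
    in the class. *)
Definition continuous_compact_support (N : nat) (g : 'rV[R]_N -> R) :=
  continuous g /\ exists M : R, forall x, M <= `|x| -> g x = 0.

Local Notation ccs := continuous_compact_support.

Lemma ccs_measurable N (g : 'rV[R]_N -> R) : ccs g -> measurable_fun setT g.
Proof. by case=> cg _; exact: continuous_measurable_rV. Qed.

Lemma ccs_cball N (g : 'rV[R]_N -> R) : ccs g -> exists r : R,
  [/\ 0 < r, forall x, g x != 0 -> rVcbox (const_mx (- r)) (const_mx r) x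
    & exists B, forall x, `|g x| <= B].
Proof.
move=> [cg [M gM]]; pose r : R := `|M| + 1.
have r0 : 0 < r by rewrite ltr_wpDl.
have supp x : g x != 0 -> rVcbox (const_mx (- r)) (const_mx r) x.
  move=> gx i; rewrite !mxE -ler_norml (le_trans (rV_coord_norm x i))//.
  have : `|x| < M by rewrite ltNge; apply: contra gx => /gM ->.
  by move=> /ltW/le_trans; apply; rewrite (le_trans (ler_norm _))// lerDl.
exists r; split => //.
have kK : compact (rVcbox (const_mx (- r)) (const_mx r : 'rV[R]_N)).
  apply: bounded_closed_compact; [exact: bounded_rVcbox|exact: closed_rVcbox].
have := compact_bounded (continuous_compact (continuous_subspaceT cg) kK).
move=> [B [_ hB]]; exists (`|B| + 1) => x.
have [->|gx] := eqVneq (g x) 0; first by rewrite normr0 addr_ge0.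
apply: hB; last by exists x => //; exact: supp.
by rewrite (le_lt_trans (ler_norm _))// ltrDl.
Qed.

Lemma ccs_integrable N (g : 'rV[R]_N -> R) : ccs g ->
  (@lebesgue_rV R N).-integrable setT (EFin \o g).
Proof.
move=> gc; have [r [r0 supp [B gB]]] := ccs_cball gc.
pose K := rVbox (const_mx (- (r + 1))) (const_mx (r + 1) : 'rV[R]_N).
have mK : measurable K by exact: rVbox_measurable.
have KE : EFin \o g = (EFin \o g) \_ K.
  apply/funext => x; rewrite patchE; case: ifPn => // xK /=.
  apply/eqP; rewrite eqe; apply: contraNT xK => /supp xr; rewrite inE => i.
  by have := xr i; rewrite !mxE => /andP[h1 h2]; apply/andP; split; lra.
rewrite KE; apply/(integrable_mkcond _ mK).1.
apply: measurable_bounded_integrable => //.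
- rewrite [X in (X < _)%E]lebesgue_rVbox ?ltry// => i; rewrite !mxE; lra.
- by apply: measurable_funTS; exact: ccs_measurable.
- exists B; split; rewrite ?num_real// => B' BB' x _ /=.
  by rewrite (le_trans (gB x))// ltW.
Qed.

Lemma rV_snoc_norm N (y : 'rV[R]_N) t : `|y| <= `|rV_snoc (y, t)|.
Proof.
rewrite [leLHS]/Num.norm/= mx_normrE; apply: bigmax_le => // -[k j] _ /=.
by rewrite [k]ord1 -(rV_snoc_lift y t) rV_coord_norm.
Qed.

Lemma continuous_snocl N (t : R) : continuous (fun y : 'rV[R]_N => rV_snoc (y, t)).
Proof.
move=> y A /rV_nbhsP[e e0 he]; apply/rV_nbhsP; exists e => // z yz.
apply: he => i; case: (unliftP ord_max i) => [j|] ->.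
  by rewrite !rV_snoc_lift.
by rewrite !rV_snoc_max subrr normr0.
Qed.

Lemma ccs_snocl N (g : 'rV[R]_N.+1 -> R) t : ccs g ->
  ccs (fun y => g (rV_snoc (y, t))).
Proof.
move=> [cg [M gM]]; split.
  by move=> y; apply: continuous_comp; [exact: continuous_snocl|exact: cg].
by exists M => y My; apply: gM; rewrite (le_trans My)// rV_snoc_norm.
Qed.

Lemma ccs_line_integrable N (g : 'rV[R]_N -> R) x i : ccs g ->
  (@lebesgue_measure R).-integrable setT (fun t => (g (set_coord x i t))%:E).
Proof.
move=> gc; have [cg _] := gc; have [r [r0 supp [B gB]]] := ccs_cball gc.
pose k t := g (set_coord x i t).
have ck : continuous k.
  by move=> t; apply: continuous_comp; [exact: continuous_set_coord|exact: cg].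
have mI : measurable (`[- r, r]%classic : set (measurableTypeR R)) by exact: measurable_itv.
rewrite -[X in integrable _ _ X]/(EFin \o k).
have KE : EFin \o k = (EFin \o k) \_ `[- r, r].
  apply/funext => t; rewrite patchE; case: ifPn => // tr /=.
  apply/eqP; rewrite eqe; apply: contraNT tr => /supp /(_ i).
  by rewrite set_coord_same !mxE inE /= in_itv.
rewrite KE; apply/(integrable_mkcond _ mI).1.
apply: continuous_compact_integrable; first exact: segment_compact.
exact: continuous_subspaceT.
Qed.

End compactly_supported.

Section gagliardo_nirenberg.
Context {R : realType}.
Local Notation ccs := continuous_compact_support.
Local Notation leb N := (@lebesgue_rV R N).

Definition rV_integral N (g : 'rV[R]_N -> R) : R := \int[leb N]_x g x.

Lemma ccs_integralE N (g : 'rV[R]_N -> R) : ccs g ->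
  (\int[leb N]_x (g x)%:E = (rV_integral g)%:E)%E.
Proof. by move=> gc; rewrite fineK// integrable_fin_num//; exact: ccs_integrable. Qed.

Lemma integral_rV0 (F : 'rV[R]_0 -> \bar R) : (\int[leb 0]_x F x = F 0%R)%E.
Proof.
have mF : measurable_fun setT F.
  move=> _ Y mY; rewrite setTI.
  have [F0|F0] := pselect (Y (F 0)).
    rewrite (_ : _ @^-1` _ = setT)//; apply/seteqP; split=> // x _.
    by rewrite /= thinmx0.
  rewrite (_ : _ @^-1` _ = set0)//; apply/seteqP; split=> // x.
  by rewrite /= thinmx0.
rewrite (eq_measure_integral (dirac (0 : 'rV[R]_0)))//.
by rewrite integral_dirac// diracT mul1e.
Qed.

Lemma integral_rV1_line (g : 'rV[R]_1 -> R) x : ccs g -> (forall x, 0 <= g x) ->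
  (\int[lebesgue_measure]_t (g (set_coord x ord0 t))%:E = (rV_integral g)%:E)%E.
Proof.
move=> gc g0; rewrite -ccs_integralE// tonelli_rV2; first last.
- by move=> y; rewrite lee_fin.
- by apply/measurable_EFinP; exact: ccs_measurable.
apply: eq_integral => t _; rewrite integral_rV0; congr (g _)%:E.
apply/rowP => i; have -> : i = ord_max by rewrite [i]ord1; exact/val_inj.
by rewrite rV_snoc_max mxE.
Qed.

Lemma ccs_integral_snoc N (g : 'rV[R]_N.+1 -> R) : ccs g -> (forall x, 0 <= g x) ->
  (\int[lebesgue_measure]_t (rV_integral (fun y => g (rV_snoc (y, t))))%:E =
    (rV_integral g)%:E)%E.
Proof.
move=> gc g0; rewrite -ccs_integralE// tonelli_rV2; first last.
- by move=> y; rewrite lee_fin.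
- by apply/measurable_EFinP; exact: ccs_measurable.
by apply: eq_integral => t _; rewrite -ccs_integralE//; exact: ccs_snocl.
Qed.

Lemma measurable_ccs_integral_snoc N (g : 'rV[R]_N.+1 -> R) : ccs g ->
  (forall x, 0 <= g x) -> measurable_fun setT
    (fun t : measurableTypeR R => rV_integral (fun y => g (rV_snoc (y, t)))).
Proof.
move=> gc g0; apply/measurable_EFinP.
rewrite (_ : _ \o _ = fun t : measurableTypeR R =>
    (\int[leb N]_y (g (rV_snoc (y, t)))%:E)%E).
  apply: (measurable_tonelli_rV2 (F := EFin \o g)).
    by apply/measurable_EFinP; exact: ccs_measurable.
  by move=> y; rewrite lee_fin.
by apply/funext => t /=; rewrite ccs_integralE//; exact: ccs_snocl.
Qed.

Definition last_integral N (g : 'rV[R]_N.+1 -> R) (y : 'rV[R]_N) : R :=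
  \int[lebesgue_measure]_t g (rV_snoc (y, t)).

Lemma last_integralE N (g : 'rV[R]_N.+1 -> R) y : ccs g ->
  (\int[lebesgue_measure]_t (g (rV_snoc (y, t)))%:E = (last_integral g y)%:E)%E.
Proof.
move=> gc; rewrite fineK//; apply: integrable_fin_num => //.
have := ccs_line_integrable (rV_snoc (y, 0)) ord_max gc.
by under eq_fun do rewrite set_coord_snoc_max.
Qed.

Lemma measurable_last_integral N (g : 'rV[R]_N.+1 -> R) : ccs g ->
  (forall x, 0 <= g x) -> measurable_fun setT (last_integral g).
Proof.
move=> gc g0; apply/measurable_EFinP.
rewrite (_ : _ \o _ = fun y => (\int[lebesgue_measure]_t (g (rV_snoc (y, t)))%:E)%E).
  apply: (measurable_tonelli_rV1 (F := EFin \o g)).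
    by apply/measurable_EFinP; exact: ccs_measurable.
  by move=> y; rewrite lee_fin.
by apply/funext => t /=; rewrite last_integralE.
Qed.

Lemma integral_last_integral N (g : 'rV[R]_N.+1 -> R) : ccs g ->
  (forall x, 0 <= g x) ->
  (\int[leb N]_y (last_integral g y)%:E = (rV_integral g)%:E)%E.
Proof.
move=> gc g0; rewrite -ccs_integralE// tonelli_rV1; first last.
- by move=> y; rewrite lee_fin.
- by apply/measurable_EFinP; exact: ccs_measurable.
by apply: eq_integral => t _; rewrite last_integralE.
Qed.

Lemma rV_integral_ge0 N (g : 'rV[R]_N -> R) : (forall x, 0 <= g x) ->
  0 <= rV_integral g.
Proof. by move=> g0; apply: Rintegral_ge0 => x _. Qed.

(* Loomis-Whitney in the form used by Gagliardo and Nirenberg, by induction on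
   the dimension: one factor h^(1/N) is bounded by the fibre integral in the last
   direction, the rest is Hölder. *)
Lemma gagliardo_nirenberg n (h : 'rV[R]_n.+2 -> R)
    (g : 'I_n.+2 -> 'rV[R]_n.+2 -> R) :
  measurable_fun setT h -> (forall x, 0 <= h x) ->
  (forall i, ccs (g i)) -> (forall i x, 0 <= g i x) ->
  (forall i x, (h x)%:E <=
     \int[lebesgue_measure]_t (g i (set_coord x i t))%:E)%E ->
  (\int[leb n.+2]_x (h x `^ (n.+2%:R / n.+1%:R))%:E <=
   (\prod_(i < n.+2) rV_integral (g i) `^ n.+1%:R^-1)%:E)%E.
Proof.
elim: n h g => [|n ih] h g mh h0 gc g0 hg.
  have mhp : measurable_fun setT (fun x => (h x `^ (2%:R / 1%:R))%:E).
    by apply/measurable_EFinP; exact: measurable_powR_fun.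
  rewrite tonelli_rV2//; last by move=> x; rewrite lee_fin powR_ge0.
  (* In dimension two, h (y, t) is at most J t and at most the integral over the last variable,
     which depends on y alone; h^2 is bounded by their product, and the double integral factors. *)
  pose J t := rV_integral (fun y => g ord0 (rV_snoc (y, t))).
  have l0 : ord0 = lift ord_max (ord0 : 'I_1) by exact/val_inj.
  have hJ y t : h (rV_snoc (y, t)) <= J t.
    rewrite -lee_fin; apply: (le_trans (hg ord0 _)).
    under eq_integral do rewrite l0 set_coord_snoc_lift.
    rewrite -(integral_rV1_line y) //; last exact: ccs_snocl.
    by rewrite -l0.
  have hG y t : h (rV_snoc (y, t)) <= last_integral (g ord_max) y.
    rewrite -lee_fin -last_integralE//; apply: (le_trans (hg ord_max _)).
    by under eq_integral do rewrite set_coord_snoc_max.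
  have G0 y : 0 <= last_integral (g ord_max) y.
    by apply: Rintegral_ge0 => t _.
  have J0 t : 0 <= J t by exact: rV_integral_ge0.
  apply: (@le_trans _ _ (\int[lebesgue_measure]_t
      ((rV_integral (g ord_max))%:E * (J t)%:E))%E).
    apply: ge0_le_integral => //.
    - by move=> t _; apply: integral_ge0 => y _; rewrite lee_fin powR_ge0.
    - apply: (measurable_tonelli_rV2 (F := fun x => (h x `^ (2%:R / 1%:R))%:E)) => // x.
      by rewrite lee_fin powR_ge0.
    - apply: emeasurable_funM; first exact: measurable_cst.
      by apply/measurable_EFinP; exact: measurable_ccs_integral_snoc.
    - move=> t _; rewrite -integral_last_integral// -ge0_integralZr//; first last.
      + by rewrite lee_fin.
      + by move=> y _; rewrite lee_fin.
      + by apply/measurable_EFinP; exact: measurable_last_integral.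
      apply: ge0_le_integral => //.
      + by move=> y _; rewrite lee_fin powR_ge0.
      + exact: (measurable_snocl mhp).
      + apply: emeasurable_funM; last exact: measurable_cst.
        by apply/measurable_EFinP; exact: measurable_last_integral.
      + move=> y _; rewrite -EFinM lee_fin divr1 powR_mulrn// expr2.
        by apply: ler_pM.
  rewrite ge0_integralZl//; first last.
  - by rewrite lee_fin rV_integral_ge0.
  - by move=> t _; rewrite lee_fin.
  - by apply/measurable_EFinP; exact: measurable_ccs_integral_snoc.
  rewrite ccs_integral_snoc// -EFinM lee_fin big_ord_recr big_ord1 /= invr1.
  rewrite !powRr1 ?rV_integral_ge0// mulrC.
  by rewrite (_ : widen_ord _ _ = ord0)//; exact/val_inj.
set p := n.+3%:R / n.+2%:R.
have mhp : measurable_fun setT (fun x => (h x `^ p)%:E).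
  by apply/measurable_EFinP; exact: measurable_powR_fun.
rewrite tonelli_rV2//; last by move=> x; rewrite lee_fin powR_ge0.
(* q is the exponent one dimension lower. As p = 1 + a and q b = 1, one has h^p = h^a (h^q)^b, where
   a and b are conjugate weights for Hölder. *)
pose a : R := n.+2%:R^-1; pose b : R := n.+1%:R / n.+2%:R; pose q : R := n.+2%:R / n.+1%:R.
have a0 : 0 < a by rewrite invr_gt0.
have b0 : 0 < b by rewrite divr_gt0.
have ab : a + b = 1.
  by rewrite /a /b -[X in X + _]mul1r -mulrDl nat1r mulfV.
have qb : q * b = 1 by rewrite /q /b mulrA divfK// mulfV.
have pa : p = 1 + a.
  by rewrite /p /a -[n.+3%:R]nat1r addrC mulrDl mul1r mulfV.
have ba : n.+1%:R^-1 * b = a by rewrite /b mulrA mulVf// mul1r.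
pose J j t := rV_integral (fun y => g (lift ord_max j) (rV_snoc (y, t))).
pose G := last_integral (g ord_max).
have G0 y : 0 <= G y by apply: Rintegral_ge0 => t _.
have J0 j t : 0 <= J j t by exact: rV_integral_ge0.
have mG : measurable_fun setT G by exact: measurable_last_integral.
have mJ j : measurable_fun setT (J j : measurableTypeR R -> R).
  exact: measurable_ccs_integral_snoc.
have hG y t : h (rV_snoc (y, t)) <= G y.
  rewrite -lee_fin -last_integralE//; apply: (le_trans (hg ord_max _)).
  by under eq_integral do rewrite set_coord_snoc_max.
have mht t : measurable_fun setT (fun y => h (rV_snoc (y, t))).
  apply/measurable_EFinP; apply: (measurable_snocl (F := EFin \o h)).
  exact/measurable_EFinP.
pose K : R := rV_integral (g ord_max) `^ a.
(* On a slice, bound h^a by G^a, apply Hölder, and estimate the integral of h^q by the induction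
   hypothesis. *)
have slice t : (\int[leb n.+2]_y (h (rV_snoc (y, t)) `^ p)%:E <=
    K%:E * (\prod_(j < n.+2) (J j t `^ a))%:E)%E.
  have := ih (fun y => h (rV_snoc (y, t))) (fun j y => g (lift ord_max j) (rV_snoc (y, t))).
  move=> /(_ (mht t) (fun y => h0 (rV_snoc (y, t)))).
  move=> /(_ (fun j => ccs_snocl t (gc (lift ord_max j)))).
  move=> /(_ (fun j y => g0 (lift ord_max j) (rV_snoc (y, t)))) sl.
  apply: (@le_trans _ _ (\int[leb n.+2]_y (G y `^ a * (h (rV_snoc (y, t)) `^ q) `^ b)%:E)%E).
    apply: ge0_le_integral => //.
    - by move=> y _; rewrite lee_fin powR_ge0.
    - exact: (measurable_snocl mhp).
    - apply/measurable_EFinP; apply: measurable_funM; first exact: measurable_powR_fun.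
      by do 2 apply: measurable_powR_fun.
    - move=> y _; rewrite lee_fin -powRrM qb powRr1// pa.
      have [->|hn0] := eqVneq (h (rV_snoc (y, t))) 0.
        by rewrite powR0 ?mulr0// gt_eqF// addr_gt0.
      rewrite powRD ?hn0 ?implybT// powRr1// mulrC ler_wpM2r//.
      by apply: ge0_ler_powR; rewrite ?nnegrE// ltW.
  apply: (le_trans (@hoelder_powR _ _ _ (leb n.+2) G
    (fun y => h (rV_snoc (y, t)) `^ q) a b a0 b0 ab mG _ G0 _)).
  - exact: measurable_powR_fun.
  - by move=> y; exact: powR_ge0.
  rewrite integral_last_integral// poweR_EFin lee_wpmul2l ?lee_fin ?powR_ge0//.
  apply: (@le_trans _ _ ((\prod_(j < n.+2) (J j t `^ n.+1%:R^-1))%:E `^ b)%E).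
    apply: gt0_ler_poweR; first exact: ltW.
    - by rewrite in_itv/= leey andbT; apply: integral_ge0 => y _; rewrite lee_fin powR_ge0.
    - by rewrite in_itv/= leey andbT lee_fin; apply: prodr_ge0 => j _; exact: powR_ge0.
    - apply: sl => j y.
      have := hg (lift ord_max j) (rV_snoc (y, t)).
      by under eq_integral do rewrite set_coord_snoc_lift.
  rewrite poweR_EFin lee_fin -prod_powR; last by move=> j; exact: powR_ge0.
  by rewrite le_eqVlt; apply/orP; left; apply/eqP; apply: eq_bigr => j _; rewrite -powRrM ba.
have mP : measurable_fun setT (fun t : measurableTypeR R => (\prod_(j < n.+2) (J j t `^ a))%:E).
  by apply/measurable_EFinP; exact: measurable_prod_powR.
have P0 t : (0 <= (\prod_(j < n.+2) (J j t `^ a))%:E)%E.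
  by rewrite lee_fin prodr_ge0// => j _; exact: powR_ge0.
have K0 : (0 <= K%:E)%E by rewrite lee_fin powR_ge0.
apply: (@le_trans _ _ (\int[lebesgue_measure]_t
    (K%:E * (\prod_(j < n.+2) (J j t `^ a))%:E))%E).
  apply: ge0_le_integral => //.
  - by move=> t _; apply: integral_ge0 => y _; rewrite lee_fin powR_ge0.
  - apply: (measurable_tonelli_rV2 (F := fun x => (h x `^ p)%:E)) => // x.
    by rewrite lee_fin powR_ge0.
  - by apply: emeasurable_funM => //; exact: measurable_cst.
rewrite ge0_integralZl//.
have sz : size (index_enum 'I_n.+2) = n.+2 by rewrite -sum1_size big_const_ord iter_addn_0 mul1n.
(* What remains is an integral in t of n + 2 functions, each raised to the power 1/(n+2). *)
have := @hoelder_prod _ _ _ (@lebesgue_measure R) _ (index_enum 'I_n.+2) J mJ J0.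
rewrite sz => /(_ isT) H.
apply: (le_trans (lee_wpmul2l K0 H)).
have -> : (\prod_(j < n.+2) (\int[lebesgue_measure]_t (J j t)%:E) `^ n.+2%:R^-1 =
    (\prod_(j < n.+2) rV_integral (g (lift ord_max j)) `^ a)%:E)%E.
  rewrite -prodEFin; apply: eq_bigr => j _.
  by rewrite /J ccs_integral_snoc// poweR_EFin.
rewrite -EFinM lee_fin [leRHS]big_ord_recr/= mulrC ler_wpM2r ?powR_ge0//.
rewrite le_eqVlt; apply/orP; left; apply/eqP; apply: eq_bigr => j _.
congr (rV_integral (g _) `^ _); apply/val_inj => /=.
by rewrite /bump leqNgt ltn_ord.
Qed.

End gagliardo_nirenberg.

(** * The fundamental lemma of the calculus of variations *)

Section Rintegral_convergence.
Context d (T : measurableType d) (R : realType) (mu : {measure set T -> \bar R}).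
Variables (D : set T) (mD : measurable D).

Lemma cvg_Rintegral_dominated (F : nat -> T -> R) (f k : T -> R) :
  (forall n, measurable_fun D (F n)) -> measurable_fun D f ->
  (forall x, D x -> F ^~ x @ \oo --> f x) ->
  mu.-integrable D (EFin \o k) -> (forall n x, D x -> `|F n x| <= k x) ->
  (\int[mu]_(x in D) F n x) @[n --> \oo] --> \int[mu]_(x in D) f x.
Proof.
move=> mF mf Ff ik Fk.
have [||||| _ _ c] := @dominated_convergence _ _ _ mu D mD
  (fun n => EFin \o F n) (EFin \o f) (EFin \o k).
- by move=> n; apply/measurable_EFinP.
- exact/measurable_EFinP.
- by apply: aeW => x Dx; apply: cvg_EFin; [exact: nearW|exact: Ff].
- exact: ik.
- by apply: aeW => x n Dx /=; rewrite lee_fin; exact: Fk.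
have fi : mu.-integrable D (EFin \o f).
  apply: (integrable_le mD mf _ ik) => x Dx.
  have h : `|F n x| @[n --> \oo] --> `|f x| by apply: cvg_norm; exact: Ff.
  rewrite -(cvg_lim _ h)//; apply: limr_le; first by apply/cvg_ex; exists `|f x|.
  by apply: nearW => n; exact: Fk.
apply: fine_cvg.
by rewrite fineK//; exact: integrable_fin_num.
Qed.

Lemma Rintegral_dominated_eq0 (F : nat -> T -> R) (f k : T -> R) :
  (forall n, measurable_fun D (F n)) -> measurable_fun D f ->
  (forall x, D x -> F ^~ x @ \oo --> f x) ->
  mu.-integrable D (EFin \o k) -> (forall n x, D x -> `|F n x| <= k x) ->
  (forall n, \int[mu]_(x in D) F n x = 0) -> \int[mu]_(x in D) f x = 0.
Proof.
move=> mF mf Ff ik Fk F0; have := cvg_Rintegral_dominated mF mf Ff ik Fk.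
under eq_fun do rewrite F0.
by move/cvg_lim => <-//; exact: lim_cst.
Qed.

Lemma Rintegral_ge0_eq0 (f : T -> R) : mu.-integrable D (EFin \o f) ->
  (forall x, D x -> 0 <= f x) -> \int[mu]_(x in D) f x = 0 ->
  {ae mu, forall x, D x -> f x = 0}.
Proof.
move=> fi f0; rewrite /Rintegral => I0.
have : (\int[mu]_(x in D) `|(f x)%:E| = 0)%E.
  rewrite (eq_integral (EFin \o f)); last first.
    by move=> x /[!inE] Dx; rewrite /= ger0_norm// f0.
  by rewrite -(fineK (integrable_fin_num mD fi)) I0.
move/(ae_eq_integral_abs mu mD (measurable_int mu fi)).1.
by apply: filterS => x h Dx; have := h Dx => -[].
Qed.

End Rintegral_convergence.

Section box_generation.
Context {R : realType} {N : nat}.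

Definition boxes : set (set 'rV[R]_N) := [set A | exists a b, A = rVbox a b].

Lemma setI_rVbox (a b a' b' : 'rV[R]_N) : rVbox a b `&` rVbox a' b' =
  rVbox (\row_i Num.max (a 0 i) (a' 0 i)) (\row_i Num.min (b 0 i) (b' 0 i)).
Proof.
apply/seteqP; split=> [x [h1 h2] i|x h].
  rewrite !mxE gt_max lt_min.
  by have /andP[h3 h4] := h1 i; have /andP[h5 h6] := h2 i; rewrite h3 h4 h5 h6.
split=> i; have := h i; rewrite !mxE gt_max lt_min.
  by move=> /andP[/andP[h1 _] /andP[h2 _]]; rewrite h1 h2.
by move=> /andP[/andP[_ h1] /andP[_ h2]]; rewrite h1 h2.
Qed.

Lemma setI_closed_boxes : setI_closed boxes.
Proof.
move=> _ _ [a [b ->]] [a' [b' ->]]; rewrite setI_rVbox.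
by eexists; eexists; reflexivity.
Qed.

Lemma measurable_rV_boxes (A : set 'rV[R]_N) : measurable A -> <<s boxes >> A.
Proof.
pose c (i : 'I_N) (x : 'rV[R]_N) : measurableTypeR R := x 0 i.
have sa : sigma_algebra setT <<s boxes >> by exact: smallest_sigma_algebra.
have cb i : measurable_fun [set: g_sigma_algebraType boxes]
    (c i : g_sigma_algebraType boxes -> measurableTypeR R).
  apply: (measurability _ (RGenOpens.measurableE R)) => _ [_ [s [t ->]] <-].
  rewrite setTI.
  (* An open slab in direction i is a countable union of boxes that grow in the other directions. *)
  rewrite (_ : _ @^-1` _ = \bigcup_n rVbox (\row_j if j == i then s else - n%:R)
    (\row_j if j == i then t else n%:R)).
    apply: sigma_algebra_bigcup => n; apply: sub_sigma_algebra.
    by eexists; eexists; reflexivity.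
  apply/seteqP; split=> [x|x [n _] h]; rewrite /= in_itv/=; last first.
    by have := h i; rewrite !mxE eqxx.
  move=> xst; pose M := \sum_i `|x 0 i|.
  exists (Num.trunc M).+1 => // j; rewrite !mxE; case: eqVneq => [->//|_].
  rewrite -ltr_norml; apply: le_lt_trans (truncnS_gt M).
  by rewrite /M (bigD1 j)//= lerDl sumr_ge0.
suff : g_sigma_preimage c `<=` <<s boxes >> by apply.
apply: smallest_sub => //; rewrite -bigcup_seq; apply: bigcup_sub => i _ _ [B mB <-].
by rewrite setTI; have := cb i measurableT B mB; rewrite setTI.
Qed.

End box_generation.

Section variational_lemma.
Context {R : realType} {N : nat}.
Local Notation leb := (@lebesgue_rV R N).
Variable Omega : set 'rV[R]_N.
Hypothesis oO : open Omega.

Let mO : measurable Omega. Proof. exact: open_measurable_rV. Qed.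

(** Boxes form a pi-system and the sets over which k integrates to zero a lambda-system, so the
    latter contains all measurable sets, in particular {k > 0} and {k < 0}. *)
Lemma ae_eq0_boxes (k : 'rV[R]_N -> R) : leb.-integrable Omega (EFin \o k) ->
  (forall a b, \int[leb]_(x in Omega) (k x * \1_(rVbox a b) x) = 0) ->
  {ae leb, forall x, Omega x -> k x = 0}.
Proof.
move=> ki k0.
have mk : measurable_fun Omega k by apply/measurable_EFinP; exact: measurable_int ki.
have ink : leb.-integrable Omega (EFin \o (fun x => `|k x|)).
  by have := integrable_abse ki.
have mkA A : measurable A -> measurable_fun Omega (fun x => k x * \1_A x).
  by move=> mA; apply: measurable_funM => //; exact: measurable_indic.
have kA_le A x : Omega x -> `|k x * \1_A x| <= `|k x|.
  by move=> _; rewrite normrM ler_piMr// indicE; case: (_ \in _); rewrite ?normr1 ?normr0.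
have ikA A : measurable A -> leb.-integrable Omega (EFin \o (fun x => k x * \1_A x)).
  by move=> mA; apply: (integrable_le mO (mkA A mA) _ ink) => x; exact: kA_le.
pose H : set (set 'rV[R]_N) :=
  [set A | measurable A /\ \int[leb]_(x in Omega) (k x * \1_A x) = 0].
have bc : (\bigcup_n rVbox (const_mx (- n%:R)) (const_mx n%:R : 'rV[R]_N)) = setT.
  rewrite -subTset => x _; pose M := \sum_i `|x 0 i|.
  exists (Num.trunc M).+1 => // i; rewrite !mxE -ltr_norml.
  apply: le_lt_trans (truncnS_gt M).
  by rewrite /M (bigD1 i)//= lerDl sumr_ge0.
have ndH : ndseq_closed H.
  move=> F ndF HF; have mF n : measurable (F n) by case: (HF n).
  have mUF : measurable (\bigcup_n F n) by exact: bigcupT_measurable.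
  split=> //.
  apply: (Rintegral_dominated_eq0 mO (F := fun n x => k x * \1_(F n) x) _ _ _ ink) => //.
  - by move=> n; exact: mkA.
  - exact: mkA.
  - move=> x Ox; apply: cvgMl_tmp; apply: cvg_near_cst.
    have [[n _ Fn]|nF] := pselect ((\bigcup_n F n) x).
      exists n => // m /= nm; have Fm : F m x by move/subsetPset: (ndF _ _ nm); apply.
      by rewrite !indicE !mem_set//; exists n.
    by apply: nearW => n; rewrite !indicE !memNset// => Fn; apply: nF; exists n.
  - by move=> n x Ox; exact: kA_le.
  - by move=> n; case: (HF n).
have HT : H setT.
  rewrite -bc; apply: ndH => [m n mn|n]; last by split; [exact: rVbox_measurable|exact: k0].
  apply/subsetPset => x h i; have := h i; rewrite !mxE -!ltr_norml => /lt_le_trans; apply.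
  by rewrite ler_nat.
have HL : lambda_system setT H.
  split => // A B BA [mA A0] [mB B0]; split; first exact: measurableD.
  rewrite -A0 -[LHS]addr0 -B0 -RintegralD//; try by apply: ikA => //; exact: measurableD.
  apply: eq_Rintegral => x _; rewrite -mulrDr !indicE in_setD; congr (_ * _).
  by have [/set_mem/BA/mem_set ->|_] := boolP (x \in B); rewrite ?andbF ?andbT ?add0r ?addr0.
have HA A : measurable A -> \int[leb]_(x in Omega) (k x * \1_A x) = 0.
  move=> /measurable_rV_boxes; suff sub : <<s boxes >> `<=` H by move=> /sub[].
  apply: (lambda_system_subset setI_closed_boxes HL) => // _ [a [b ->]].
  by split; [exact: rVbox_measurable|exact: k0].
(* Used with s = 1 and s = -1; s k is non-negative on P and integrates to zero there. *)
have part (s : R) : {ae leb, forall x, Omega x -> 0 < s * k x -> k x = 0}.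
  pose P := Omega `&` [set x | 0 < s * k x].
  have mP : measurable P.
    rewrite (_ : P = Omega `&` (fun x => s * k x) @^-1` `]0, +oo[).
      by apply: (measurable_funM (measurable_cst s) mk).
    by apply/seteqP; split=> x /=; rewrite in_itv/= andbT.
  have : {ae leb, forall x, Omega x -> s * (k x * \1_P x) = 0}.
    apply: Rintegral_ge0_eq0 => //.
    - have := integrableZl mO s (ikA P mP); exact: eq_integrable.
    - move=> x Ox; rewrite indicE mulrA.
      by have [/set_mem[_ /= /ltW]|_] := boolP (x \in P); rewrite ?mulr1 ?mulr0.
    - by rewrite RintegralZl ?HA ?mulr0//; exact: ikA.
  apply: filterS => x h Ox sk; have := h Ox.
  rewrite indicE mem_set ?mulr1; last by split.
  by move/eqP; rewrite gt_eqF.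
have p1 := part 1; have p2 := part (- 1).
apply: filterS2 p1 p2 => x h1 h2 Ox.
have [k1|k1|//] := ltgtP (k x) 0; first by apply: h2 => //; rewrite mulN1r oppr_gt0.
by apply: h1 => //; rewrite mul1r.
Qed.

Lemma fundamental_variational (g : 'rV[R]_N -> R) :
  leb.-integrable Omega (EFin \o g) ->
  (forall phi, test_function Omega phi ->
     \int[leb]_(x in Omega) (g x * phi x) = 0) ->
  {ae leb, forall x, Omega x -> g x = 0}.
Proof.
move=> gi g0.
have mg : measurable_fun Omega g by apply/measurable_EFinP; exact: measurable_int gi.
have ing : leb.-integrable Omega (EFin \o (fun x => `|g x|)).
  by have := integrable_abse gi.
have gbox a b : rVcbox a b `<=` Omega ->
    \int[leb]_(x in Omega) (g x * \1_(rVbox a b) x) = 0.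
  move=> abO.
  apply: (Rintegral_dominated_eq0 mO (F := fun n x => g x * box_bump a b n x) _ _ _ ing) => //.
  - move=> n; apply: measurable_funM => //; apply: measurable_funTS.
    by apply: continuous_measurable_rV; apply: smooth_continuous; exact: smooth_box_bump.
  - by apply: measurable_funM => //; apply: measurable_indic; exact: rVbox_measurable.
  - move=> x Ox; apply: cvgMl_tmp; rewrite indicE.
    have [abx|abx] := pselect (rVbox a b x); first by rewrite mem_set//; exact: cvg_box_bump.
    rewrite memNset//; under eq_fun do rewrite box_bump_eq0//.
    exact: cvg_cst.
  - move=> n x Ox; rewrite normrM ler_piMr// ger0_norm ?box_bump_ge0//.
    exact: box_bump_le1.
  - by move=> n; apply: g0; exact: test_function_box_bump.
have gQ q : rVcbox (@ratcube R N q).1 (@ratcube R N q).2 `<=` Omega ->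
    {ae leb, forall x, Omega x -> rVbox (ratcube q).1 (ratcube q).2 x -> g x = 0}.
  set a := (ratcube q).1; set b := (ratcube q).2 => abO.
  have mab : measurable (rVbox a b) by exact: rVbox_measurable.
  have : {ae leb, forall x, Omega x -> g x * \1_(rVbox a b) x = 0}.
    apply: ae_eq0_boxes.
      apply: (integrable_le mO _ _ ing).
        by apply: measurable_funM => //; exact: measurable_indic.
      by move=> x _; rewrite normrM ler_piMr// indicE; case: (_ \in _); rewrite ?normr1 ?normr0.
    move=> a' b'.
    (* An arbitrary box cut with the cube is again a box, and its closed box stays inside Omega. *)
    under eq_Rintegral do rewrite -mulrA
      -[\1_(rVbox a b) _ * _]/((\1_(rVbox a b) \* \1_(rVbox a' b')) _) -indicI setI_rVbox.
    apply: gbox => x h; apply: abO => i; have := h i.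
    by rewrite !mxE ge_max le_min => /andP[/andP[h1 _] /andP[h2 _]]; rewrite h1 h2.
  apply: filterS => x h Ox abx; have := h Ox.
  by rewrite indicE mem_set// mulr1.
(* An enumeration of the admissible rational cubes, with the empty set as default, so that the
   exceptional null sets are countably many. *)
pose Q n : set 'rV[R]_N := if unpickle n is Some q then
  (if pselect (rVcbox (@ratcube R N q).1 (@ratcube R N q).2 `<=` Omega) is left _
   then rVbox (@ratcube R N q).1 (@ratcube R N q).2 else set0) else set0.
have : {ae leb, forall x, forall n, Omega x -> Q n x -> g x = 0}.
  apply/ae_foralln => n; rewrite /Q; case: unpickle => [q|]; last exact: aeW.
  by case: pselect => // h; [exact: gQ|exact: aeW].
apply: filterS => x h Ox; have [q [xq qO]] := open_ratcube oO Ox.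
apply: (h (pickle q)) => //; rewrite /Q pickleK.
by case: pselect.
Qed.

End variational_lemma.

(** * Test functions: integration by parts and the Poincare inequality *)

Section mem_Lp.
Context {R : realType} {N : nat}.
Local Notation leb := (@lebesgue_rV R N).
Variables (Omega : set 'rV[R]_N) (mO : measurable Omega).

Lemma patch_pow2 (u : 'rV[R]_N -> R) :
  EFin \o (fun x => (u \_ Omega) x ^+ 2) = (EFin \o (fun x => u x ^+ 2)) \_ Omega.
Proof.
by apply/funext => x /=; rewrite !patchE; case: ifP => // _; rewrite expr0n.
Qed.

Lemma mem_Lp2P (u : 'rV[R]_N -> R) : mem_Lp Omega 2%:E u <-> L2 leb Omega u.
Proof.
split=> [Lu|[mu u2]].
  split.
    apply: (proj2 (measurable_restrictT u mO)); move: Lu; rewrite /mem_Lp inE => /andP[].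
    by rewrite inE.
  apply: (proj2 (integrable_mkcond _ mO)); rewrite -patch_pow2.
  exact: Lfun2_integrable_sqr.
rewrite /mem_Lp inE; apply/andP; split; rewrite inE/=.
  exact: (proj1 (measurable_restrictT u mO)).
rewrite /finite_norm unlock; apply: poweR_lty.
have /integrableP[_] := proj1 (integrable_mkcond _ mO) u2.
rewrite -patch_pow2; apply: le_lt_trans; rewrite le_eqVlt; apply/orP; left; apply/eqP.
apply: eq_integral => x _ /=.
by rewrite powR_mulrn// normrX.
Qed.

End mem_Lp.

Section test_functions.
Context {R : realType} {N : nat}.
Local Notation leb := (@lebesgue_rV R N).
Variable Omega : set 'rV[R]_N.
Hypotheses (oO : open Omega) (bO : bounded_set Omega).
Implicit Types phi psi : 'rV[R]_N -> R.

Local Notation test := (test_function Omega).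
Local Notation ccs := continuous_compact_support.

Lemma open_Omega_measurable : measurable Omega.
Proof. exact: open_measurable_rV. Qed.
Let mO := open_Omega_measurable.

Lemma Omega_finite : (leb Omega < +oo)%E.
Proof. exact: lebesgue_rV_bounded. Qed.

Lemma test_eq0 phi x : test phi -> ~ Omega x -> phi x = 0.
Proof.
move=> [_ _ sO] nOx; apply: contrapT => px; apply: nOx; apply: sO.
by apply: subset_closure; apply/eqP.
Qed.

Lemma test_partial_eq0 phi i x : test phi ->
  ~ closure [set x | phi x != 0] x -> partial i phi x = 0.
Proof.
move=> tphi ncx.
have h : \forall y \near x, 0 = phi y.
  have : nbhs x (~` closure [set x | phi x != 0]).
    by apply: open_nbhs_nbhs; split => //; exact/closed_openC/closed_closure.
  apply: filterS => y ncy; apply/esym/eqP/negP => py; apply: ncy.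
  by apply: subset_closure; exact/negP.
have [_ <-] := near_eq_is_derive h (is_derive_cst (0 : R) x (delta_mx 0 i)).
by [].
Qed.

Lemma test_partial_out phi i x : test phi -> ~ Omega x -> partial i phi x = 0.
Proof.
move=> tphi nOx; apply: test_partial_eq0 => // cx; apply: nOx.
by have [_ _] := tphi; exact.
Qed.

Lemma test_bound phi : test phi -> exists M : R, forall x, M <= `|x| ->
  phi x = 0 /\ forall i, partial i phi x = 0.
Proof.
move=> tphi; have [_ /compact_bounded[M [_ hM]] _] := tphi.
exists (`|M| + 2) => x Mx.
have nc : ~ closure [set x | phi x != 0] x.
  move=> cx; have := hM (`|M| + 1) _ x cx.
  rewrite (le_lt_trans (ler_norm _)) ?ltrDl// => /(_ isT) /(le_trans Mx); lra.
split; last by move=> i; exact: test_partial_eq0.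
by apply: contrapT => px; apply: nc; apply: subset_closure; exact/eqP.
Qed.

Lemma test_ccs phi : test phi -> ccs phi.
Proof.
move=> tphi; split; first by case: tphi => /smooth_continuous.
by have [M hM] := test_bound tphi; exists M => x /hM[].
Qed.

Lemma test_partial_ccs phi i : test phi -> ccs (partial i phi).
Proof.
move=> tphi; split; first by case: tphi => /(smooth_partial i)/smooth_continuous.
by have [M hM] := test_bound tphi; exists M => x /hM[].
Qed.

Lemma ccs_L2 phi : ccs phi -> L2 leb Omega phi.
Proof.
move=> cphi; have [r [_ _ [B pB]]] := ccs_cball cphi.
apply: (@L2_bounded _ _ _ leb _ mO Omega_finite _ B) => //.
by apply: measurable_funTS; exact: ccs_measurable.
Qed.

Lemma test_lin c phi psi : test phi -> test psi -> test (c *: phi + psi).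
Proof.
move=> tphi tpsi; have [s1 c1 i1] := tphi; have [s2 c2 i2] := tpsi.
pose S := closure [set x | phi x != 0] `|` closure [set x | psi x != 0].
have cS : closed S by apply: closedU; exact: closed_closure.
have kS : compact S by exact: compactU.
have sub : closure [set x | (c *: phi + psi) x != 0] `<=` S.
  apply: (subset_trans _ cS); apply: closure_subset => x /= h.
  have [p0|p0] := eqVneq (phi x) 0; last by left; apply: subset_closure.
  right; apply: subset_closure => /=; move: h.
  rewrite -[(c *: phi + psi) x]/(c * phi x + psi x).
  by rewrite p0 mulr0 add0r.
split; first exact: smooth_lin.
- by apply: subclosed_compact kS sub; exact: closed_closure.
- by move=> x /sub[/i1|/i2].
Qed.

Lemma test0 : test 0.
Proof.
have e : [set x : 'rV[R]_N | (0 : 'rV[R]_N -> R) x != 0] = set0.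
  by apply/seteqP; split=> x //= /eqP.
by split; rewrite ?e ?closure0//; [exact: smooth0|exact: compact0].
Qed.

Lemma coord_is_derive (i : 'I_N) (x : 'rV[R]_N) :
  is_derive x (delta_mx 0 i) (fun y : 'rV[R]_N => y 0 i) 1.
Proof.
have := @is_derive_coord R N id i i 1 0 x 1 (is_derive_id _ _).
rewrite eqxx mulr1; under eq_fun do rewrite mul1r addr0.
exact.
Qed.

Lemma Rintegral_Omega (h : 'rV[R]_N -> R) : (forall x, ~ Omega x -> h x = 0) ->
  \int[leb]_(x in Omega) h x = \int[leb]_x h x.
Proof.
move=> h0; rewrite Rintegral_mkcond; congr fine; apply: eq_integral => x _.
by rewrite patchE; case: ifPn => //; rewrite notin_setE => /h0 ->.
Qed.

(** The product phi psi has compact support, so its i-th partial derivative integrates to zero. *)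
Lemma test_by_parts i phi psi : test phi -> test psi ->
  L2_inner leb Omega phi (partial i psi) = - L2_inner leb Omega (partial i phi) psi.
Proof.
move=> tphi tpsi; apply/eqP; rewrite -addr_eq0; apply/eqP.
have [cphi [M hM]] := test_ccs tphi; have cpsi := (test_ccs tpsi).1.
have cdphi := (test_partial_ccs i tphi).1; have cdpsi := (test_partial_ccs i tpsi).1.
have [sphi _ _] := tphi; have [spsi _ _] := tpsi.
have L2p := ccs_L2 (test_ccs tphi); have L2q := ccs_L2 (test_ccs tpsi).
have L2dp := ccs_L2 (test_partial_ccs i tphi).
have L2dq := ccs_L2 (test_partial_ccs i tpsi).
rewrite /L2_inner -RintegralD//; [|exact: L2_mul..].
rewrite Rintegral_Omega; last first.
  by move=> x nOx; rewrite (test_eq0 tphi)// (test_eq0 tpsi)// mul0r mulr0 addr0.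
apply: (@integral_partial_eq0 _ _ i (fun x => phi x * psi x) _ M).
- move=> x; have := is_deriveM (smooth_is_derive i x sphi) (smooth_is_derive i x spsi).
  by move/is_derive_eq; apply; rewrite /GRing.scale/= [psi x * _]mulrC.
- by apply: continuous_addf; apply: continuous_mulf.
- by move=> x /hM ->; rewrite mul0r.
Qed.

(** Integrating the i-th derivative of x_i phi^2 gives |phi|^2 = -2 <x_i phi, partial_i phi>. Since
    |x_i| <= K on Omega, Cauchy-Schwarz yields the constant 2 K. *)
Lemma test_poincare : exists2 C : R, 0 <= C & forall i phi, test phi ->
  seminorm (L2_inner leb Omega) phi <= C * seminorm (L2_inner leb Omega) (partial i phi).
Proof.
have [M [_ hM]] := bO; pose K : R := `|M| + 1.
have OK x : Omega x -> `|x| <= K.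
  by apply: hM; rewrite (le_lt_trans (ler_norm _))// ltrDl.
have K0 : 0 <= K by rewrite addr_ge0.
exists (2 * K) => [|i phi tphi]; first by rewrite mulr_ge0.
have [cphi [M' hM']] := test_ccs tphi.
have cdphi := (test_partial_ccs i tphi).1; have [sphi _ _] := tphi.
have L2p := ccs_L2 (test_ccs tphi).
have L2dp := ccs_L2 (test_partial_ccs i tphi).
have mc : measurable_fun Omega (fun x : 'rV[R]_N => x 0 i).
  by apply: measurable_funTS; exact: (measurable_coord i).
pose xp := fun x : 'rV[R]_N => x 0 i * phi x.
have mxp : measurable_fun Omega xp.
  by apply: measurable_funM => //; exact: L2_measurable L2p.
have xple x : Omega x -> `|xp x| <= K * `|phi x|.
  move=> Ox; rewrite normrM ler_wpM2r// (le_trans (rV_coord_norm x i))//.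
  exact: OK.
have L2xp : L2 leb Omega xp.
  apply: (L2_cst_ge mO mxp xple); apply: (L2Z mO K (L2_norm L2p)).
have nxp : seminorm (L2_inner leb Omega) xp <= K * seminorm (L2_inner leb Omega) phi.
  have L2Kp := L2Z mO K L2p.
  rewrite -[in K * _](ger0_norm K0) -(seminormZ (semi_inner_L2 leb mO) _ L2p).
  rewrite /seminorm ler_wsqrtr// /L2_inner le_Rintegral//; [exact: L2_mul|exact: L2_mul|].
  move=> x Ox; rewrite -!expr2 -[leLHS]real_normK ?num_real//.
  rewrite -[leRHS]real_normK ?num_real// ler_sqr ?nnegrE//.
  by rewrite (le_trans (xple x Ox))// normrM ger0_norm.
have ibp : L2_inner leb Omega phi phi = - (2 * L2_inner leb Omega xp (partial i phi)).
  apply/eqP; rewrite -addr_eq0; apply/eqP.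
  rewrite /L2_inner -RintegralZl//; last exact: L2_mul.
  rewrite -RintegralD//; last 2 first.
  + exact: L2_mul.
  + by have := integrableZl mO 2 (L2_mul mO L2xp L2dp); exact: eq_integrable.
  rewrite Rintegral_Omega; last first.
    by move=> x nOx; rewrite (test_partial_out i tphi nOx) (test_eq0 tphi nOx) !mulr0 addr0.
  have cc : continuous (fun x : 'rV[R]_N => x 0 i) by exact: coord_continuous.
  apply: (@integral_partial_eq0 _ _ i (fun x => x 0 i * (phi x * phi x)) _ M').
  - move=> x; have dp := smooth_is_derive i x sphi.
    have := is_deriveM (coord_is_derive i x) (is_deriveM dp dp).
    move/is_derive_eq; apply; rewrite /GRing.scale/= /xp.
    rewrite -[(phi * phi) x]/(phi x * phi x); ring.
  - apply: continuous_addf; first exact: continuous_mulf.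
    apply: continuous_mulf; first exact: cst_continuous.
    by apply: continuous_mulf => //; exact: continuous_mulf.
  - by move=> x /hM' ->; rewrite mul0r mulr0.
have [->|p0] := eqVneq (seminorm (L2_inner leb Omega) phi) 0.
  by rewrite mulr_ge0 ?seminorm_ge0// mulr_ge0.
have p1 : 0 < seminorm (L2_inner leb Omega) phi by rewrite lt_neqAle eq_sym p0 seminorm_ge0.
rewrite -(ler_pM2l p1) -expr2 (sqr_seminorm (semi_inner_L2 leb mO))// ibp -mulrN.
have := inner_CS_norm (semi_inner_L2 leb mO) L2xp L2dp.
have := ler_norm (- L2_inner leb Omega xp (partial i phi)); rewrite normrN.
have d0 := seminorm_ge0 (L2_inner leb Omega) (partial i phi).
have := ler_wpM2r d0 nxp.
set p := seminorm _ phi; set q := seminorm _ xp; set s := seminorm _ (partial i phi).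
set I := L2_inner _ _ _ _; set A := `|I|.
by move: p q s I A => p q s I A; lra.
Qed.

End test_functions.

Lemma poincare_arith (R : realType) (C e a b d p s : R) : a <= s -> b <= C * d ->
  (C + 1) * s < e -> C * d <= C * (p + s) -> a + b <= e + C * p.
Proof. by move=> *; lra. Qed.

Lemma quarter_arith (R : realType) (e a b c : R) : a <= b + c ->
  b < e / 4 -> c < e / 4 -> a < e / 2.
Proof. by move=> *; lra. Qed.

(** * Weak derivatives and completeness of H10 *)

Section sobolev_space.
Context {R : realType} {N : nat}.
Local Notation leb := (@lebesgue_rV R N).
Variable Omega : set 'rV[R]_N.
Hypotheses (oO : open Omega) (bO : bounded_set Omega).
Implicit Types u v w g phi : 'rV[R]_N -> R.

Local Notation test := (test_function Omega).
Local Notation L2O := (L2 leb Omega).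
Local Notation ip := (L2_inner leb Omega).
Local Notation wp := (weak_partial Omega).
Let mO : measurable Omega. Proof. exact: open_measurable_rV. Qed.
Let muO : (leb Omega < +oo)%E. Proof. exact: Omega_finite. Qed.
Let sL2 : semi_inner L2O ip. Proof. exact: semi_inner_L2. Qed.

Lemma H1_L2 u : H1 Omega u -> L2O u.
Proof. by case=> /(mem_Lp2P mO). Qed.

Lemma weak_partialP i u : H1 Omega u ->
  L2O (wp i u) /\ is_weak_partial Omega i u (wp i u).
Proof.
move=> [_ /(_ i)[g Lg ig]].
have [L w] : [set g | mem_Lp Omega 2%:E g /\ is_weak_partial Omega i u g] (wp i u).
  by apply: getPex; exists g.
by split=> //; apply/(mem_Lp2P mO).
Qed.

Lemma weak_partial_L2 i u : H1 Omega u -> L2O (wp i u).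
Proof. by move=> /(weak_partialP i)[]. Qed.

Lemma is_weak_partialE i u g : is_weak_partial Omega i u g <->
  forall phi, test phi -> ip u (partial i phi) = - ip g phi.
Proof. by []. Qed.

Let test_L2 phi : test phi -> L2O phi.
Proof. by move=> /test_ccs/(ccs_L2 oO bO). Qed.

Let test_partial_L2 i phi : test phi -> L2O (partial i phi).
Proof. by move=> /(test_partial_ccs i)/(ccs_L2 oO bO). Qed.

Lemma weak_partial_lin i c u v g h : L2O u -> L2O v -> L2O g -> L2O h ->
  is_weak_partial Omega i u g -> is_weak_partial Omega i v h ->
  is_weak_partial Omega i (c *: u + v) (c *: g + h).
Proof.
move=> Lu Lv Lg Lh /is_weak_partialE ug /is_weak_partialE vh.
apply/is_weak_partialE => phi tphi.
have [_ _ _ BD _] := sL2.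
have Lp := test_L2 tphi; have Ldp := test_partial_L2 i tphi.
by rewrite !BD// ug// vh// opprD mulrN.
Qed.

(** The difference g - h is orthogonal to every test function. *)
Lemma weak_partial_unique i u g h : L2O g -> L2O h ->
  is_weak_partial Omega i u g -> is_weak_partial Omega i u h ->
  {ae leb, forall x, Omega x -> g x = h x}.
Proof.
move=> Lg Lh /is_weak_partialE ug /is_weak_partialE uh.
have Lgh := L2B mO Lg Lh.
have : {ae leb, forall x, Omega x -> (g - h) x = 0}.
  apply: fundamental_variational => //; first exact: (L2_integrable mO muO).
  move=> phi tphi; have Lp := test_L2 tphi.
  rewrite -[LHS]/(ip (g - h) phi) (innerBl sL2)//.
  by apply/eqP; rewrite subr_eq0 -eqr_opp -ug// -uh.
by apply: filterS => x h0 /h0 /eqP; rewrite -[(g - h) x]/(g x - h x) subr_eq0 => /eqP.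
Qed.

(** [weak_partial] is picked by choice, so a derivative found by computation identifies it only up
    to a null set. *)
Lemma H1_weak_partial i u g : H1 Omega u -> L2O g ->
  is_weak_partial Omega i u g -> {ae leb, forall x, Omega x -> wp i u x = g x}.
Proof.
by move=> /(weak_partialP i)[Lw iw] Lg ig; exact: weak_partial_unique ig.
Qed.

Lemma H1_lin c u v : H1 Omega u -> H1 Omega v -> H1 Omega (c *: u + v).
Proof.
move=> Hu Hv; have Lu := H1_L2 Hu; have Lv := H1_L2 Hv.
split; first by apply/(mem_Lp2P mO); exact: L2_lin.
move=> i; have [Lgu gu] := weak_partialP i Hu; have [Lgv gv] := weak_partialP i Hv.
exists (c *: wp i u + wp i v); last exact: weak_partial_lin.
by apply/(mem_Lp2P mO); exact: L2_lin.
Qed.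

Definition dirichlet u v : R := \int[leb]_(x in Omega) gradient_dot Omega u v x.

Lemma dirichletE u v : H1 Omega u -> H1 Omega v ->
  dirichlet u v = \sum_(i < N) ip (wp i u) (wp i v).
Proof.
move=> Hu Hv; rewrite /dirichlet /gradient_dot.
(* Integrability accompanies the formula through the induction because additivity of the integral
   requires it. *)
suff [] : leb.-integrable Omega (EFin \o (fun x => \sum_(i < N) wp i u x * wp i v x)) /\
  \int[leb]_(x in Omega) (\sum_(i < N) wp i u x * wp i v x) =
  \sum_(i < N) ip (wp i u) (wp i v) by [].
elim: (index_enum _) => [|i s [ih1 ih2]].
  rewrite big_nil; under eq_fun do rewrite big_nil.
  split; last by rewrite /Rintegral integral0.
  by rewrite (_ : _ \o _ = cst 0%E)//; exact: integrable0.
have L := L2_mul mO (weak_partial_L2 i Hu) (weak_partial_L2 i Hv).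
rewrite big_cons; under eq_fun do rewrite big_cons.
split; last by rewrite -ih2 RintegralD.
by have := integrableD mO L ih1; exact: eq_integrable.
Qed.

Lemma ip_ae_l u u' v : L2O u -> L2O u' -> L2O v ->
  {ae leb, forall x, Omega x -> u x = u' x} -> ip u v = ip u' v.
Proof. by move=> [mu _] [mu' _] [mv _]; exact: L2_ae_eq_inner. Qed.

Lemma seminorm_ae u u' : L2O u -> L2O u' ->
  {ae leb, forall x, Omega x -> u x = u' x} -> seminorm ip u = seminorm ip u'.
Proof.
move=> Lu Lu' uu'; rewrite /seminorm (ip_ae_l Lu Lu' Lu uu') (innerC sL2 Lu' Lu).
by rewrite (ip_ae_l Lu Lu' Lu' uu').
Qed.

(** The chosen derivative of a combination is the combination of the chosen derivatives only a.e.;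
    the L2 pairing does not see the difference. *)
Lemma ip_wp_lin i c u v w : H1 Omega u -> H1 Omega v -> L2O w ->
  ip (wp i (c *: u + v)) w = c * ip (wp i u) w + ip (wp i v) w.
Proof.
move=> Hu Hv Lw; have Huv := H1_lin c Hu Hv.
have [Lgu gu] := weak_partialP i Hu; have [Lgv gv] := weak_partialP i Hv.
have [_ PD _ BD _] := sL2.
rewrite -BD//; apply: ip_ae_l => //; [exact: weak_partial_L2|exact: PD|].
apply: H1_weak_partial => //; first exact: PD.
by apply: weak_partial_lin => //; exact: H1_L2.
Qed.

Lemma test_H1 phi : test phi -> H1 Omega phi.
Proof.
move=> tphi; split; first by apply/(mem_Lp2P mO); exact: test_L2.
move=> i; exists (partial i phi).
  by apply/(mem_Lp2P mO); exact: test_partial_L2.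
by apply/is_weak_partialE => psi tpsi; exact: test_by_parts.
Qed.

Lemma wp_test i phi : test phi ->
  {ae leb, forall x, Omega x -> wp i phi x = partial i phi x}.
Proof.
move=> tphi; apply: H1_weak_partial; [exact: test_H1|exact: test_partial_L2|].
by apply/is_weak_partialE => psi tpsi; exact: test_by_parts.
Qed.

Lemma H1_0 : H1 Omega 0. Proof. by apply: test_H1; exact: test0. Qed.

Lemma semi_inner_H1 : semi_inner (H1 Omega) dirichlet.
Proof.
split.
- exact: H1_0.
- by move=> c u v; exact: H1_lin.
- move=> u v Hu Hv; rewrite (dirichletE Hu Hv) (dirichletE Hv Hu); apply: eq_bigr => i _.
  by rewrite (innerC sL2)//; exact: weak_partial_L2.
- move=> c u v w Hu Hv Hw.
  rewrite (dirichletE (H1_lin c Hu Hv) Hw) (dirichletE Hu Hw) (dirichletE Hv Hw).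
  rewrite mulr_sumr -big_split/=; apply: eq_bigr => i _.
  by apply: ip_wp_lin => //; exact: weak_partial_L2.
- move=> u Hu; rewrite (dirichletE Hu Hu); apply: sumr_ge0 => i _.
  by apply: (inner_ge0 sL2); exact: weak_partial_L2.
Qed.

Definition H1_inner u v : R := ip u v + dirichlet u v.

Lemma semi_inner_H1_full : semi_inner (H1 Omega) H1_inner.
Proof.
have [B0 BD BC BL Bp] := semi_inner_H1; have [_ _ LC LL Lp] := sL2.
split; [exact: B0|exact: BD|..].
- move=> u v Hu Hv; rewrite /H1_inner (BC _ _ Hu Hv).
  by rewrite (LC _ _ (H1_L2 Hu) (H1_L2 Hv)).
- move=> c u v w Hu Hv Hw; rewrite /H1_inner (BL c _ _ _ Hu Hv Hw).
  rewrite (LL c _ _ _ (H1_L2 Hu) (H1_L2 Hv) (H1_L2 Hw)).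
  by rewrite mulrDr addrACA.
- by move=> u Hu; apply: addr_ge0; [exact: Lp (H1_L2 Hu)|exact: Bp].
Qed.

Lemma H1_normE u : H1_norm Omega u = seminorm H1_inner u.
Proof.
rewrite /H1_norm /seminorm /H1_inner /L2_inner; congr (Num.sqrt (_ + _)).
Qed.

Local Opaque L2_inner dirichlet H1_inner weak_partial.

Lemma L2_le_H1_norm u : H1 Omega u -> seminorm ip u <= seminorm H1_inner u.
Proof.
move=> Hu; rewrite ler_wsqrtr// lerDl.
exact: inner_ge0 semi_inner_H1 _ Hu.
Qed.

Lemma dirichlet_le_H1_norm u : H1 Omega u ->
  seminorm dirichlet u <= seminorm H1_inner u.
Proof.
move=> Hu; rewrite ler_wsqrtr// lerDr.
by apply: (inner_ge0 sL2); exact: H1_L2.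
Qed.

Lemma H1_norm_le u : H1 Omega u ->
  seminorm H1_inner u <= seminorm ip u + seminorm dirichlet u.
Proof.
move=> Hu; have Lu := H1_L2 Hu.
rewrite -ler_sqr ?nnegrE ?addr_ge0 ?seminorm_ge0//.
rewrite (sqr_seminorm semi_inner_H1_full)// sqrrD.
rewrite (sqr_seminorm sL2)// (sqr_seminorm semi_inner_H1)//.
by rewrite -addrA lerD2l lerDr mulrn_wge0// mulr_ge0 ?seminorm_ge0.
Qed.

Lemma H10_H1 u : H10 Omega u -> H1 Omega u. Proof. by case. Qed.

Lemma test_H10 phi : test phi -> H10 Omega phi.
Proof.
move=> tphi; split; first exact: test_H1.
move=> e e0; exists phi => //; rewrite H1_normE.
have -> : phi \- phi = 0 by apply/funext => x /=; rewrite subrr.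
by rewrite /seminorm (inner0l semi_inner_H1_full) ?sqrtr0//; exact: H1_0.
Qed.

Lemma H10_lin c u v : H10 Omega u -> H10 Omega v -> H10 Omega (c *: u + v).
Proof.
move=> [Hu au] [Hv av]; split; first exact: H1_lin.
move=> e e0; pose k := `|c| + 1; have k0 : 0 < k by rewrite ltr_wpDl.
have e1 : 0 < e / 2 / k by rewrite !divr_gt0.
have e2 : 0 < e / 2 by rewrite divr_gt0.
have [phi tphi hphi] := au _ e1; have [psi tpsi hpsi] := av _ e2.
exists (c *: phi + psi); first exact: test_lin.
have Hp := test_H1 tphi; have Hq := test_H1 tpsi.
have S := semi_inner_H1_full.
have -> : (c *: u + v) \- (c *: phi + psi) = c *: (u - phi) + (v - psi).
  by rewrite scalerBr addrACA -opprD.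
have Hup : H1 Omega (u - phi) := semi_innerB S Hu Hp.
have Hvq : H1 Omega (v - psi) := semi_innerB S Hv Hq.
have hB : seminorm H1_inner (v - psi) < e / 2 by rewrite -H1_normE; exact: hpsi.
have hA : `|c| * seminorm H1_inner (u - phi) < e / 2.
  apply: (@le_lt_trans _ _ (k * seminorm H1_inner (u - phi))).
    by apply: ler_wpM2r; [exact: seminorm_ge0|rewrite lerDl].
  by rewrite mulrC -ltr_pdivlMr// -H1_normE; exact: hphi.
have := seminormD S (semi_innerZ S c Hup) Hvq.
rewrite (seminormZ S c Hup) H1_normE => hD.
by rewrite (splitr e); apply: (le_lt_trans hD); exact: ltrD.
Qed.

Lemma semi_inner_H10 : semi_inner (H10 Omega) dirichlet.
Proof.
have [B0 BD BC BL Bp] := semi_inner_H1; split.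
- by apply: test_H10; exact: test0.
- by move=> c u v; exact: H10_lin.
- by move=> u v /H10_H1 Hu /H10_H1 Hv; exact: BC.
- by move=> c u v w /H10_H1 Hu /H10_H1 Hv /H10_H1 Hw; exact: BL.
- by move=> u /H10_H1; exact: Bp.
Qed.

Lemma seminorm_wp_le i u : H1 Omega u -> seminorm ip (wp i u) <= seminorm dirichlet u.
Proof.
move=> Hu; rewrite ler_wsqrtr// (dirichletE Hu Hu) (bigD1 i)//= lerDl.
by apply: sumr_ge0 => j _; apply: (inner_ge0 sL2); exact: weak_partial_L2.
Qed.

(** A Euclidean norm is at most the sum of its components; this turns convergence of each partial
    derivative into convergence in the Dirichlet seminorm. *)
Lemma dirichlet_norm_le u (g : 'I_N -> 'rV[R]_N -> R) : H1 Omega u ->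
  (forall i, L2O (g i)) ->
  (forall i, {ae leb, forall x, Omega x -> wp i u x = g i x}) ->
  seminorm dirichlet u <= \sum_(i < N) seminorm ip (g i).
Proof.
move=> Hu Lg wg.
have S0 : 0 <= \sum_(i < N) seminorm ip (g i).
  by apply: sumr_ge0 => i _; exact: seminorm_ge0.
rewrite -ler_sqr ?nnegrE ?seminorm_ge0// (sqr_seminorm semi_inner_H1)// (dirichletE Hu Hu).
have -> : \sum_(i < N) ip (wp i u) (wp i u) = \sum_(i < N) seminorm ip (g i) ^+ 2.
  apply: eq_bigr => i _; have Lw := weak_partial_L2 i Hu.
  by rewrite -(seminorm_ae Lw (Lg i) (wg i)) (sqr_seminorm sL2 Lw).
elim: (index_enum _) => [|i s ih]; first by rewrite !big_nil expr0n.
rewrite !big_cons sqrrD -addrA lerD2l (le_trans ih)// lerDr.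
by rewrite mulrn_wge0// mulr_ge0 ?seminorm_ge0// sumr_ge0// => j _; exact: seminorm_ge0.
Qed.

(** Density of test functions in the full H1 norm, which controls both sides; N > 0 provides a
    direction in which to apply [test_poincare]. *)
Lemma poincare : (0 < N)%N -> exists2 C : R, 0 <= C & forall u, H10 Omega u ->
  seminorm ip u <= C * seminorm dirichlet u.
Proof.
move=> N0; have [C C0 hC] := test_poincare oO bO; exists C => // u [Hu au].
pose i : 'I_N := Ordinal N0.
apply/ler_addgt0Pl => e e0; pose k := C + 1; have k0 : 0 < k by rewrite ltr_wpDl.
have [phi tphi hphi] := au _ (divr_gt0 e0 k0).
have Hp := test_H1 tphi; have S := semi_inner_H1_full.
have Hup : H1 Omega (u - phi) by exact: (semi_innerB S).
have Lu := H1_L2 Hu; have Lp := H1_L2 Hp.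
rewrite -[u in seminorm ip u](subrK phi).
rewrite (le_trans (seminormD sL2 _ _))//; first exact: H1_L2.
have h1 := L2_le_H1_norm Hup.
have h2 : seminorm ip phi <= C * seminorm dirichlet phi.
  rewrite (le_trans (hC i _ tphi))// ler_wpM2l//.
  rewrite (le_trans _ (seminorm_wp_le i Hp))//.
  have Lw := weak_partial_L2 i Hp; have Ldp := test_partial_L2 i tphi.
  by rewrite (seminorm_ae Lw Ldp (wp_test i tphi)).
have h3 : seminorm dirichlet phi <= seminorm dirichlet u + seminorm dirichlet (u - phi).
  by rewrite -{1}(subKr u phi) (seminormB semi_inner_H1).
have h4 := dirichlet_le_H1_norm Hup.
have h5 : k * seminorm H1_inner (u - phi) < e.
  by rewrite mulrC -ltr_pdivlMr// -H1_normE.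
have h6 : C * seminorm dirichlet phi <=
    C * (seminorm dirichlet u + seminorm H1_inner (u - phi)).
  by rewrite ler_wpM2l// (le_trans h3)// lerD2l.
exact: (poincare_arith h1 h2 h5 h6).
Qed.

(** By Poincare a Dirichlet-Cauchy sequence is L2-Cauchy, and so are its partial derivatives. For a
    fixed test function the weak derivative identity is continuous in L2, so it passes to the limits
    l and g i. *)
Lemma H10_complete : (0 < N)%N -> seminorm_complete (H10 Omega) dirichlet.
Proof.
move=> N0 u Hu uC; have [C C0 hC] := poincare N0.
have SB := semi_inner_H10; have S1 := semi_inner_H1.
have Hu1 n : H1 Omega (u n) by exact: H10_H1.
have Lu n : L2O (u n) by exact: H1_L2.
have [l Ll ul] : exists2 l, L2O l & forall e, 0 < e -> exists K, forall n, (K <= n)%N ->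
    seminorm ip (u n - l) < e.
  apply: (L2_complete mO muO Lu) => e e0.
  have k0 : 0 < C + 1 by rewrite ltr_wpDl.
  have [K hK] := uC _ (divr_gt0 e0 k0); exists K => m n Km Kn.
  rewrite (le_lt_trans (hC _ (semi_innerB SB (Hu m) (Hu n))))//.
  rewrite (@le_lt_trans _ _ ((C + 1) * seminorm dirichlet (u m - u n)))//.
    by rewrite ler_wpM2r ?seminorm_ge0// lerDl.
  by rewrite mulrC -ltr_pdivlMr// hK.
have Lw i n : L2O (wp i (u n)) by exact: weak_partial_L2.
have wpB i v w : H1 Omega v -> H1 Omega w ->
    {ae leb, forall x, Omega x -> wp i (v - w) x = (wp i v - wp i w) x}.
  move=> Hv Hw; have [Lgv gv] := weak_partialP i Hv; have [Lgw gw] := weak_partialP i Hw.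
  apply: H1_weak_partial; [exact: (semi_innerB S1)|exact: L2B|].
  have := weak_partial_lin (-1) (H1_L2 Hw) (H1_L2 Hv) Lgw Lgv gw gv.
  by rewrite !scaleN1r [- w + v]addrC [- wp i w + _]addrC.
have /choice[g gP] i : exists g, L2O g /\ forall e, 0 < e -> exists K, forall n, (K <= n)%N ->
    seminorm ip (wp i (u n) - g) < e.
  suff [g] : exists2 g, L2O g & forall e, 0 < e -> exists K, forall n, (K <= n)%N ->
    seminorm ip (wp i (u n) - g) < e by exists g.
  apply: (L2_complete mO muO (Lw i)) => e e0.
  have [K hK] := uC _ e0; exists K => m n Km Kn; have := hK m n Km Kn.
  apply: le_lt_trans; have Hmn := semi_innerB S1 (Hu1 m) (Hu1 n).
  rewrite (le_trans _ (seminorm_wp_le i Hmn))//.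
  have Lmn := weak_partial_L2 i Hmn; have LB := L2B mO (Lw i m) (Lw i n).
  by rewrite (seminorm_ae Lmn LB (wpB i _ _ (Hu1 m) (Hu1 n))).
have Lg i : L2O (g i) by case: (gP i).
have ugP i : forall e, 0 < e -> exists K, forall n, (K <= n)%N ->
    seminorm ip (wp i (u n) - g i) < e by case: (gP i).
have ip_small v w phi e : L2O v -> L2O w -> L2O phi ->
    seminorm ip (v - w) <= e -> `|ip v phi - ip w phi| <= e * seminorm ip phi.
  move=> Lv Lw' Lp vw; rewrite -(innerBl sL2)//.
  rewrite (le_trans (inner_CS_norm sL2 (L2B mO Lv Lw') Lp))//.
  by rewrite ler_wpM2r ?seminorm_ge0.
have wl i : is_weak_partial Omega i l (g i).
  apply/is_weak_partialE => phi tphi.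
  have Lp := test_L2 tphi; have Ldp := test_partial_L2 i tphi.
  apply/eqP; rewrite -subr_eq0 -normr_le0; apply/ler_addgt0Pl => e e0; rewrite addr0.
  pose q := seminorm ip phi + seminorm ip (partial i phi) + 1.
  have q0 : 0 < q by rewrite ltr_wpDl// addr_ge0 ?seminorm_ge0.
  have [K1 hK1] := ul _ (divr_gt0 e0 q0); have [K2 hK2] := ugP i _ (divr_gt0 e0 q0).
  pose n := maxn K1 K2.
  have h1 := ip_small _ _ _ _ (Lu n) Ll Ldp (ltW (hK1 n (leq_maxl _ _))).
  have h2 := ip_small _ _ _ _ (Lw i n) (Lg i) Lp (ltW (hK2 n (leq_maxr _ _))).
  have /is_weak_partialE/(_ phi tphi) h3 := (weak_partialP i (Hu1 n)).2.
  rewrite h3 in h1.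
  have h4 : `|ip l (partial i phi) - - ip (g i) phi| <=
      e / q * seminorm ip (partial i phi) + e / q * seminorm ip phi.
    rewrite opprK (_ : _ + _ = (ip l (partial i phi) + ip (wp i (u n)) phi)
      - (ip (wp i (u n)) phi - ip (g i) phi)); last by ring.
    rewrite (le_trans (ler_normB _ _))// lerD//.
    by rewrite -normrN opprD addrC.
  rewrite (le_trans h4)// -mulrDr -[leRHS](@divfK _ q) ?gt_eqF// ler_wpM2l//.
    by apply: divr_ge0; exact: ltW.
  by rewrite /q [leLHS]addrC lerDl.
have Hl : H1 Omega l.
  split; first exact/(mem_Lp2P mO).
  by move=> i; exists (g i) => //; exact/(mem_Lp2P mO).
have wlg i := H1_weak_partial Hl (Lg i) (wl i).
have ulB e : 0 < e -> exists K, forall n, (K <= n)%N -> seminorm dirichlet (u n - l) < e.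
  (* Dividing by N + 1 makes the sum of the N bounds strictly smaller than e. *)
  move=> e0; have eN : 0 < e / N.+1%:R by rewrite divr_gt0.
  have /choice[K hK] i := ugP i _ eN.
  exists (\max_(i < N) K i) => n Kn.
  have Hnl := semi_innerB S1 (Hu1 n) Hl.
  rewrite (le_lt_trans (@dirichlet_norm_le _ (fun i => wp i (u n) - g i) Hnl _ _))//.
  - by move=> i; exact: L2B.
  - move=> i; apply: filterS2 (wpB i _ _ (Hu1 n) Hl) (wlg i) => x h1 h2 Ox.
    by rewrite h1// -[LHS]/(wp i (u n) x - wp i l x) h2.
  rewrite (@le_lt_trans _ _ (\sum_(i < N) e / N.+1%:R))//.
    apply: ler_sum => i _; apply/ltW/hK; rewrite (leq_trans _ Kn)//.
    exact: (leq_bigmax i).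
  rewrite sumr_const card_ord -[ltLHS]mulr_natr -mulrA gtr_pMr// mulrC ltr_pdivrMr// mul1r.
  by rewrite ltr_nat.
exists l => //; split=> // e e0; have S := semi_inner_H1_full.
have e4 : 0 < e / 4 by rewrite divr_gt0.
have e2 : 0 < e / 2 by rewrite divr_gt0.
have [K1 hK1] := ul _ e4; have [K2 hK2] := ulB _ e4.
pose n := maxn K1 K2; have h1 := hK1 n (leq_maxl _ _); have h2 := hK2 n (leq_maxr _ _).
have [_ /(_ _ e2)[phi tphi hphi]] := Hu n.
exists phi => //; have Hp := test_H1 tphi.
(* In the H1 norm the first difference costs less than e/2, namely e/4 each for its L2 and Dirichlet
   parts, and the second less than e/2. *)
have -> : l \- phi = (l - u n) + (u n - phi) by rewrite addrA subrK.
rewrite H1_normE.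
apply: (le_lt_trans (seminormD S (semi_innerB S Hl (Hu1 n)) (semi_innerB S (Hu1 n) Hp))).
rewrite H1_normE in hphi.
rewrite (seminorm_distC S Hl (Hu1 n)).
have h3 := H1_norm_le (semi_innerB S (Hu1 n) Hl).
rewrite (splitr e); apply: ltr_leD; last exact: ltW.
exact: (quarter_arith h3 h1 h2).
Qed.

Lemma dirichlet_eq0 u : (0 < N)%N -> H10 Omega u -> dirichlet u u = 0 ->
  {ae leb, forall x, Omega x -> u x = 0}.
Proof.
move=> N0 Hu u0; have [C C0 /(_ _ Hu)] := poincare N0.
rewrite {2}/seminorm u0 sqrtr0 mulr0 => n0.
have Lu := H1_L2 (H10_H1 Hu); apply: (L2_inner_eq0 mO Lu).
rewrite -(sqr_seminorm sL2)//; apply/eqP; rewrite sqrf_eq0 eq_le n0.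
exact: seminorm_ge0.
Qed.

End sobolev_space.

(** * Boundedness of the linear form defined by f *)

Lemma integral_le_cvg d (T : measurableType d) (R : realType)
    (mu : {measure set T -> \bar R}) (D : set T) (F : nat -> T -> R) (f : T -> R)
    (c : \bar R) : measurable D ->
  (forall n, measurable_fun D (F n)) -> (forall n x, D x -> 0 <= F n x) ->
  (forall x, D x -> F ^~ x @ \oo --> f x) ->
  (forall n, \int[mu]_(x in D) (F n x)%:E <= c)%E ->
  (\int[mu]_(x in D) (f x)%:E <= c)%E.
Proof.
move=> mD mF F0 Ff Fc.
rewrite (eq_integral (fun x => limn_einf (fun n => (F n x)%:E))); last first.
  move=> x /[!inE] Dx.
  suff /cvg_limn_einf_sup[-> _] : (F n x)%:E @[n --> \oo] --> (f x)%:E by [].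
  by apply: cvg_EFin; [exact: nearW|exact: Ff].
apply: (le_trans (fatou mu mD _ _)).
- by move=> n; exact/measurable_EFinP.
- by move=> n x Dx; rewrite lee_fin F0.
rewrite limn_einf_lim; apply: lime_le; first exact: is_cvg_einfs.
apply: nearW => n; apply: le_trans (Fc n).
by apply: ereal_inf_lbound; exists n => /=.
Qed.

Section clip.
Variable R : realType.

(** Truncation of values to [-n, n]: a truncated f is bounded, hence in L2 of the bounded set
    Omega. *)
Definition clip (n : nat) (t : R) : R := Num.max (- n%:R) (Num.min t n%:R).

Lemma clip_near n (t : R) : `|t| <= n%:R -> clip n t = t.
Proof. by rewrite ler_norml /clip => /andP[h1 h2]; rewrite min_l// max_r. Qed.

Lemma clip_le n (t : R) : `|clip n t| <= n%:R.
Proof.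
have n0 : 0 <= n%:R :> R by [].
rewrite ler_norml /clip le_max lexx/= ge_max ge_min lexx orbT andbT.
by rewrite lerNl (le_trans _ n0)// oppr_le0.
Qed.

Lemma clip_le_norm n (t : R) : `|clip n t| <= `|t|.
Proof.
have n0 : 0 <= n%:R :> R by [].
have t1 := ler_norm t; have t2 : - `|t| <= t by rewrite lerNl -normrN ler_norm.
rewrite ler_norml /clip le_max ge_max le_min ge_min t1 t2/= andbT.
have t3 : 0 <= `|t| := normr_ge0 t.
by apply/andP; split; [apply/orP; right; lra|lra].
Qed.

Lemma cvg_clip (t : R) : clip n t @[n --> \oo] --> t.
Proof.
apply: cvg_near_cst; exists (Num.trunc `|t|).+1 => // n /= tn.
rewrite clip_near//; apply/ltW/(lt_le_trans (truncnS_gt _)).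
by rewrite ler_nat.
Qed.

Lemma measurable_clip d (T : measurableType d) (D : set T) n (f : T -> R) :
  measurable_fun D f -> measurable_fun D (fun x => clip n (f x)).
Proof.
move=> mf; apply: measurable_maxr; first exact: measurable_cst.
by apply: measurable_minr => //; exact: measurable_cst.
Qed.

End clip.

Lemma extension_arith (R : realType) (C G e i p d s D E : R) : i <= p + d ->
  p <= C * E -> d <= G * s -> (C + G + 1) * s < e -> C * E <= C * (D + s) ->
  0 <= s -> i <= e + C * D.
Proof. by move=> *; lra. Qed.

Section bounded_functional.
Context {R : realType} {N : nat}.
Local Notation leb := (@lebesgue_rV R N).
Variable Omega : set 'rV[R]_N.
Hypotheses (N0 : (0 < N)%N) (oO : open Omega) (bO : bounded_set Omega).
Variable f : 'rV[R]_N -> R.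
Hypothesis mf : measurable_fun Omega f.

Local Notation test := (test_function Omega).
Local Notation L2O := (L2 leb Omega).
Local Notation ip := (L2_inner leb Omega).
Local Notation dnorm := (seminorm (dirichlet Omega)).
Let mO : measurable Omega. Proof. exact: open_measurable_rV. Qed.
Let muO : (leb Omega < +oo)%E. Proof. exact: Omega_finite. Qed.
Let sL2 : semi_inner L2O ip. Proof. exact: semi_inner_L2. Qed.

Definition source v : R := \int[leb]_(x in Omega) (f x * v x).

Lemma clip_source_L2 n : L2O (fun x => clip n (f x)).
Proof.
apply: (@L2_bounded _ _ _ leb _ mO muO _ n%:R); first exact: measurable_clip.
by move=> x _; exact: clip_le.
Qed.

Lemma clip_source_bounded n : exists C, forall v, H10 Omega v ->
  `|ip (fun x => clip n (f x)) v| <= C * dnorm v.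
Proof.
have [C C0 hC] := poincare oO bO N0.
exists (seminorm ip (fun x => clip n (f x)) * C) => v Hv.
have Lv := H1_L2 oO (H10_H1 Hv).
apply: (le_trans (inner_CS_norm sL2 (clip_source_L2 n) Lv)).
rewrite -mulrA; apply: ler_wpM2l; [exact: seminorm_ge0|exact: hC].
Qed.

(** Density cannot be applied to f itself, which need not be in L2. For |clip n f| the pairing with
    |v| is continuous in the H1 norm, so the bound extends from test functions to v; Fatou then
    removes the truncation and yields integrability of f v as well. *)
Lemma functional_extension (C : R) : 0 <= C ->
  (forall phi, test phi ->
    (\int[leb]_(x in Omega) `|(f x * phi x)%:E| <= (C * dnorm phi)%:E)%E) ->
  forall v, H10 Omega v -> leb.-integrable Omega (fun x => (f x * v x)%:E) /\
    `|source v| <= C * dnorm v.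
Proof.
move=> C0 hC v Hv; have [Hv1 av] := Hv; have Lv := H1_L2 oO Hv1.
have S := semi_inner_H1_full oO bO.
pose F n x := `|clip n (f x)| * `|v x|.
have LF n := L2_norm (clip_source_L2 n).
have mF n : measurable_fun Omega (F n).
  by apply: measurable_funM; [exact: L2_measurable (LF n)|exact: L2_measurable (L2_norm Lv)].
have key n : ip (fun x => `|clip n (f x)|) (fun x => `|v x|) <= C * dnorm v.
  apply/ler_addgt0Pl => e e0.
  set g := fun x => `|clip n (f x)|.
  have Lg : L2O g by exact: LF.
  (* k collects the two costs of replacing v by phi: C from the bound on test functions, the L2 norm
     of g from Cauchy-Schwarz. *)
  pose k := C + seminorm ip g + 1.
  have k0 : 0 < k by rewrite ltr_wpDl// addr_ge0// seminorm_ge0.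
  have [phi tphi hphi] := av _ (divr_gt0 e0 k0).
  have Hp := test_H1 oO bO tphi; have Lp := H1_L2 oO Hp.
  have Hvp : H1 Omega (v - phi) := semi_innerB S Hv1 Hp.
  have Lvp := H1_L2 oO Hvp.
  rewrite H1_normE in hphi.
  have h1 : ip g (fun x => `|v x|) <= ip g (fun x => `|phi x|) + ip g (fun x => `|(v - phi) x|).
    rewrite -(innerDr sL2 (L2_norm Lp) (L2_norm Lvp) Lg).
    rewrite /L2_inner; apply: le_Rintegral => //.
    - by apply: L2_mul => //; exact: L2_norm.
    - by apply: L2_mul => //; exact: (L2D mO (L2_norm Lp) (L2_norm Lvp)).
    - move=> x _; apply: ler_wpM2l; first exact: normr_ge0.
      apply: (@le_trans _ _ (`|phi x| + `|v x - phi x|)); last exact: lexx.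
      by apply: le_trans (ler_normD _ _); rewrite subrKC.
  have h2 : ip g (fun x => `|phi x|) <= C * dnorm phi.
    rewrite -lee_fin; apply: le_trans (hC _ tphi).
    rewrite /L2_inner /Rintegral (fineK (integrable_fin_num mO (L2_mul mO Lg (L2_norm Lp)))).
    apply: ge0_le_integral => //.
    - by move=> x _; rewrite lee_fin; exact: mulr_ge0 (normr_ge0 _) (normr_ge0 _).
    - apply/measurable_EFinP; apply: measurable_funM; first exact: L2_measurable Lg.
      exact: L2_measurable (L2_norm Lp).
    - apply: measurableT_comp => //; apply/measurable_EFinP.
      by apply: measurable_funM => //; exact: L2_measurable Lp.
    - by move=> x _; rewrite lee_fin normrM ler_wpM2r// clip_le_norm.
  have h3 : ip g (fun x => `|(v - phi) x|) <= seminorm ip g * seminorm (H1_inner Omega) (v - phi).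
    apply: (le_trans (ler_norm _)).
    apply: (le_trans (inner_CS_norm sL2 Lg (L2_norm Lvp))).
    apply: ler_wpM2l; first exact: seminorm_ge0.
    have -> : seminorm ip (fun x => `|(v - phi) x|) = seminorm ip (v - phi).
      rewrite /seminorm /L2_inner; congr Num.sqrt.
      by apply: eq_Rintegral => x _; rewrite -!expr2 real_normK ?num_real.
    exact: (L2_le_H1_norm oO bO Hvp).
  have h4 : dnorm phi <= dnorm v + seminorm (H1_inner Omega) (v - phi).
    have h := seminormB (semi_inner_H1 oO bO) Hv1 Hvp; rewrite subKr in h.
    apply: (le_trans h); rewrite lerD2l.
    exact: (dirichlet_le_H1_norm oO Hvp).
  have h5 : k * seminorm (H1_inner Omega) (v - phi) < e by rewrite mulrC -ltr_pdivlMr.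
  have h6 := ler_wpM2l C0 h4.
  have h7 := seminorm_ge0 (H1_inner Omega) (v - phi).
  exact: (extension_arith h1 h2 h3 h5 h6 h7).
have I : (\int[leb]_(x in Omega) `|f x * v x|%:E <= (C * dnorm v)%:E)%E.
  apply: (@integral_le_cvg _ _ _ leb Omega F) => //.
  - by move=> n x _; rewrite mulr_ge0.
  - move=> x _; rewrite normrM; apply: cvgMr_tmp; apply: cvg_norm; exact: cvg_clip.
  - move=> n; rewrite -(fineK (integrable_fin_num mO (L2_mul mO (LF n) (L2_norm Lv)))).
    by rewrite lee_fin; exact: key.
have fi : leb.-integrable Omega (fun x => (f x * v x)%:E).
  apply/integrableP; split; last by apply: (le_lt_trans I); exact: ltry.
  by apply/measurable_EFinP; apply: measurable_funM => //; exact: L2_measurable Lv.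
split => //; rewrite -lee_fin; apply: le_trans I.
rewrite /source /Rintegral -abse_EFin (fineK (integrable_fin_num mO fi)).
by apply: le_abse_integral => //; exact: measurable_int fi.
Qed.

(** The truncated forms are bounded at each v by the integral of |f v|, and by dominated convergence
    their common bound survives in the limit. *)
Lemma functional_uniform_bound :
  (forall v, H10 Omega v -> leb.-integrable Omega (fun x => (f x * v x)%:E)) ->
  exists C, forall v, H10 Omega v -> `|source v| <= C * dnorm v.
Proof.
move=> fi; have SB := semi_inner_H10 oO bO.
have /choice[C hC] := clip_source_bounded.
have fi' v : H10 Omega v -> leb.-integrable Omega (EFin \o (fun x => `|f x * v x|)).
  by move=> /fi/integrable_abse.
have le v n x : `|clip n (f x) * v x| <= `|f x * v x|.
  by rewrite !normrM ler_wpM2r// clip_le_norm.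
have mcv n v : H10 Omega v -> measurable_fun Omega (fun x => clip n (f x) * v x).
  move=> Hv; apply: measurable_funM; first exact: measurable_clip.
  exact: L2_measurable (H1_L2 oO (H10_H1 Hv)).
have [M hM] : exists M, forall n v, H10 Omega v ->
    `|ip (fun x => clip n (f x)) v| <= M * dnorm v.
  apply: (uniform_boundedness SB (H10_complete oO bO N0) _ hC).
    move=> n c u v Hu Hv; have Lu := H1_L2 oO (H10_H1 Hu).
    have Lv := H1_L2 oO (H10_H1 Hv); have Lf := clip_source_L2 n.
    by rewrite (innerDr sL2 (L2Z mO c Lu) Lv Lf) (innerZr sL2 c Lu Lf).
  move=> v Hv; exists (\int[leb]_(x in Omega) `|f x * v x|) => n.
  have Lcv := L2_mul mO (clip_source_L2 n) (H1_L2 oO (H10_H1 Hv)).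
  apply: (le_trans (le_normr_Rintegral mO Lcv)).
  apply: le_Rintegral => //; last exact: fi'.
  by have := integrable_abse Lcv.
exists M => v Hv.
have c : ip (fun x => clip n (f x)) v @[n --> \oo] --> source v.
  apply: (cvg_Rintegral_dominated mO (F := fun n x => clip n (f x) * v x) _ _ _ (fi' _ Hv)).
  - by move=> n; exact: mcv.
  - by apply: measurable_funM => //; exact: L2_measurable (H1_L2 oO (H10_H1 Hv)).
  - by move=> x _; apply: cvgMr_tmp; exact: cvg_clip.
  - by move=> n x _; exact: le.
have h : `|ip (fun x => clip n (f x)) v| @[n --> \oo] --> `|source v| by exact: cvg_norm.
rewrite -(cvg_lim _ h)//; apply: limr_le; first by apply/cvg_ex; eexists; exact: h.
by apply: nearW => n; exact: hM.
Qed.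

End bounded_functional.

Lemma is_derive_comp_partial (R : realType) (N : nat) (i : 'I_N) (g : R -> R)
    (phi : 'rV[R]_N -> R) x dphi dg :
  is_derive (phi x) 1 g dg -> is_derive x (delta_mx 0 i) phi dphi ->
  is_derive x (delta_mx 0 i) (fun y => g (phi y)) (dg * dphi).
Proof.
rewrite -{1 2}(set_coord_id x i) => gd /is_derive_line pd.
rewrite -(set_coord_id x i); apply/is_derive_line.
exact: (@is_derive1_comp _ g (fun h => phi (set_coord x i h))).
Qed.

(** * Sobolev-type inequalities for test functions *)

Section sobolev_inequality.
Context {R : realType}.
Local Notation leb N := (@lebesgue_rV R N).
Local Notation ccs := continuous_compact_support.

Lemma ccs_norm N (g : 'rV[R]_N -> R) : ccs g -> ccs (fun x => `|g x|).
Proof.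
move=> [cg [M hM]]; split; last by exists M => x /hM ->; rewrite normr0.
by move=> x; apply: continuous_comp; [exact: cg|exact: norm_continuous].
Qed.

Lemma ccs_mulr N (g h : 'rV[R]_N -> R) : ccs g -> continuous h ->
  ccs (fun x => g x * h x).
Proof.
move=> [cg [M hM]] ch; split; first exact: continuous_mulf.
by exists M => x /hM ->; rewrite mul0r.
Qed.

Lemma ccs_norm_powR N (g : 'rV[R]_N -> R) p : 0 < p -> ccs g ->
  ccs (fun x => `|g x| `^ p).
Proof.
move=> p0 [cg [M hM]]; split; last first.
  by exists M => x /hM ->; rewrite normr0 powR0// gt_eqF.
move=> x; apply: (@continuous_comp _ _ _ g (fun t => `|t| `^ p)); first exact: cg.
exact: continuous_norm_powR.
Qed.

Section dirichlet_bounds.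
Context {N : nat}.
Variable Omega : set 'rV[R]_N.
Hypotheses (oO : open Omega) (bO : bounded_set Omega).
Local Notation test := (test_function Omega).
Local Notation ip := (L2_inner (leb N) Omega).
Local Notation dnorm := (seminorm (dirichlet Omega)).
Let mO : measurable Omega. Proof. exact: open_measurable_rV. Qed.
Let muO : (leb N Omega < +oo)%E. Proof. exact: Omega_finite. Qed.
Let sL2 : semi_inner (L2 (leb N) Omega) ip. Proof. exact: semi_inner_L2. Qed.

Lemma test_partial_le i phi : test phi -> seminorm ip (partial i phi) <= dnorm phi.
Proof.
move=> tphi; have Hp := test_H1 oO bO tphi.
have Lw := weak_partial_L2 oO i Hp.
have Ldp := ccs_L2 oO bO (test_partial_ccs i tphi).
rewrite -(seminorm_ae oO Lw Ldp (wp_test oO bO i tphi)).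
exact: seminorm_wp_le.
Qed.

Lemma rV_integral_Omega (h : 'rV[R]_N -> R) : (forall x, ~ Omega x -> h x = 0) ->
  rV_integral h = \int[leb N]_(x in Omega) h x.
Proof. by move=> h0; rewrite Rintegral_Omega. Qed.

Lemma seminorm_norm u : seminorm ip (fun x => `|u x|) = seminorm ip u.
Proof.
rewrite /seminorm /L2_inner; congr Num.sqrt.
by apply: eq_Rintegral => x _; rewrite -!expr2 real_normK ?num_real.
Qed.

End dirichlet_bounds.

(** On the line |phi| is at most the integral of |phi'|, hence at most |1| |phi'| in L2 norms; a
    uniformly bounded phi can be paired with an integrable f. *)
Lemma functional_dim1 (Omega : set 'rV[R]_1) (f : 'rV[R]_1 -> R) :
  open Omega -> bounded_set Omega -> (leb 1).-integrable Omega (EFin \o f) ->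
  exists2 C : R, 0 <= C & forall phi, test_function Omega phi ->
    (\int[leb 1]_(x in Omega) `|(f x * phi x)%:E| <=
      (C * seminorm (dirichlet Omega) phi)%:E)%E.
Proof.
move=> oO bO fi; have mO : measurable Omega by exact: open_measurable_rV.
have mf : measurable_fun Omega f by apply/measurable_EFinP; exact: measurable_int fi.
have muO := Omega_finite oO bO; have sL2 := semi_inner_L2 (leb 1) mO.
have L1 := @L2_cst _ _ _ (leb 1) _ mO muO 1.
have nfi : (leb 1).-integrable Omega (EFin \o (fun x => `|f x|)).
  by have := integrable_abse fi.
pose A : R := \int[leb 1]_(x in Omega) `|f x|.
have A0 : 0 <= A by apply: Rintegral_ge0 => x _; exact: normr_ge0.
pose c : R := seminorm (L2_inner (leb 1) Omega) (cst 1).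
exists (A * c) => [|phi tphi]; first by apply: mulr_ge0 => //; exact: seminorm_ge0.
have [cphi [M hM]] := test_ccs tphi; have cdp := test_partial_ccs ord0 tphi.
have Ldp := ccs_L2 oO bO cdp.
pose d : R := seminorm (dirichlet Omega) phi.
have bound x : `|phi x| <= c * d.
  have [sphi _ _] := tphi.
  have h := abs_le_integral_partial (fun x => smooth_is_derive ord0 x sphi) cdp.1 hM x.
  rewrite (integral_rV1_line x (ccs_norm cdp) (fun x => normr_ge0 _)) lee_fin in h.
  apply: (le_trans h); rewrite (@rV_integral_Omega _ Omega); last first.
    by move=> y nOy; rewrite (test_partial_out ord0 tphi nOy) normr0.
  have -> : \int[leb 1]_(x in Omega) `|partial ord0 phi x| =
      L2_inner (leb 1) Omega (cst 1) (fun x => `|partial ord0 phi x|).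
    by apply: eq_Rintegral => y _; rewrite /= mul1r.
  apply: (le_trans (ler_norm _)).
  apply: (le_trans (inner_CS_norm sL2 L1 (L2_norm Ldp))).
  apply: ler_wpM2l; first exact: seminorm_ge0.
  by rewrite seminorm_norm; exact: test_partial_le.
apply: (@le_trans _ _ (\int[leb 1]_(x in Omega) ((c * d)%:E * `|f x|%:E))%E).
  apply: ge0_le_integral => //.
  - apply: measurableT_comp => //; apply/measurable_EFinP; apply: measurable_funM => //.
    by apply: measurable_funTS; exact: continuous_measurable_rV.
  - apply: emeasurable_funM; first exact: measurable_cst.
    by apply/measurable_EFinP; exact: measurableT_comp.
  - by move=> x _; rewrite -EFinM lee_fin normrM mulrC ler_wpM2r.
rewrite ge0_integralZl//; last first.
- by rewrite lee_fin mulr_ge0// seminorm_ge0.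
- by apply/measurable_EFinP; exact: measurableT_comp.
rewrite -(fineK (integrable_fin_num mO nfi)) -EFinM lee_fin.
by rewrite -[X in _ * X]/A mulrC mulrA.
Qed.

(** With N = n + 3, Gagliardo-Nirenberg is applied to |phi|^c, where c = 2 (N-1)/(N-2). This
    exponent satisfies c N/(N-1) = s and 2 (c-1) = s, so the left-hand side and the Cauchy-Schwarz
    factor from the derivative both involve the same integral A of |phi|^s. *)
Lemma sobolev_inequality n (Omega : set 'rV[R]_n.+3) phi (s : R) :
  open Omega -> bounded_set Omega -> test_function Omega phi ->
  s = 2 * n.+3%:R / n.+1%:R ->
  rV_integral (fun x => `|phi x| `^ s) `^ s^-1 <=
  2 * n.+2%:R / n.+1%:R * seminorm (dirichlet Omega) phi.
Proof.
move=> oO bO tphi sE; have mO : measurable Omega by exact: open_measurable_rV.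
have sL2 := semi_inner_L2 (leb n.+3) mO.
pose d : R := seminorm (dirichlet Omega) phi.
pose c : R := 2 * n.+2%:R / n.+1%:R; rewrite -/c.
have n1 : n.+1%:R != 0 :> R by rewrite pnatr_eq0.
have n2 : n.+2%:R != 0 :> R by rewrite pnatr_eq0.
have n3 : n.+3%:R != 0 :> R by rewrite pnatr_eq0.
have s0 : 0 < s by rewrite sE divr_gt0// mulr_gt0.
have c0 : 0 < c by rewrite divr_gt0// mulr_gt0.
have n2E : n.+2%:R = n.+1%:R + 1 :> R by rewrite natr1.
have n3E : n.+3%:R = n.+1%:R + 2 :> R by rewrite -(natrD _ n.+1 2) addn2.
have c2 : 2 < c.
  by rewrite /c ltr_pdivlMr// ltr_pM2l// ltr_nat.
have cs : 2 * (c - 1) = s.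
  by rewrite /c sE n2E n3E; move: n1; move: (n.+1%:R) => x x0; field.
have cp : c * (n.+3%:R / n.+2%:R) = s.
  rewrite /c sE; move: n1 n2; move: (n.+1%:R) (n.+2%:R) (n.+3%:R) => x y z x0 y0.
  by field; rewrite ?x0 ?y0.
clearbody c.
have tc := test_ccs tphi; have [cphi [M hM]] := tc; have [sphi _ _] := tphi.
have d0 : 0 <= d by exact: seminorm_ge0.
have hs := ccs_norm_powR s0 tc.
pose A := rV_integral (fun x => `|phi x| `^ s).
have A0 : 0 <= A by apply: rV_integral_ge0 => x; exact: powR_ge0.
(* |phi|^(c-1) with the sign of phi, so that c q partial_i phi is the derivative of |phi|^c. *)
pose q x := phi x * `|phi x| `^ (c - 2).
have c20 : 0 < c - 2 by rewrite subr_gt0.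
have qE x : `|q x| = `|phi x| `^ (c - 1).
  rewrite /q normrM [X in _ * X]ger0_norm ?powR_ge0//.
  have [->|p0] := eqVneq `|phi x| 0; first by rewrite mul0r powR0// gt_eqF//; lra.
  have -> : c - 1 = 1 + (c - 2) by lra.
  by rewrite [RHS]powRD ?p0 ?implybT// powRr1.
have cq : continuous q.
  by apply: continuous_mulf => //; case: (ccs_norm_powR c20 tc).
have ccsq : ccs q.
  by split => //; exists M => x /hM p0; rewrite /q p0 mul0r.
pose g i x := `|c * q x * partial i phi x|.
have cg i : ccs (g i).
  apply: ccs_norm; apply: ccs_mulr; last exact: (test_partial_ccs i tphi).1.
  rewrite (_ : (fun x => _) = fun x => q x * c); last by apply/funext => x; rewrite mulrC.
  by apply: ccs_mulr => //; exact: cst_continuous.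
have hg i x : (((`|phi x| `^ c)%:E <=
    \int[lebesgue_measure]_t (g i (set_coord x i t))%:E)%E).
  have dP y : is_derive y (delta_mx 0 i) (fun y => `|phi y| `^ c) (c * q y * partial i phi y).
    apply: (is_derive_comp_partial (g := fun t => `|t| `^ c)).
      exact: is_derive_norm_powR.
    exact: smooth_is_derive.
  have cP : continuous (fun y => c * q y * partial i phi y).
    apply: continuous_mulf; last exact: (test_partial_ccs i tphi).1.
    by apply: continuous_mulf => //; exact: cst_continuous.
  have P0 y : M <= `|y| -> `|phi y| `^ c = 0.
    by move=> /hM ->; rewrite normr0 powR0// gt_eqF.
  have := abs_le_integral_partial dP cP P0 x.
  by rewrite ger0_norm// powR_ge0.
have := gagliardo_nirenberg (ccs_measurable (ccs_norm_powR c0 tc))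
  (fun x => powR_ge0 _ _) cg (fun i x => normr_ge0 _) hg.
under eq_integral do rewrite -powRrM cp.
rewrite (ccs_integralE hs) lee_fin -/A => gn.
have Lq := ccs_L2 oO bO ccsq.
have out x : ~ Omega x -> phi x = 0 by exact: test_eq0.
have qA : seminorm (L2_inner (leb n.+3) Omega) q = A `^ 2^-1.
  rewrite powR12_sqrt// /seminorm; congr Num.sqrt.
  rewrite /A (@rV_integral_Omega _ Omega); last first.
    by move=> x /out ->; rewrite normr0 powR0// gt_eqF.
  apply: eq_Rintegral => x _; rewrite -expr2 -real_normK ?num_real// qE.
  by rewrite -powR_mulrn ?powR_ge0// -powRrM mulrC cs.
have gI i : rV_integral (g i) <= c * A `^ 2^-1 * d.
  have Ldp := ccs_L2 oO bO (test_partial_ccs i tphi).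
  rewrite (@rV_integral_Omega _ Omega); last first.
    by move=> x /out p0; rewrite /g /q p0 mul0r mulr0 mul0r normr0.
  have -> : \int[leb n.+3]_(x in Omega) g i x =
      c * L2_inner (leb n.+3) Omega (fun x => `|q x|) (fun x => `|partial i phi x|).
    rewrite /L2_inner -RintegralZl//.
      apply: eq_Rintegral => x _; by rewrite /g normrM [`|c * q x|]normrM (gtr0_norm c0) mulrA.
    exact: L2_mul (L2_norm Lq) (L2_norm Ldp).
  rewrite -mulrA ler_pM2l// (le_trans (ler_norm _))//.
  apply: (le_trans (inner_CS_norm sL2 (L2_norm Lq) (L2_norm Ldp))).
  rewrite !seminorm_norm qA; apply: ler_wpM2l; first exact: powR_ge0.
  exact: test_partial_le.
have {}gn : A <= (c * A `^ 2^-1 * d) `^ (n.+3%:R / n.+2%:R).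
  apply: (le_trans gn).
  apply: (@le_trans _ _ (\prod_(i < n.+3) (c * A `^ 2^-1 * d) `^ n.+2%:R^-1)).
    apply: ler_prod => i _; rewrite powR_ge0/=.
    apply: ge0_ler_powR; rewrite ?invr_ge0 ?nnegrE//.
    + by apply: rV_integral_ge0 => x; exact: normr_ge0.
    + by rewrite !mulr_ge0 ?powR_ge0// ltW.
  by rewrite prodr_const card_ord -powR_mulrn ?powR_ge0// -powRrM [_^-1 * _]mulrC.
have si : s^-1 != 0 by rewrite invr_eq0 gt_eqF.
rewrite -/A -/d; clearbody A d.
have [->|An0] := eqVneq A 0.
  by rewrite powR0//; apply: mulr_ge0 => //; exact: ltW.
have A1 : 0 < A by rewrite lt_neqAle eq_sym An0.
have K0 : 0 <= c * A `^ 2^-1 * d by rewrite !mulr_ge0 ?powR_ge0// ltW.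
have e0 : 0 <= n.+2%:R / n.+3%:R :> R by rewrite divr_ge0.
have : A `^ (n.+2%:R / n.+3%:R) <= c * A `^ 2^-1 * d.
  have := ge0_ler_powR e0 _ _ gn; rewrite !nnegrE => /(_ A0 (powR_ge0 _ _)).
  have one : n.+3%:R / n.+2%:R * (n.+2%:R / n.+3%:R) = 1 :> R.
    by rewrite mulrA divfK// mulfV.
  by rewrite -powRrM one powRr1//; apply.
(* (N-1)/N = 1/2 + 1/s, so the positive factor A^(1/2) cancels and A^(1/s) remains. *)
have -> : n.+2%:R / n.+3%:R = 2^-1 + s^-1 :> R.
  have x0 : n.+1%:R + 2 != 0 :> R by rewrite -n3E.
  rewrite sE n2E n3E; move: n1 x0; move: (n.+1%:R) => x h1 h2.
  by field; rewrite ?h1 ?h2.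
rewrite powRD; last by rewrite An0 implybT.
rewrite [c * _]mulrC -mulrA ler_pM2l//.
by rewrite powR_gt0.
Qed.

End sobolev_inequality.

Section source_functional.
Context {R : realType}.
Local Notation leb N := (@lebesgue_rV R N).

Lemma mem_Lp_measurable N (Omega : set 'rV[R]_N) p f : measurable Omega ->
  mem_Lp Omega p f -> measurable_fun Omega f.
Proof.
move=> mO; rewrite /mem_Lp inE => /andP[+ _]; rewrite inE /= => mf.
exact: (proj2 (measurable_restrictT f mO)).
Qed.

(** Hölder with the conjugate exponents q and s, s being the Sobolev exponent; the Sobolev
    inequality bounds the factor in phi. *)
Lemma functional_dim_ge3 n (Omega : set 'rV[R]_n.+3) (f : 'rV[R]_n.+3 -> R) :
  open Omega -> bounded_set Omega ->
  mem_Lp Omega (dual_sobolev_exponent R n.+3) f ->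
  exists2 C : R, 0 <= C & forall phi, test_function Omega phi ->
    (\int[leb n.+3]_(x in Omega) `|(f x * phi x)%:E| <=
      (C * seminorm (dirichlet Omega) phi)%:E)%E.
Proof.
move=> oO bO Lf; have mO : measurable Omega by exact: open_measurable_rV.
have mf := mem_Lp_measurable mO Lf.
pose s : R := 2 * n.+3%:R / n.+1%:R.
have n3E : n.+3%:R = n.+1%:R + 2 :> R by rewrite -(natrD _ n.+1 2) addn2.
have s1 : 1 < s.
  by rewrite /s ltr_pdivlMr// mul1r -natrM ltr_nat mul2n -addnn; apply: leq_trans (leq_addr _ _).
have s0 : 0 < s by rewrite (lt_trans ltr01).
pose q : R := s / (s - 1).
have qE : dual_sobolev_exponent R n.+3 = q%:E.
  rewrite /dual_sobolev_exponent /sobolev_exponent /= /q /s.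
  by have -> : n.+3%:R - 2 = n.+1%:R :> R by rewrite n3E addrK.
have sE : s = 2 * n.+3%:R / n.+1%:R by [].
rewrite qE /mem_Lp in Lf; clearbody s.
have sm : 0 < s - 1 by rewrite subr_gt0.
have q0 : 0 < q by rewrite divr_gt0.
have q1 : 1 <= q by rewrite /q ler_pdivlMr// mul1r gerBl.
have qs : q^-1 + s^-1 = 1.
  by rewrite /q invf_div; field; rewrite gt_eqF.
set fO := f \_ Omega in Lf.
have fOi := Lfun_integrable q1 Lf.
have mfO : measurable_fun setT fO by exact: (proj1 (measurable_restrictT f mO)).
pose F x := `|fO x| `^ q.
have mF : measurable_fun setT F.
  by apply: measurable_powR_fun; exact: measurableT_comp.
pose K : R := \int[leb n.+3]_x F x.
have KE : (\int[leb n.+3]_x (F x)%:E = K%:E)%E.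
  by rewrite /K /Rintegral fineK//; exact: integrable_fin_num fOi.
have K0 : 0 <= K by apply: Rintegral_ge0 => x _; exact: powR_ge0.
pose c : R := 2 * n.+2%:R / n.+1%:R.
have c0 : 0 <= c by rewrite divr_ge0.
exists (K `^ q^-1 * c) => [|phi tphi]; first by apply: mulr_ge0 => //; exact: powR_ge0.
set d := seminorm _ phi.
have hs := ccs_norm_powR s0 (test_ccs tphi).
pose G x := `|phi x| `^ s.
have GE := ccs_integralE hs.
have sob := sobolev_inequality oO bO tphi sE.
have out x : ~ Omega x -> phi x = 0 by exact: test_eq0.
have -> : (\int[leb n.+3]_(x in Omega) `|(f x * phi x)%:E| =
    \int[leb n.+3]_x (F x `^ q^-1 * G x `^ s^-1)%:E)%E.
  rewrite [LHS]integral_mkcond; apply: eq_integral => x _.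
  rewrite /F /G -!powRrM !mulfV ?gt_eqF// !powRr1// patchE /fO patchE.
  by case: ifPn => _; rewrite ?normr0 ?mul0r// /= normrM.
have si : 0 < s^-1 by rewrite invr_gt0.
have qi : 0 < q^-1 by rewrite invr_gt0.
apply: (le_trans (hoelder_powR (leb n.+3) qi si qs mF (ccs_measurable hs)
  (fun x => powR_ge0 _ _) (fun x => powR_ge0 _ _))).
rewrite KE GE !poweR_EFin -EFinM lee_fin -mulrA.
by apply: ler_wpM2l; [exact: powR_ge0|exact: sob].
Qed.

Lemma mem_L1_integrable N (Omega : set 'rV[R]_N) (f : 'rV[R]_N -> R) :
  measurable Omega -> mem_Lp Omega 1%E f -> (leb N).-integrable Omega (EFin \o f).
Proof.
move=> mO /Lfun1_integrable fi; apply: (proj2 (integrable_mkcond _ mO)).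
rewrite (_ : _ \_ _ = EFin \o (f \_ Omega))//.
by apply/funext => x /=; rewrite !patchE; case: ifP.
Qed.

Lemma source_bounded N (Omega : set 'rV[R]_N) (f : 'rV[R]_N -> R) : (0 < N)%N ->
  open Omega -> bounded_set Omega ->
  mem_Lp Omega (dual_sobolev_exponent R N) f ->
  (N = 2%N -> forall v, H10 Omega v ->
    (leb N).-integrable Omega (fun x => (f x * v x)%:E)) ->
  (forall v, H10 Omega v -> (leb N).-integrable Omega (fun x => (f x * v x)%:E)) /\
  exists C : R, forall v, H10 Omega v ->
    `|source Omega f v| <= C * seminorm (dirichlet Omega) v.
Proof.
move=> N0 oO bO Lf f2; have mO : measurable Omega by exact: open_measurable_rV.
have mf := mem_Lp_measurable mO Lf.
(* Two routes: a bound on test functions yields integrability on H10 by extension, and integrability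
   on H10 yields a bound by uniform boundedness. The first serves N = 1 and N >= 3, the second N =
   2. *)
suff [[C C0 hC]|fi] : (exists2 C : R, 0 <= C & forall phi, test_function Omega phi ->
    (\int[leb N]_(x in Omega) `|(f x * phi x)%:E| <=
      (C * seminorm (dirichlet Omega) phi)%:E)%E) \/
    (forall v, H10 Omega v -> (leb N).-integrable Omega (fun x => (f x * v x)%:E)).
- have h := functional_extension oO bO mf C0 hC.
  by split=> [v /h[]//|]; exists C => v /h[].
- by split=> //; exact: functional_uniform_bound.
case: N Omega f N0 oO bO Lf f2 mO mf => [//|[|[|n]]] Omega f _ oO bO Lf f2 mO mf.
- by left; apply: functional_dim1 => //; exact: mem_L1_integrable.
- by right; exact: f2.
- by left; exact: functional_dim_ge3.
Qed.

End source_functional.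

(** * Solutions and the count of their classes *)

Section null_boxes.
Context {R : realType} {N : nat}.
Local Notation leb := (@lebesgue_rV R N).

(** A nondegenerate box has positive measure. This extracts an actual point from an a.e.
    statement. *)
Lemma box_not_negligible (a b : 'rV[R]_N) (P : 'rV[R]_N -> Prop) :
  (forall i, a 0 i < b 0 i) -> {ae leb, forall x, P x} ->
  exists2 x, rVbox a b x & P x.
Proof.
move=> ab [Z [mZ Z0 PZ]]; apply: contrapT => h.
have : (leb (rVbox a b) <= leb Z)%E.
  apply: le_measure; rewrite ?inE//; first exact: rVbox_measurable.
  by move=> x abx; apply: PZ => /= Px; apply: h; exists x.
rewrite Z0 lebesgue_rVbox// lee_fin leNgt => /negP; apply.
by apply: prodr_gt0 => i _; rewrite subr_gt0.
Qed.

(** Cubes strung along a diagonal from x0: in every coordinate the n-th one spans the interval from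
    r (n+1) to r n beyond x0, and these intervals are disjoint as r decreases. *)
Lemma open_disjoint_boxes (Omega : set 'rV[R]_N) : (0 < N)%N -> open Omega ->
  Omega !=set0 -> exists a b : nat -> 'rV[R]_N, [/\ forall n i, a n 0 i < b n 0 i,
    forall n, rVcbox (a n) (b n) `<=` Omega &
    forall n m, n != m -> forall x, rVbox (a n) (b n) x -> ~ rVbox (a m) (b m) x].
Proof.
move=> N0 oO [x0 Ox0].
have /rV_nbhsP[e e0 he] : nbhs x0 Omega by exact: open_nbhs_nbhs.
(* The denominator n + 2 keeps r n below e already for n = 0. *)
pose r (n : nat) : R := e / n.+2%:R.
have r0 n : 0 < r n by rewrite divr_gt0.
have re n : r n < e by rewrite /r ltr_pdivrMr// ltr_pMr// ltr1n.
have rlt n m : (n < m)%N -> r m < r n.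
  by move=> nm; rewrite /r ltr_pM2l// ltf_pV2 ?posrE// ltr_nat.
exists (fun n => \row_i (x0 0 i + r n.+1)), (fun n => \row_i (x0 0 i + r n)).
have lt n m : (n < m)%N -> forall x : 'rV[R]_N,
    rVbox (\row_i (x0 0 i + r n.+1)) (\row_i (x0 0 i + r n)) x ->
    ~ rVbox (\row_i (x0 0 i + r m.+1)) (\row_i (x0 0 i + r m)) x.
  move=> nm x /(_ (Ordinal N0)); rewrite !mxE => /andP[h1 _] /(_ (Ordinal N0)).
  rewrite !mxE => /andP[_ h2].
  have : r m <= r n.+1.
    by move: nm; rewrite leq_eqVlt => /orP[/eqP <-|/rlt/ltW].
  lra.
split=> [n i|n x xab|n m].
- by rewrite !mxE ltrD2l rlt.
- apply: he => i; have := xab i; rewrite !mxE => /andP[h1 h2].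
  have := re n; have := r0 n.+1 => h3 h4.
  by rewrite ltr_norml; apply/andP; split; lra.
- rewrite neq_ltn => /orP[|] nm x xn xm; first exact: (lt _ _ nm x xn xm).
  exact: (lt _ _ nm x xm xn).
Qed.

End null_boxes.

Section solutions.
Context {R : realType} {N : nat}.
Local Notation leb := (@lebesgue_rV R N).
Variable Omega : set 'rV[R]_N.
Hypotheses (N0 : (0 < N)%N) (oO : open Omega) (bO : bounded_set Omega).
Hypothesis Omega0 : Omega !=set0.
Variables (a b : R).
Hypotheses (a0 : 0 < a) (b0 : 0 < b).
Variable f : 'rV[R]_N -> R.

Local Notation D := (dirichlet Omega).
Let SB : semi_inner (H10 Omega) D. Proof. exact: semi_inner_H10. Qed.
Let mO : measurable Omega. Proof. exact: open_measurable_rV. Qed.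

Lemma ae_class_eq (u u' : 'rV[R]_N -> R) :
  {ae leb, forall x, Omega x -> u x = u' x} -> ae_class Omega u = ae_class Omega u'.
Proof.
move=> uu'; apply/seteqP; split=> v /= uv.
  by apply: filterS2 uu' uv => x h1 h2 Ox; rewrite -h1// h2.
by apply: filterS2 uu' uv => x h1 h2 Ox; rewrite h1// h2.
Qed.

Lemma eq_ae_class (u u' : 'rV[R]_N -> R) : ae_class Omega u = ae_class Omega u' ->
  {ae leb, forall x, Omega x -> u x = u' x}.
Proof.
move=> e; have : ae_class Omega u' u' by exact: aeW.
by rewrite -e.
Qed.

(** Bumps living on disjoint boxes are scaled to square norm a / b; at a point of the n-th box
    outside the exceptional null set only the n-th function is nonzero, which separates the
    classes. *)
Lemma infinite_solution_classes0 : infinite_set (solution_classes Omega a b f 0).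
Proof.
have [l [r [lr lrO dis]]] := open_disjoint_boxes N0 oO Omega0.
pose phi n := box_bump (l n) (r n) 0.
have tphi n : test_function Omega (phi n) by exact: test_function_box_bump.
have phi_gt0 n x : rVbox (l n) (r n) x -> 0 < phi n x by exact: box_bump_gt0.
have phi_eq0 n x : ~ rVbox (l n) (r n) x -> phi n x = 0 by exact: box_bump_eq0.
clearbody phi; have Hphi n : H10 Omega (phi n) by exact: test_H10.
have phin0 n : 0 < D (phi n) (phi n).
  rewrite lt_neqAle (inner_ge0 SB (Hphi n)) andbT eq_sym; apply/eqP => z.
  have := dirichlet_eq0 oO bO N0 (Hphi n) z.
  move=> /(box_not_negligible (lr n))[x xb /(_ (lrO n _ (subset_rVbox_cbox xb)))].
  by apply/eqP; rewrite gt_eqF// phi_gt0.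
pose c n := Num.sqrt (a / b / D (phi n) (phi n)).
have c0 n : 0 < c n by rewrite sqrtr_gt0 !divr_gt0.
pose u n := c n *: phi n.
have Hu n : H10 Omega (u n) by exact: (semi_innerZ SB).
have Du n : D (u n) (u n) = a / b.
  rewrite (innerZl SB _ (Hphi n) (Hu n)) (innerZr SB _ (Hphi n) (Hphi n)).
  rewrite mulrA -expr2 sqr_sqrtr; last by rewrite ltW// !divr_gt0.
  by rewrite divfK// gt_eqF.
have sol n : weak_solution Omega a b f 0 (u n).
  split=> // v Hv; rewrite mul0r.
  have -> : a - b * D (u n) (u n) = 0 by rewrite Du mulrC divfK ?subrr// gt_eqF.
  by rewrite mul0r.
have pos_neq (s t p q : R) : 0 < s -> 0 < p -> q = 0 -> s * p <> t * q.
  by move=> s0 p0 ->; rewrite mulr0; apply/eqP; rewrite mulf_neq0 ?gt_eqF.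
have inj : injective (fun n => ae_class Omega (u n)).
  move=> n m /eq_ae_class e; apply/eqP/negP => /negP nm.
  have [x xb] := box_not_negligible (lr n) e.
  have p0 := phi_gt0 n x xb.
  have q0 := phi_eq0 m x (dis _ _ nm _ xb).
  move=> /(_ (lrO n _ (subset_rVbox_cbox xb))) h.
  exact: (pos_neq _ _ _ _ (c0 n) p0 q0 h).
have : infinite_set ((fun n => ae_class Omega (u n)) @` setT).
  have e : (fun n => ae_class Omega (u n)) @` setT #= [set: nat].
    by apply: inj_card_eq => n m _ _; exact: inj.
  by rewrite (eq_finite_set e); exact: infinite_nat.
apply: sub_infinite_set => _ [n _ <-]; by exists (u n).
Qed.

Hypothesis fpos : {ae leb, forall x, Omega x -> 0 < f x}.
Hypothesis fi : forall v, H10 Omega v -> leb.-integrable Omega (fun x => (f x * v x)%:E).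
Variable w : 'rV[R]_N -> R.
Hypotheses (Hw : H10 Omega w) (wf : forall v, H10 Omega v -> D w v = source Omega f v).

(** If D w w = 0, Cauchy-Schwarz makes the form vanish on a bump phi. Then f phi >= 0 has integral
    zero, although it is positive a.e. on a box. *)
Lemma source_representative_gt0 : 0 < D w w.
Proof.
rewrite lt_neqAle (inner_ge0 SB Hw) andbT eq_sym; apply/eqP => z.
have [l [r [lr lrO _]]] := open_disjoint_boxes N0 oO Omega0.
pose phi := box_bump (l 0%N) (r 0%N) 0.
have tphi : test_function Omega phi by exact: test_function_box_bump.
have Hphi : H10 Omega phi by exact: test_H10.
have s0 : source Omega f phi = 0.
  rewrite -(wf Hphi); apply/eqP; rewrite -normr_le0.
  apply: (le_trans (inner_CS_norm SB Hw Hphi)).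
  by rewrite /seminorm z sqrtr0 mul0r.
have ifp := fi Hphi.
have nfp : leb.-integrable Omega (EFin \o (fun x => `|f x * phi x|)).
  by have := integrable_abse ifp.
have n0 : \int[leb]_(x in Omega) `|f x * phi x| = 0.
  rewrite -[RHS]s0 /source /Rintegral; congr fine; apply: ae_eq_integral => //.
  - exact: measurable_int nfp.
  - exact: measurable_int ifp.
  - apply: filterS fpos => x h Ox /=; rewrite ger0_norm// mulr_ge0//.
      by rewrite ltW// h.
    exact: box_bump_ge0.
have := Rintegral_ge0_eq0 mO nfp (fun x _ => normr_ge0 _) n0.
move=> /(filterS2 _ _) h.
have : {ae leb, forall x, Omega x -> 0 < f x /\ `|f x * phi x| = 0}.
  by apply: (h _ _ _ fpos) => x h1 h2 Ox; split; [exact: h2|exact: h1].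
move=> /(box_not_negligible (lr 0%N))[x xb /(_ (lrO 0%N _ (subset_rVbox_cbox xb)))].
case=> fx /normr0P; apply/negP; rewrite mulf_neq0 ?gt_eqF//.
exact: box_bump_gt0.
Qed.

Lemma solution_classesE mu : mu != 0 -> solution_classes Omega a b f mu =
  (fun t => ae_class Omega (t *: w)) @` cubic_roots a (b * D w w) mu.
Proof.
move=> mu0; have w0 := source_representative_gt0.
have Htw t : H10 Omega (t *: w) by exact: (semi_innerZ SB).
have Dtw t : D (t *: w) (t *: w) = t ^+ 2 * D w w.
  by rewrite (innerZl SB _ Hw (Htw t)) (innerZr SB _ Hw Hw) mulrA.
have div_eq (k m x y : R) : k != 0 -> k * x = m * y -> x = m / k * y.
  by move=> k0 kx; apply: (mulfI k0); rewrite kx mulrA mulrCA mulfV// mulr1.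
apply/seteqP; split=> [_ [u [Hu su] <-]|_ [t ht <-]].
  pose k := a - b * D u u.
  have {}su v : H10 Omega v -> k * D u v = mu * D w v.
    by move=> Hv; rewrite (wf Hv); exact: su.
  (* Testing the equation with w itself gives k D u w = mu D w w, which is nonzero. *)
  have k0 : k != 0.
    apply/eqP => k0; have := su w Hw; rewrite k0 mul0r => /esym/eqP.
    by rewrite mulf_eq0 (negbTE mu0) gt_eqF.
  pose t := mu / k.
  (* Once the number k is fixed the equation is linear: u and (mu / k) w have equal pairings on H10,
     so their difference has Dirichlet norm zero and vanishes a.e. *)
  have ut : {ae leb, forall x, Omega x -> u x = (t *: w) x}.
    have Hd : H10 Omega (u - t *: w) := semi_innerB SB Hu (Htw t).
    have z : D (u - t *: w) (u - t *: w) = 0.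
      rewrite (innerBl SB Hu (Htw t) Hd) (innerZl SB _ Hw Hd).
      by apply/eqP; rewrite subr_eq0; apply/eqP; exact: div_eq (k0) (su _ Hd).
    apply: filterS (dirichlet_eq0 oO bO N0 Hd z) => x h Ox.
    by apply/eqP; rewrite -subr_eq0; apply/eqP; exact: h Ox.
  exists t; last by apply/esym; exact: ae_class_eq.
  have kE : k = a - b * D w w * t ^+ 2.
    have z v : H10 Omega v -> D u v = D (t *: w) v.
      by move=> Hv; rewrite (innerZl SB _ Hw Hv); exact: div_eq (k0) (su v Hv).
    by rewrite /k (inner_diag_eq SB Hu (Htw t) z) Dtw -mulrA [t ^+ 2 * _]mulrC.
  by rewrite /cubic_roots /= -kE /t mulrC divfK.
exists (t *: w); last by [].
split; [exact: Htw|move=> v Hv].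
suff : (a - b * D (t *: w) (t *: w)) * D (t *: w) v = mu * source Omega f v by [].
by rewrite -(wf Hv) Dtw (innerZl SB _ Hw Hv) -ht mulrA -mulrA [t ^+ 2 * _]mulrC !mulrA.
Qed.

(** Distinct multiples of w lie in distinct classes: otherwise w = 0 a.e., and D w w, being the
    integral of f w, would be zero. *)
Lemma card_solution_classes mu : mu != 0 ->
  solution_classes Omega a b f mu #= cubic_roots a (b * D w w) mu.
Proof.
move=> mu0; rewrite solution_classesE//; apply: inj_card_eq => s t _ _ /eq_ae_class st.
apply/eqP; rewrite -subr_eq0; apply/eqP/eqP; apply: contraT => st0.
have w0 := source_representative_gt0.
suff : D w w = 0 by move/eqP; rewrite gt_eqF.
have wz : {ae leb, forall x, Omega x -> w x = 0}.
  apply: filterS st => x h Ox; apply: (mulfI st0).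
  by rewrite mulr0 mulrBl; apply/eqP; rewrite subr_eq0; apply/eqP; exact: h Ox.
rewrite (wf Hw) /source /Rintegral (ae_eq_integral (cst 0%E))//.
- by rewrite integral0.
- exact: measurable_int (fi Hw).
- by apply: filterS wz => x h Ox /=; rewrite h// mulr0.
Qed.

End solutions.

(* hf2: for N = 2 membership in L^1 does not make the integral of f v in the
   definition of a weak solution converge; for N <> 2 it is automatic. *)
Theorem theorem1p2 (R : realType) (N : nat) (hN : (1 <= N)%N)
  (Omega : set 'rV[R]_N) (hOmega : bounded_domain Omega)
  (hboundary : smooth_boundary Omega)
  (a b : R) (ha : 0 < a) (hb : 0 < b)
  (f : 'rV[R]_N -> R) (hf : mem_Lp Omega (dual_sobolev_exponent R N) f)
  (hfpos : {ae @lebesgue_rV R N, forall x, Omega x -> 0 < f x})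
  (hf2 : N = 2%N -> forall v, H10 Omega v ->
    (@lebesgue_rV R N).-integrable Omega (fun x => (f x * v x)%:E)) :
  (exists mustar : R,
    [/\ 0 < mustar,
        forall mu, 0 < `|mu| < mustar ->
          solution_classes Omega a b f mu #= `I_3,
        forall mu, mu = mustar \/ mu = - mustar ->
          solution_classes Omega a b f mu #= `I_2
      & forall mu, mustar < `|mu| ->
          solution_classes Omega a b f mu #= `I_1]) /\
  infinite_set (solution_classes Omega a b f 0).
Proof.
have [oO _ Omega0 bO] := hOmega.
have mO : measurable Omega by exact: open_measurable_rV.
have [fi [C hC]] := source_bounded hN oO bO hf hf2.
have SB := semi_inner_H10 oO bO.
have lin : linear_on (H10 Omega) (source Omega f).
  move=> c u v Hu Hv; have fu := fi u Hu; have fv := fi v Hv.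
  have cfu := integrableZl mO c fu.
  rewrite /source -RintegralZl// -RintegralD//.
  rewrite /Rintegral; congr fine; apply: eq_integral => x _; congr EFin.
  by rewrite mulrCA -mulrDr.
have [w Hw wf] := riesz_representation SB (H10_complete oO bO hN) lin hC.
have w0 := source_representative_gt0 hN oO bO Omega0 hfpos fi Hw wf.
have card := card_solution_classes hN oO bO Omega0 a b hfpos fi Hw wf.
(* The cubic has c = b D w w, positive because D w w is. *)
have [mustar [mustar0 three two one]] := card_cubic_roots ha (mulr_gt0 hb w0).
split; last exact: infinite_solution_classes0.
exists mustar; split=> // mu hmu; apply: card_eq_trans.
- by apply: card; rewrite -normr_gt0; case/andP: hmu.
- exact: three.
- by apply: card; case: hmu => ->; rewrite ?oppr_eq0 gt_eqF.
- exact: two.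
- by apply: card; rewrite -normr_gt0 (lt_trans mustar0).
- exact: one.
Qed.
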